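(* Let $d\ge1$ and $\psi\in C_0^\infty(-1,1)$. For $\kappa\in\mathbb{R}$, $\varepsilon>0$ and $(x,t)\in\mathbb{R}^d\times\mathbb{R}$ let $$\mathcal K_{\kappa,\varepsilon}(x,t)=\int_{\mathbb{R}^d}e^{i(x\cdot\xi+t\langle\xi\rangle)}\,\psi(\varepsilon|\xi|)\,(1+|\xi|^2)^{-\frac{d+2}4-i\kappa}\,d\xi.$$ There exist constants $C<\infty$ and $N>0$ such that $$|\mathcal K_{\kappa,\varepsilon}(x,t)|\le C(1+|\kappa|)^N|t|^{-\frac d2}$$ for all $\kappa\in\mathbb{R}$, $\varepsilon>0$ and $(x,t)\in\mathbb{R}^d\times\mathbb{R}$.
   Context: $\langle\xi\rangle=(1+|\xi|^2)^{1/2}$. The constants $C,N$ may depend on $d$ and $\psi$ but not on $\kappa,\varepsilon,x,t$. For $t=0$ the right-hand side is interpreted as $+\infty$. *)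

(* Defs.v *)
From HB Require Import structures.
From mathcomp Require Import all_boot all_order all_algebra.
From mathcomp Require Import complex.
From mathcomp Require Import all_classical all_reals all_analysis.

Set Implicit Arguments.
Unset Strict Implicit.
Unset Printing Implicit Defensive.

Import Order.TTheory GRing.Theory Num.Theory numFieldNormedType.Exports.

Local Open Scope classical_set_scope.
Local Open Scope ring_scope.

(* Points of R^n, with the product of the n Borel sigma-algebras on R. *)
Notation euclid R n := (n.-tuple (measurableTypeR R)).

Section lebesgue_measure_n.
Context {R : realType}.
Local Open Scope ereal_scope.

Definition cons_pair n (p : measurableTypeR R * euclid R n) : euclid R n.+1 :=
  [tuple of p.1 :: p.2].

(* Lebesgue measure on the Borel sets of R^n: the n-fold product of the Lebesgue
   measure of R, carried to tuples; see lebesgue_measuren_box. *)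
Fixpoint lebesgue_measuren n : set (euclid R n) -> \bar R :=
  match n with
  | 0 => dirac ([tuple] : euclid R 0)
  | m.+1 => pushforward (lebesgue_measure \x @lebesgue_measuren m) (@cons_pair m)
  end.

Lemma measurable_cons_pair n : measurable_fun [set: _] (@cons_pair n).
Proof. by apply: measurable_cons. Qed.

Lemma sigma_finite_measure_of d (T : measurableType d)
    (nu : set T -> \bar R) : nu set0 = 0 -> (forall A, 0 <= nu A) ->
    semi_sigma_additive nu -> sigma_finite [set: T] nu ->
  {mu : {sigma_finite_measure set T -> \bar R} | mu = nu :> (set T -> \bar R)}.
Proof.
move=> nu0 nu_ge0 nuS nuF.
pose nuM := isMeasure.Build _ _ R nu nu0 nu_ge0 nuS.
pose nu_measure : {measure set T -> \bar R} := HB.pack nu nuM.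
pose nuSF := @Measure_isSigmaFinite.Build _ _ R nu_measure nuF.
by exists (HB.pack_for {sigma_finite_measure set T -> \bar R} nu nuM nuSF).
Qed.

Lemma product_sigma_finite d1 d2 (T1 : measurableType d1)
    (T2 : measurableType d2) (m1 : {sigma_finite_measure set T1 -> \bar R})
    (m2 : {sigma_finite_measure set T2 -> \bar R}) :
  sigma_finite [set: T1 * T2] (m1 \x m2).
Proof.
have /sigma_finiteP[F [TF ndF Foo]] := sigma_finiteT m1.
have /sigma_finiteP[G [TG ndG Goo]] := sigma_finiteT m2.
exists (fun n => F n `*` G n).
  rewrite -setXTT TF TG predeqE => -[x y]; split.
    move=> [/= [n _ Fnx] [k _ Gky]]; exists (maxn n k) => //; split.
    - by move: x Fnx; exact/subsetPset/ndF/leq_maxl.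
    - by move: y Gky; exact/subsetPset/ndG/leq_maxr.
  by move=> [n _ []/= ? ?]; split; exists n.
move=> k; have [? ?] := Foo k; have [? ?] := Goo k.
split; first exact: measurableX.
by rewrite product_measure1E// lte_mul_pinfty// ge0_fin_numE.
Qed.

Lemma lebesgue_measuren_sigma_finite_measure n :
  {mu : {sigma_finite_measure set (euclid R n) -> \bar R} |
    mu = @lebesgue_measuren n :> (set _ -> _)}.
Proof.
elim: n => [|n [mu muE]].
  by exists (dirac ([tuple] : euclid R 0)).
rewrite /= -muE.
apply: sigma_finite_measure_of.
- by rewrite /pushforward preimage_set0 measure0.
- by move=> A; rewrite /pushforward; exact: measure_ge0.
- move=> F mF tF mUF; rewrite /pushforward preimage_bigcup.
  apply: measure_semi_sigma_additive.
  + by move=> i; rewrite -[X in measurable X]setTI; exact: measurable_cons_pair.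
  + apply/trivIsetP => /= i j _ _ ij; rewrite -preimage_setI.
    by move/trivIsetP : tF => /(_ _ _ _ _ ij) ->//; rewrite preimage_set0.
  + rewrite -preimage_bigcup -[X in measurable X]setTI.
    exact: measurable_cons_pair.
have [F UF mF] := product_sigma_finite lebesgue_measure mu.
pose g (x : euclid R n.+1) : measurableTypeR R * euclid R n :=
  (thead x, [tuple of behead x]).
have mg : measurable_fun [set: _] g.
  apply/measurable_fun_pairP; split.
    exact: measurable_tnth.
  exact: measurable_behead.
have gK p : g (cons_pair p) = p.
  by case: p => x y; congr pair; apply/val_inj.
exists (fun k => g @^-1` F k).
  by rewrite -preimage_bigcup -UF preimage_setT.
move=> k; have [mFk Fk] := mF k; split.
  by rewrite -[X in measurable X]setTI; exact: mg.
rewrite /pushforward -comp_preimage.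
by rewrite (_ : g \o _ = id) ?preimage_id //; apply/funext => p /=; exact: gK.
Qed.

Let mu0 n : @lebesgue_measuren n set0 = 0.
Proof. by have [mu <-] := lebesgue_measuren_sigma_finite_measure n. Qed.

Let mu_ge0 n A : 0 <= @lebesgue_measuren n A.
Proof. by have [mu <-] := lebesgue_measuren_sigma_finite_measure n. Qed.

Let mu_sigma_additive n : semi_sigma_additive (@lebesgue_measuren n).
Proof.
have [mu <-] := lebesgue_measuren_sigma_finite_measure n.
exact: measure_semi_sigma_additive.
Qed.

HB.instance Definition _ n := isMeasure.Build _ _ R
  (@lebesgue_measuren n) (mu0 n) (@mu_ge0 n) (@mu_sigma_additive n).

Let mu_sigma_finite n : sigma_finite [set: _] (@lebesgue_measuren n).
Proof.
by have [mu <-] := lebesgue_measuren_sigma_finite_measure n; exact: sigma_finiteT.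
Qed.

HB.instance Definition _ n := Measure_isSigmaFinite.Build _ _ R
  (@lebesgue_measuren n) (@mu_sigma_finite n).

Lemma measurable_box n (A : 'I_n -> set (measurableTypeR R)) :
  (forall i, measurable (A i)) ->
  measurable [set x : euclid R n | forall i, A i (tnth x i)].
Proof.
move=> mA.
rewrite (_ : [set _ | _] =
    \bigcap_(i in [set: 'I_n]) ((fun x : euclid R n => tnth x i) @^-1` A i)).
  apply: fin_bigcap_measurable => [|i _]; first exact: finite_finset.
  by rewrite -[X in measurable X]setTI; exact: measurable_tnth.
by apply/seteqP; split=> x /= Ax i; [move=> _|]; exact: Ax.
Qed.

Lemma lebesgue_measuren_box n (A : 'I_n -> set (measurableTypeR R)) :
  (forall i, measurable (A i)) ->
  lebesgue_measuren [set x : euclid R n | forall i, A i (tnth x i)] =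
    \prod_(i < n) lebesgue_measure (A i).
Proof.
elim: n A => [|n IHn] A mA.
  rewrite big_ord0 /= diracE; case: (boolP (_ \in _)) => // /negP[].
  by rewrite inE => -[].
rewrite big_ord_recl -IHn => [|i]; last exact: mA.
transitivity ((lebesgue_measure \x @lebesgue_measuren n)
    (A ord0 `*` [set x | forall i, A (lift ord0 i) (tnth x i)])); last first.
  apply: product_measure1E; first exact: mA.
  by apply: (@measurable_box n (fun i => A (lift ord0 i))) => i; exact: mA.
rewrite /= /pushforward; congr (product_measure1 _ _ _).
apply/seteqP; split=> -[x y] /= => [Axy|[Ax Ay] i].
  by split=> [|i]; [exact: (Axy ord0)|have := Axy (lift ord0 i); rewrite tnthS].
by have [j ->|->] := unliftP ord0 i; [rewrite tnthS; exact: Ay|exact: Ax].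
Qed.

End lebesgue_measure_n.
Arguments lebesgue_measuren {R n}.

Section complex_functions.
Context {R : realType}.
Local Open Scope complex_scope.

Definition expC (z : R[i]) : R[i] :=
  (expR (complex.Re z) * cos (complex.Im z)) +i*
  (expR (complex.Re z) * sin (complex.Im z)).

(* a ^ z for a > 0 *)
Definition powRC (a : R) (z : R[i]) : R[i] := expC (z * (ln a)%:C).

Definition Cintegral d (T : measurableType d) (mu : {measure set T -> \bar R})
    (f : T -> R[i]) : R[i] :=
  (\int[mu]_x complex.Re (f x)) +i* (\int[mu]_x complex.Im (f x)).

Definition smooth (f : R -> R) := forall n x, derivable (derive1n n f) x 1.

(* C_0^oo(a, b), each function being extended by 0 to the real line *)
Definition C0infty (a b : R) (f : R -> R[i]) :=
  let supp := closure [set x : R | f x != 0] in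
  [/\ smooth (fun x => complex.Re (f x)), smooth (fun x => complex.Im (f x)),
      compact supp & supp `<=` `]a, b[ ].

End complex_functions.

Section kernel.
Context {R : realType} {d : nat}.
Implicit Types x xi : euclid R d.
Local Open Scope complex_scope.

Definition dotr x xi : R := \sum_(i < d) (tnth x i : R) * tnth xi i.

Definition enorm xi : R := Num.sqrt (dotr xi xi).

Definition jbracket xi : R := Num.sqrt (1 + enorm xi ^+ 2).

Definition kernelK (psi : R -> R[i]) (kappa eps : R) x (t : R) : R[i] :=
  Cintegral lebesgue_measuren (fun xi : euclid R d =>
    expC (0 +i* (dotr x xi + t * jbracket xi)) * psi (eps * enorm xi) *
    powRC (1 + enorm xi ^+ 2) ((- ((d%:R + 2) / 4)) -i* kappa)).

End kernel.

(* Main.v *)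
Require Import Defs.
From mathcomp Require Import all_boot all_order all_algebra.
From mathcomp Require Import complex ring lra.
From mathcomp Require Import all_classical all_reals all_analysis.
From mathcomp Require Import measurable_realfun.

Import Order.TTheory GRing.Theory Num.Theory numFieldNormedType.Exports.
Local Open Scope classical_set_scope.
Local Open Scope ring_scope.

Set Implicit Arguments.
Unset Strict Implicit.
Unset Printing Implicit Defensive.

(** Write A = <xi>, h = t A + x.xi and X = |x|, and take t > 0; the case t < 0
    follows by complex conjugation.  The bound has to be uniform in kappa, eps
    and x, and it is obtained from three ideas.

    Removing psi and eps.  Repeated integration by parts in one variable
    (superposition) writes psi(r), for r >= 0, as the integral over rho in
    ]0, 1] of (1 - (r / rho)^2)_+^(N+1) g(rho) with g continuous.  By Fubini it
    suffices to bound, uniformly in delta = (eps / rho)^2, the integrals with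
    cutoff (1 - delta |xi|^2)_+^(N+1) in place of psi(eps |xi|); here
    N = 2 (d + 1).  If delta > max(1, t) the measure of the support, of order
    delta^(-d/2), is small enough (cutoff_trivial).

    Gaining from the oscillation.  If delta <= max(1, t), integrate by parts N
    times along a vector field W adapted to the phase, for which W h = k >= 0.
    When X < t, W is the gradient of h for the hyperbolic metric on the sheet
    A^2 = 1 + |xi|^2, divided by h + s with s = sqrt(t^2 - X^2), and k = h - s.
    When X >= t, W is the boost (A / X) x.grad, and k = X A + (t / X) x.xi.  What
    this choice gains is algebraic: A, k, the divergence of W and the cutoff
    satisfy closed systems of differential equations along W, so they are symbols
    (in the sense of symbol) with constants that depend on d alone, each
    derivative costing at most omega = sqrt(1 + k).  As each integration by
    parts divides by 1 + k = omega^2, it gains 1 / omega, at the cost of a factor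
    1 + |kappa| coming from the logarithmic phase kappa ln(A^2)
    (oscillatory_bound, amplitude_bound).  What remains is the integral of
    A^(-d/2-1) (1 + k)^(-d-1).

    Integrating the gain.  (1 + k)^(-d-1) is dominated by an average of m^d
    exp(-m k) over 0 < m <= 1, so it is enough to know that the integral of
    A^(-d/2-1) exp(-(t A + x.xi)) is at most C t^(-d/2) exp(-s)
    (laplace_bound).  For this A^(-d/2-1) exp(-t A) is dominated by an integral
    of Gaussians exp(-tau^2 A^2 - t^2 / (4 tau^2)) in tau, and the integrals
    over xi and then tau are explicit.  The exponent d/2 + 1 of the weight is
    exactly the one that produces t^(-d/2). *)

(** * Affine changes of variables *)

Section pushforward.
Context d1 d2 (T1 : measurableType d1) (T2 : measurableType d2) (R : realType).
Variables (m : {measure set T1 -> \bar R}) (f : T1 -> T2).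
Hypothesis mf : measurable_fun [set: T1] f.

(** The measure structure of a pushforward depends on a proof of measurability, which
    is an argument here. *)
Definition pushforward_measure : {measure set T2 -> \bar R} :=
  measure_function_pushforward__canonical__measure_function_Measure m mf.

End pushforward.

Section affine.
Context {R : realType}.
Local Open Scope ereal_scope.
Local Notation mu := (@lebesgue_measure R).

Definition aff1 (r a : R) (y : measurableTypeR R) : measurableTypeR R := (r * y + a)%R.

Lemma measurable_aff1 r a : measurable_fun setT (aff1 r a).
Proof.
by apply: measurable_funD => //; apply: measurable_funM => //; exact: measurable_id.
Qed.

(** Lebesgue measure is characterised by its values on intervals, so it is enough to
    compare the two measures there. *)
Lemma pushforward_aff1 (r a : R) (r0 : (0 < r)%R) A : measurable A ->
  pushforward mu (aff1 r a) A = (r^-1)%:E * mu A.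
Proof.
move=> mA.
have r0' : (0 <= r^-1)%R by rewrite invr_ge0 ltW.
pose m := pushforward_measure mu (measurable_aff1 r a).
have mE B : measurable B -> mu B = mscale (NngNum (ltW r0)) m B.
  apply: lebesgue_measure_unique => _ [[u v] _ <-].
  transitivity (r%:E * mu `]((u - a) / r)%R, ((v - a) / r)%R]%classic); last first.
    congr (_ * mu _).
    apply/esym/seteqP; split => y /=; rewrite !in_itv /= /aff1 => /andP[h1 h2].
      by rewrite ltr_pdivrMr// ler_pdivlMr// ltrBlDr lerBrDr ![(y * r)%R]mulrC h1 h2.
    by move: h1 h2; rewrite ltr_pdivrMr// ler_pdivlMr// ltrBlDr lerBrDr ![(y * r)%R]mulrC => -> ->.
  rewrite !lebesgue_measure_itv /= !lte_fin ltr_pM2r ?invr_gt0// ltrD2r.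
  case: ifPn => _; last by rewrite mule0.
  rewrite -EFinM; congr EFin; field; exact: lt0r_neq0.
rewrite mE// /mscale /= muleA -EFinM mulVf ?mul1e//; exact: lt0r_neq0.
Qed.

Lemma ge0_integral_aff1 (r a : R) (r0 : (0 < r)%R) (f : measurableTypeR R -> \bar R) :
  measurable_fun setT f -> (forall x, 0 <= f x) ->
  \int[mu]_x f (aff1 r a x) = (r^-1)%:E * \int[mu]_x f x.
Proof.
move=> mf f0.
have r0' : (0 <= r^-1)%R by rewrite invr_ge0 ltW.
rewrite -(@ge0_integral_mscale _ _ _ mu _ measurableT (NngNum r0'))//.
rewrite -[LHS](@ge0_integral_pushforward _ _ _ _ _ _ (measurable_aff1 r a) mu setT)//.
pose m := pushforward_measure mu (measurable_aff1 r a).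
apply: (@eq_measure_integral _ _ _ _ (mscale (NngNum r0') mu) m) => A mA _.
exact: pushforward_aff1.
Qed.

End affine.

Section tuples.
Context {R : realType}.
Local Open Scope ereal_scope.
Local Notation mu := (@lebesgue_measure R).
Local Notation mun n := (@lebesgue_measuren R n).

Lemma ge0_integral_lebesgueS n (f : euclid R n.+1 -> \bar R) :
  measurable_fun setT f -> (forall x, 0 <= f x) ->
  \int[mun n.+1]_x f x = \int[mu]_x \int[mun n]_y f (cons_pair (x, y)).
Proof.
move=> mf f0.
transitivity (\int[mu \x mun n]_p f (cons_pair p)).
  rewrite -[RHS](@ge0_integral_pushforward _ _ _ _ _ _ (@measurable_cons_pair R n) (mu \x mun
    n) setT)//.
rewrite fubini_tonelli1//.
by apply: measurableT_comp => //; exact: measurable_cons_pair.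
Qed.

Definition aff n (r : R) (a xi : euclid R n) : euclid R n :=
  [tuple aff1 r (tnth a i) (tnth xi i) | i < n].

Lemma aff_cons n r x (a y : euclid R n) u :
  aff r (cons_pair (u, a)) (cons_pair (x, y)) = cons_pair (aff1 r u x, aff r a y).
Proof.
apply/eq_from_tnth => i; rewrite tnth_mktuple.
by have [j ->|->] := unliftP ord0 i; rewrite ?tnthS ?tnth_mktuple.
Qed.

Lemma measurable_aff n r a : measurable_fun setT (@aff n r a).
Proof.
apply/measurable_fun_tnthP => i.
rewrite (_ : _ \o _ = (aff1 r (tnth a i) \o (fun x => tnth x i))); last first.
  by apply/funext => x /=; rewrite tnth_mktuple.
by apply: measurableT_comp; [exact: measurable_aff1|exact: measurable_tnth].
Qed.

(** Induction on the dimension, one coordinate at a time through the iterated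
    integral. *)
Lemma ge0_integral_aff n (r : R) (a : euclid R n) (r0 : (0 < r)%R) (f : euclid R n -> \bar R) :
  measurable_fun setT f -> (forall x, 0 <= f x) ->
  \int[mun n]_x f (aff r a x) = (r^-1 ^+ n)%:E * \int[mun n]_x f x.
Proof.
elim: n a f => [|n IHn] a f mf f0.
  rewrite expr0 mul1e; apply: eq_integral => x _; congr f; apply/eq_from_tnth => -[]//.
rewrite ge0_integral_lebesgueS//; last first.
  by apply: measurableT_comp => //; exact: measurable_aff.
have aE : a = cons_pair (thead a, [tuple of behead a]) by rewrite {1}[a]tuple_eta.
have mfc x : measurable_fun setT (fun y => f (cons_pair (x, y))).
  apply: measurableT_comp => //; apply: (measurableT_comp (@measurable_cons_pair R n)).
  exact: pair1_measurable.
transitivity (\int[mu]_x \int[mun n]_y f (cons_pair (aff1 r (thead a) x, aff r [tuple of behead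
  a] y))).
  by apply: eq_integral => x _; apply: eq_integral => y _; rewrite {1}aE aff_cons.
transitivity (\int[mu]_x ((r^-1 ^+ n)%:E * \int[mun n]_y f (cons_pair (aff1 r (thead a) x, y)))).
  apply: eq_integral => x _.
  by rewrite (IHn _ (fun y => f (cons_pair (aff1 r (thead a) x, y)))).
have mF : measurable_fun setT (fun x => \int[mun n]_y f (cons_pair (x, y))).
  apply: (@measurable_fun_fubini_tonelli_F _ _ _ _ _ (mun n) (fun p => f (cons_pair p))) => //.
  by apply: measurableT_comp => //; exact: measurable_cons_pair.
have rn0 : 0 <= (r^-1 ^+ n)%:E by rewrite lee_fin exprn_ge0// invr_ge0 ltW.
rewrite (@ge0_integral_aff1 _ _ (thead a) r0 (fun x => (r^-1 ^+ n)%:E *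
  \int[mun n]_y f (cons_pair (x, y)))); last 2 first.
- exact: measurable_funeM.
- by move=> x; rewrite mule_ge0//; apply: integral_ge0.
rewrite ge0_integralZl//; last by move=> x _; exact: integral_ge0.
by rewrite muleA -EFinM -exprS ge0_integral_lebesgueS.
Qed.

(** No integrability is asked for: the positive and the negative part scale by the
    same factor, so the two sides degenerate simultaneously. *)
Lemma integral_aff n (r : R) (a : euclid R n) (r0 : (0 < r)%R) (f : euclid R n -> R) :
  measurable_fun setT f ->
  (r ^+ n * \int[mun n]_x f (aff r a x) = \int[mun n]_x f x)%R.
Proof.
move=> mf; rewrite /Rintegral.
have rn0 : (0 < r ^+ n)%R by rewrite exprn_gt0.
have key (g : euclid R n -> \bar R) : measurable_fun setT g -> (forall x, 0 <= g x) ->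
   \int[mun n]_x g x = (r ^+ n)%:E * \int[mun n]_x g (aff r a x).
  by move=> mg g0; rewrite ge0_integral_aff// muleA -EFinM exprVn divff ?mul1e// lt0r_neq0.
pose Ef x := (f x)%:E.
have mEf : measurable_fun setT Ef by exact/measurable_EFinP.
pose u := \int[mun n]_x Ef^\+ (aff r a x); pose v := \int[mun n]_x Ef^\- (aff r a x).
transitivity (r ^+ n * fine (u - v))%R; first last.
  rewrite [in RHS]integralE (key _ (measurable_funepos mEf))// (key _ (measurable_funeneg mEf))//.
  rewrite -/u -/v.
  have u0 : 0 <= u by exact: integral_ge0.
  have v0 : 0 <= v by exact: integral_ge0.
  move: u v u0 v0 => [u| |] [v| |]//= u0 v0; rewrite ?gt0_muley ?lte_fin//= ?mulr0//.
  by rewrite mulrBr.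
congr (_ * fine _)%R; rewrite integralE; congr (_ - _); apply: eq_integral => x _.
  by rewrite !funeposE.
by rewrite !funenegE.
Qed.

End tuples.

(** * Integration by parts along a flow *)

Section flow.
Context {R : realType} {n : nat}.
Local Notation E := (euclid R n).
Local Notation mun := (@lebesgue_measuren R n).
Implicit Types (phi : R -> E -> E) (f g G : E -> R).

(** Boundedness on bounded sets, which are exhausted by the sublevel sets of
    jbracket. *)
Definition locally_bounded f :=
  forall L : R, exists B : R, forall xi, jbracket xi <= L -> `|f xi| <= B.

(** The constant c is the divergence of the generator: time t multiplies volumes by
    expR (c * t).  The growth bound keeps supports bounded for small times. *)
Record flow_like (phi : R -> E -> E) (c : R) : Prop := FlowLike {
  flow0 : forall xi, phi 0 xi = xi ;
  flowD : forall s t xi, phi (s + t) xi = phi s (phi t xi) ;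
  flow_meas : forall t, measurable_fun setT (phi t) ;
  flow_int : forall t f, measurable_fun setT f ->
    expR (c * t) * (\int[mun]_xi f (phi t xi)) = \int[mun]_xi f xi ;
  flow_growth : exists k : R, 0 < k /\ forall t xi, `|t| <= 1 ->
    jbracket (phi t xi) <= k * jbracket xi }.

(** Besides the derivative at time 0, this records what dominated convergence needs
    to differentiate integrals along the flow. *)
Record derivative_along (phi : R -> E -> E) (f g : E -> R) : Prop := DerivativeAlong {
  da_meas : measurable_fun setT f ;
  da_meas' : measurable_fun setT g ;
  da_bd : locally_bounded f ;
  da_bd' : locally_bounded g ;
  da_der : forall xi, is_derive (0 : R) 1 (fun t => f (phi t xi)) (g xi) }.

Lemma measurable_dotr (x : E) : measurable_fun setT (dotr x : E -> R).
Proof.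
apply: measurable_sum => i; apply: measurable_funM => //.
exact: measurable_tnth.
Qed.

Lemma measurable_normsq : measurable_fun setT (fun xi : E => dotr xi xi).
Proof.
by apply: measurable_sum => i; apply: measurable_funM; exact: measurable_tnth.
Qed.

Lemma dotrr_ge0 (xi : E) : 0 <= dotr xi xi.
Proof. by apply: sumr_ge0 => i _; rewrite -expr2 sqr_ge0. Qed.

Lemma enorm_sqr (xi : E) : enorm xi ^+ 2 = dotr xi xi.
Proof. by rewrite sqr_sqrtr// dotrr_ge0. Qed.

Lemma jbracket_sqr (xi : E) : jbracket xi ^+ 2 = 1 + dotr xi xi.
Proof. by rewrite sqr_sqrtr enorm_sqr// addr_ge0// dotrr_ge0. Qed.

Lemma jbracket_ge1 (xi : E) : 1 <= jbracket xi.
Proof.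
rewrite -[leLHS]sqrtr1 ler_wsqrtr// lerDl sqr_ge0//.
Qed.

Lemma jbracket_gt0 (xi : E) : 0 < jbracket xi.
Proof. exact: lt_le_trans (jbracket_ge1 xi). Qed.

Lemma measurable_jbracket : measurable_fun setT (@jbracket R n).
Proof.
have ms : measurable_fun setT (@Num.sqrt R) by apply: continuous_measurable_fun => x;
  exact: sqrt_continuous.
apply: (measurableT_comp ms).
apply: measurable_funD => //.
under eq_fun do rewrite enorm_sqr.
exact: measurable_normsq.
Qed.

Lemma tnth_le_jbracket (xi : E) i : `|tnth xi i| <= jbracket xi.
Proof.
rewrite -ler_sqr ?nnegrE ?normr_ge0 ?sqrtr_ge0//.
rewrite jbracket_sqr real_normK ?num_real// /dotr (bigD1 i)//= -expr2.
rewrite addrCA lerDl addr_ge0// sumr_ge0// => j _; rewrite -expr2 sqr_ge0//.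
Qed.

Definition jball (L : R) : set E := [set xi | jbracket xi <= L].

Lemma measurable_jball L : measurable (jball L).
Proof.
rewrite (_ : jball L = (@jbracket R n) @^-1` `]-oo, L]); last first.
  by apply/seteqP; split => xi /=; rewrite in_itv.
rewrite -[X in measurable X]setTI; exact: measurable_jbracket.
Qed.

Lemma jball_fin L : (mun (jball L) < +oo)%E.
Proof.
pose J : set (measurableTypeR R) := `[- L, L]%classic.
pose box := [set xi : E | forall i, J (tnth xi i)].
have mJ : measurable J by exact: measurable_itv.
have mbox : measurable box by exact: (@measurable_box R n (fun=> J)).
apply: (@le_lt_trans _ _ (mun box)).
  apply: le_measure; rewrite ?inE//; first exact: measurable_jball.
  move=> xi /= h i; rewrite /J /= in_itv /= -ler_norml.
  exact: le_trans (tnth_le_jbracket xi i) h.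
rewrite [X in (X < _)%E](_ : _ = (\prod_(i < n) (lebesgue_measure J)))%E; last first.
  exact: (@lebesgue_measuren_box R n (fun=> J)).
have J0 : (lebesgue_measure J < +oo)%E by rewrite lebesgue_measure_itv /=; case: ifP => _;
  rewrite ltry.
elim: n => [|m IHm]; first by rewrite big_ord0 ltry.
rewrite big_ord_recl.
by rewrite lte_mul_pinfty// ge0_fin_numE.
Qed.

Lemma integrable_jball L : mun.-integrable setT (fun xi => (\1_(jball L) xi)%:E).
Proof.
have mL := measurable_jball L.
apply/integrableP; split; first by apply/measurable_EFinP; exact: measurable_indic.
under eq_integral do rewrite gee0_abs ?lee_fin//.
by rewrite integral_indic// setIT jball_fin.
Qed.

Lemma locally_boundedP f : locally_bounded f ->
  forall L : R, exists B : R, 0 <= B /\ forall xi, jbracket xi <= L -> `|f xi| <= B.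
Proof.
move=> h L; have [B hB] := h L; exists `|B|; split => // xi hxi.
exact: le_trans (hB _ hxi) (ler_norm _).
Qed.

Lemma bounded_jball_integrable f (L B : R) : measurable_fun setT f ->
  (forall xi, ~ jball L xi -> f xi = 0) -> (forall xi, jball L xi -> `|f xi| <= B) ->
  mun.-integrable setT (EFin \o f).
Proof.
move=> mf f0 fB.
have i1 : mun.-integrable setT (EFin \o (fun xi => B * \1_(jball L) xi)).
  apply: (@eq_integrable _ _ _ _ _ _ (fun xi => B%:E * (\1_(jball L) xi)%:E)%E) => //.
  by apply: integrableZl => //; exact: integrable_jball.
apply: le_integrable i1 => //; first exact/measurable_EFinP.
move=> xi _ /=; rewrite lee_fin.
have [h|h] := pselect (jball L xi).
  by rewrite indicE mem_set// mulr1 (le_trans (fB _ h))// ler_norm.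
by rewrite f0// normr0.
Qed.

(** By invariance of the measure, the integral of expR (c * t) * G (phi t xi) does
    not depend on t; differentiating under the integral sign at t = 0 gives the
    identity.  Compactness of the support provides the domination. *)
Lemma flow_ibp phi c G DG (L : R) : flow_like phi c -> derivative_along phi G DG ->
  (forall xi, L < jbracket xi -> G xi = 0) ->
  [/\ mun.-integrable setT (EFin \o G), mun.-integrable setT (EFin \o DG) &
   \int[mun]_xi (DG xi + c * G xi) = 0].
Proof.
move=> fphi dG G0.
have [k [k0 hk]] := flow_growth fphi.
have hder (t : R) (xi : E) : is_derive t 1 (fun t : R => G (phi t xi)) (DG (phi t xi)).
  have h := da_der dG (phi t xi).
  have -> : (fun t => G (phi t xi)) = (fun s => G (phi s (phi t xi))) \o (fun u => u - t).
    by apply/funext => u /=; rewrite -(flowD fphi) subrK.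
  rewrite -[DG _]mulr1.
  apply: (@is_derive1_comp _ (fun s => G (phi s (phi t xi))) (fun u => u - t)).
    by rewrite subrr.
  by apply: is_derive_eq; rewrite subr0.
pose F (t : R) (xi : E) := expR (c * t) * G (phi t xi).
pose F' (t : R) (xi : E) := expR (c * t) * (DG (phi t xi) + c * G (phi t xi)).
have hF (t : R) (xi : E) : is_derive t 1 (F ^~ xi) (F' t xi).
  have h1 : is_derive t 1 (fun t => expR (c * t)) (expR (c * t) * c).
    apply: is_derive1_comp; rewrite -[X in is_derive _ _ _ X]mulr1.
    exact: is_deriveZ.
  apply: is_derive_eq; rewrite /F' /GRing.scale /=; ring.
have out xi : ~ jball (k * L) xi -> forall t, `|t| <= 1 -> G (phi t xi) = 0.
  move=> h t t1; apply: G0; rewrite ltNge; apply/negP => h'; apply: h; rewrite /jball /=.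
  rewrite -{1}[xi](flow0 fphi) -(addNr t) (flowD fphi).
  by rewrite (le_trans (hk _ _ _)) ?normrN// ler_wpM2l// ltW.
have [B [B0 hB]] := locally_boundedP (da_bd dG) (k * (k * L)).
have [B' [B'0 hB']] := locally_boundedP (da_bd' dG) (k * (k * L)).
have inn xi : jball (k * L) xi -> forall t, `|t| <= 1 -> jbracket (phi t xi) <= k * (k * L).
  move=> h t t1; rewrite (le_trans (hk _ _ t1))// ler_wpM2l//; exact: ltW.
have I1 (t : R) : `]-1, 1[%classic t -> `|t| <= 1.
  by rewrite /= in_itv /= ler_norml => /andP[/ltW -> /ltW ->].
have F'0 (xi : E) : ~ jball (k * L) xi -> forall t : R, `]-1, 1[%classic t -> F' t xi = 0.
  move=> h t It.
  have : is_derive t 1 (F ^~ xi) 0.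
    apply: (near_eq_is_derive _ (is_derive_cst (0 : R) t (1 : R))).
    near=> s; rewrite /F out ?mulr0//; apply: I1; near: s.
    exact: near_in_itvoo.
  by move=> h0; rewrite -[LHS](@derive_val _ _ _ _ _ _ _ (hF t xi)) (@derive_val _ _ _ _ _ _ _ h0).
pose M := expR `|c|.
have M0 : 0 <= M by exact: expR_ge0.
have eM (t : R) : `|t| <= 1 -> `|expR (c * t)| <= M.
  move=> t1; rewrite ger0_norm ?expR_ge0// ler_expR (le_trans (ler_norm _))// normrM.
  by rewrite ler_piMr.
pose KK := M * (B' + `|c| * B).
have F'le (t : R) (xi : E) : `]-1, 1[%classic t -> `|F' t xi| <= KK * \1_(jball (k * L)) xi.
  move=> It; have [h|h] := pselect (jball (k * L) xi); last first.
    by rewrite F'0// normr0 indicE memNset// mulr0.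
  rewrite indicE mem_set// mulr1 /F' normrM ler_pM// ?eM ?I1//.
  rewrite (le_trans (ler_normD _ _))// lerD// ?hB' ?inn ?I1// normrM ler_wpM2l//.
  by rewrite hB ?inn ?I1.
have iG : mun.-integrable setT (EFin \o G).
  apply: (@bounded_jball_integrable _ (k * L) B); first exact: da_meas dG.
    by move=> xi h; rewrite -[xi](flow0 fphi) out// normr0.
  by move=> xi h; rewrite hB// -[xi](flow0 fphi) inn// normr0.
have iDG : mun.-integrable setT (EFin \o DG).
  have [B2 hB2] := da_bd' dG (k * L).
  apply: (@bounded_jball_integrable _ (k * L) B2) => //; first exact: da_meas' dG.
  move=> xi h; have := F'0 xi h 0; rewrite /F' mulr0 expR0 mul1r !(flow0 fphi).
  have -> : G xi = 0 by rewrite -[xi](flow0 fphi) out// normr0.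
  by rewrite mulr0 addr0; apply; rewrite /= in_itv/= ltrN10 ltr01.
split => //.
have mG t : measurable_fun setT (fun xi => G (phi t xi)).
  by apply: measurableT_comp; [exact: da_meas dG|exact: (flow_meas fphi)].
have iF (t : R) : `]-1, 1[%classic t -> mun.-integrable setT (EFin \o F t).
  move=> It; apply: (@bounded_jball_integrable _ (k * L) (M * B)).
  - exact: measurable_funM.
  - by move=> xi h; rewrite /F out ?mulr0// I1.
  - by move=> xi h; rewrite /F normrM ler_pM ?eM ?I1// hB// inn// I1.
have FE (t : R) : `]-1, 1[%classic t -> \int[mun]_xi F t xi = \int[mun]_xi G xi.
  move=> It; rewrite -(flow_int fphi t (da_meas dG)) /F RintegralZl//.
  apply: (@bounded_jball_integrable _ (k * L) B) => //.
  - by move=> xi h; rewrite out// I1.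
  - by move=> xi h; rewrite hB// inn// I1.
have I0 : `]-1, 1[%classic (0 : R) by rewrite /= in_itv/= ltrN10 ltr01.
have := @differentiation_under_integral _ _ _ mun F setT measurableT 0 (-1) 1 I0 iF _
  (fun xi => KK * \1_(jball (k * L)) xi).
rewrite (_ : derive1 _ (0 : R) = 0); last first.
  rewrite derive1E.
  have : is_derive (0:R) 1 (fun t => \int[mun]_xi F t xi) 0.
    apply: (near_eq_is_derive _ (is_derive_cst (\int[mun]_xi G xi : R) 0 (1 : R))).
    near=> s; rewrite FE//; near: s; exact: near_in_itvoo.
  by move=> h0; rewrite (@derive_val _ _ _ _ _ _ _ h0).
have pE t xi : partial1of2 F t xi = F' t xi.
  by rewrite partial1of2E (@derive_val _ _ _ _ _ _ _ (hF t xi)).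
move=> H; rewrite H.
- by apply: eq_Rintegral => xi _; rewrite pE /F' mulr0 expR0 mul1r !(flow0 fphi).
- by move=> t xi _ _; exact: ex_derive.
- move=> xi; by rewrite mulr_ge0// /KK mulr_ge0// addr_ge0// mulr_ge0.
- apply: (@bounded_jball_integrable _ (k * L) KK).
  + by apply: measurable_funM => //; apply: measurable_indic; exact: measurable_jball.
  + by move=> xi h; rewrite indicE memNset// mulr0.
  + move=> xi h; rewrite indicE mem_set// mulr1 ger0_norm// /KK.
    by rewrite mulr_ge0// addr_ge0// mulr_ge0.
- by move=> t xi It _; rewrite pE F'le.
Unshelve. all: end_near. Qed.

End flow.

(** * Translations, dilations and their derivatives *)

Section flows.
Context {R : realType} {n : nat}.
Local Notation E := (euclid R n).
Local Notation mun := (@lebesgue_measuren R n).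
Implicit Types (x xi : E) (f g : E -> R).

Definition vscale (t : R) (x : E) : E := [tuple t * tnth x i | i < n].

Lemma dotrC x y : dotr x y = dotr y x.
Proof. by apply: eq_bigr => i _; rewrite mulrC. Qed.

Lemma dotr_aff y r a xi : dotr y (aff r a xi) = r * dotr y xi + dotr y a.
Proof.
rewrite /dotr big_distrr/= -big_split/=; apply: eq_bigr => i _.
by rewrite tnth_mktuple /aff1 mulrDr mulrCA.
Qed.

Lemma dotr_vscale y t x : dotr y (vscale t x) = t * dotr y x.
Proof.
by rewrite /dotr big_distrr/=; apply: eq_bigr => i _; rewrite tnth_mktuple mulrCA.
Qed.

Lemma dotr_aff_vscale r t x xi : dotr (aff r (vscale t x) xi) (aff r (vscale t x) xi) =
  r ^+ 2 * dotr xi xi + 2 * r * t * dotr x xi + t ^+ 2 * dotr x x.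
Proof.
rewrite dotr_aff dotr_vscale [dotr (aff _ _ _) xi]dotrC [dotr (aff _ _ _) x]dotrC.
rewrite !dotr_aff !dotr_vscale [dotr xi x]dotrC; ring.
Qed.

(** Expand the nonnegative square of |x|^2 xi - (x.xi) x. *)
Lemma dotr_CS x xi : dotr x xi ^+ 2 <= dotr x x * dotr xi xi.
Proof.
have [x0|x0] := eqVneq (dotr x x) 0.
  suff -> : dotr x xi = 0 by rewrite x0 expr0n mul0r.
  rewrite /dotr big1// => i _.
  have /eqP := x0; rewrite psumr_eq0; last by move=> j _; rewrite -expr2 sqr_ge0.
  by move/allP/(_ i (mem_index_enum _)); rewrite /= mulf_eq0 orbb => /eqP ->; rewrite mul0r.
have xp : 0 < dotr x x by rewrite lt_neqAle eq_sym x0 dotrr_ge0.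
have := dotrr_ge0 (aff (dotr x x) (vscale (- dotr x xi) x) xi).
rewrite dotr_aff_vscale -(pmulr_rge0 _ xp) => h.
rewrite -subr_ge0 -(pmulr_rge0 _ xp) -(pmulr_rge0 _ xp).
by apply: le_trans h _; rewrite le_eqVlt; apply/orP; left; apply/eqP; ring.
Qed.

Definition trans x (t : R) : E -> E := aff 1 (vscale t x).
Definition dil (t : R) : E -> E := aff (expR t) (vscale 0 [tuple 0 | i < n]).

Lemma dotr_trans y x t xi : dotr y (trans x t xi) = dotr y xi + t * dotr y x.
Proof. by rewrite dotr_aff dotr_vscale mul1r. Qed.

Lemma dotr_dil y t xi : dotr y (dil t xi) = expR t * dotr y xi.
Proof. by rewrite dotr_aff dotr_vscale mul0r addr0. Qed.

Lemma normsq_trans x t xi : dotr (trans x t xi) (trans x t xi) =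
  dotr xi xi + 2 * t * dotr x xi + t ^+ 2 * dotr x x.
Proof. by rewrite dotr_aff_vscale expr1n !(mul1r, mulr1). Qed.

Lemma normsq_dil t xi : dotr (dil t xi) (dil t xi) = expR t ^+ 2 * dotr xi xi.
Proof. by rewrite dotr_aff_vscale mulr0 mul0r expr0n mul0r !addr0. Qed.

Lemma trans_flow x : flow_like (trans x) 0.
Proof.
split.
- move=> xi; apply/eq_from_tnth => i;
    rewrite /trans /dil /aff /vscale !tnth_mktuple /aff1 ?tnth_mktuple; ring.
- move=> s t xi; apply/eq_from_tnth => i;
    rewrite /trans /dil /aff /vscale !tnth_mktuple /aff1 ?tnth_mktuple; ring.
- by move=> t; exact: measurable_aff.
- by move=> t f mf; rewrite mul0r expR0 mul1r -(@integral_aff _ _ 1 (vscale t x) ltr01 f mf)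
    expr1n mul1r.
- exists (2 * (1 + dotr x x)); have x0 := dotrr_ge0 x.
  split; first lra.
  move=> t xi t1; rewrite -ler_sqr ?nnegrE ?mulr_ge0 ?sqrtr_ge0//; last lra.
  rewrite exprMn !jbracket_sqr normsq_trans.
  (* the opposite translate has nonnegative square norm: 2 t x.xi <= |xi|^2 + t^2 |x|^2 *)
  have := dotrr_ge0 (trans x (- t) xi); rewrite normsq_trans sqrrN => h.
  have xi0 := dotrr_ge0 xi.
  have t2 : t ^+ 2 <= 1 by rewrite -real_normK ?num_real// expr_le1.
  have : t ^+ 2 * dotr x x <= dotr x x by rewrite ler_piMl.
  have : 0 <= dotr x x * dotr xi xi by rewrite mulr_ge0.
  have : 0 <= dotr x x * (dotr x x * dotr xi xi) by rewrite !mulr_ge0.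
  have : 0 <= dotr x x * dotr x x by rewrite mulr_ge0.
  move: h; nra.
Qed.

Lemma dil_flow : flow_like dil n%:R.
Proof.
split.
- move=> xi; apply/eq_from_tnth => i;
    rewrite /trans /dil /aff /vscale !tnth_mktuple /aff1 ?tnth_mktuple expR0; ring.
- move=> s t xi; apply/eq_from_tnth => i;
    rewrite /trans /dil /aff /vscale !tnth_mktuple /aff1 ?tnth_mktuple expRD; ring.
- by move=> t; exact: measurable_aff.
- move=> t f mf; rewrite -(@integral_aff _ _ (expR t) (vscale 0 [tuple 0 | i < n]) (expR_gt0 _)
    f mf).
  by rewrite expRM_natl.
- exists (expR 1); rewrite expR_gt0; split => // t xi t1.
  rewrite -ler_sqr ?nnegrE ?mulr_ge0 ?sqrtr_ge0 ?expR_ge0//.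
  rewrite exprMn !jbracket_sqr normsq_dil.
  rewrite mulrDr mulr1 lerD//.
    by rewrite -[leLHS](expr1n _ 2) ler_sqr ?nnegrE ?expR_ge0// -expR0 ler_expR.
  rewrite ler_wpM2r ?dotrr_ge0// ler_sqr ?nnegrE ?expR_ge0// ler_expR.
  exact: le_trans (ler_norm _) t1.
Qed.

End flows.

Section derivative_along_theory.
Context {R : realType} {n : nat}.
Local Notation E := (euclid R n).
Variables (phi : R -> E -> E) (c : R).
Hypothesis fphi : flow_like phi c.
Implicit Types f g : E -> R.

Lemma locally_bounded_cst (a : R) : locally_bounded (fun _ : E => a).
Proof. by move=> L; exists `|a|. Qed.

Lemma locally_boundedD f g : locally_bounded f -> locally_bounded g ->
  locally_bounded (fun xi => f xi + g xi).
Proof.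
move=> hf hg L; have [B hB] := hf L; have [B' hB'] := hg L; exists (B + B') => xi h.
by rewrite (le_trans (ler_normD _ _))// lerD ?hB ?hB'.
Qed.

Lemma locally_boundedM f g : locally_bounded f -> locally_bounded g ->
  locally_bounded (fun xi => f xi * g xi).
Proof.
move=> hf hg L; have [B hB] := hf L; have [B' hB'] := hg L; exists (B * B') => xi h.
by rewrite normrM ler_pM ?hB ?hB'.
Qed.

Lemma da_cst (a : R) : derivative_along phi (fun=> a) (fun=> 0).
Proof.
split; [exact: measurable_cst|exact: measurable_cst|exact: locally_bounded_cst|exact:
  locally_bounded_cst|].
by move=> xi; exact: is_derive_cst.
Qed.

Lemma da_add f f' g g' : derivative_along phi f f' -> derivative_along phi g g' ->
  derivative_along phi (fun xi => f xi + g xi) (fun xi => f' xi + g' xi).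
Proof.
move=> [? ? ? ? df] [? ? ? ? dg]; split; try exact: locally_boundedD; try exact: measurable_funD.
by move=> xi; have := df xi; have := dg xi => ? ?; exact: is_deriveD.
Qed.

Lemma da_mul f f' g g' : derivative_along phi f f' -> derivative_along phi g g' ->
  derivative_along phi (fun xi => f xi * g xi) (fun xi => f' xi * g xi + f xi * g' xi).
Proof.
move=> [? ? ? ? df] [? ? ? ? dg]; split.
- exact: measurable_funM.
- by apply: measurable_funD; exact: measurable_funM.
- exact: locally_boundedM.
- by apply: locally_boundedD; exact: locally_boundedM.
- move=> xi; have := df xi; have := dg xi => ? ?; apply: is_derive_eq.
  rewrite /GRing.scale /= !(flow0 fphi); ring.
Qed.

Lemma da_comp (h h' : R -> R) f f' : derivative_along phi f f' ->
  measurable_fun setT (h \o f) -> measurable_fun setT (h' \o f) ->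
  locally_bounded (h \o f) -> locally_bounded (h' \o f) ->
  (forall xi, is_derive (f xi) (1 : R) h (h' (f xi))) ->
  derivative_along phi (h \o f) (fun xi => h' (f xi) * f' xi).
Proof.
move=> [? ? ? ? df] mh mh' bh bh' dh; split => //.
- exact: measurable_funM.
- exact: locally_boundedM.
- move=> xi; have := @is_derive1_comp _ h (fun t => f (phi t xi)) 0 (h' (f xi)) (f' xi).
  by rewrite (flow0 fphi); apply.
Qed.

(** A power with exponent -1 is measurable, and agrees with the inverse on positive
    numbers. *)
Lemma measurable_inv_pos (f : E -> R) : measurable_fun setT f -> (forall xi, 0 < f xi) ->
  measurable_fun setT (fun xi => (f xi)^-1).
Proof.
move=> mf f0.
rewrite (_ : (fun _ => _) = (fun xi => f xi `^ (- 1))); last first.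
  by apply/funext => xi; rewrite powR_inv1// ltW.
exact: (measurableT_comp (@measurable_powR R (- 1)) mf).
Qed.

Lemma da_inv f f' : derivative_along phi f f' -> (forall xi, 0 < f xi) ->
  locally_bounded (fun xi => (f xi)^-1) ->
  derivative_along phi (fun xi => (f xi)^-1) (fun xi => - (f xi)^-1 ^+ 2 * f' xi).
Proof.
move=> df f0 bf; have mi := measurable_inv_pos (da_meas df) f0.
apply: (@da_comp (fun y => y^-1) (fun y => - y^-1 ^+ 2)) => //.
- exact: (measurable_funN (measurable_funX 2 mi)).
- rewrite /comp; under eq_fun do rewrite -mulN1r expr2.
  apply: locally_boundedM; first exact: locally_bounded_cst.
  exact: locally_boundedM.
- move=> xi; apply: is_derive_eq; first by apply: is_deriveV; rewrite ?gt_eqF ?f0.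
  by rewrite /GRing.scale /= mulr1 exprVn.
Qed.

Lemma da_eq f g g' : derivative_along phi f g -> g =1 g' -> derivative_along phi f g'.
Proof. by move=> h /funext <-. Qed.

End derivative_along_theory.

(** * Gaussian integrals *)

Section gauss.
Context {R : realType}.
Local Notation mu := (@lebesgue_measure R).
Local Notation mun n := (@lebesgue_measuren R n).

Definition sqpi : R := Num.sqrt pi.

Lemma sqpi_gt0 : 0 < sqpi. Proof. by rewrite sqrtr_gt0 pi_gt0. Qed.

Lemma measurable_gaussian (T : R) : measurable_fun setT (fun y : measurableTypeR R => expR (-
  (T * y ^+ 2))).
Proof.
apply: measurableT_comp => //; apply: measurable_funN; apply: measurable_funM => //.
Qed.

Lemma gauss_shift (a : R) : (\int[mu]_y (expR (- (y - a) ^+ 2))%:E = sqpi%:E)%E.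
Proof.
have mg : measurable_fun setT (fun y : measurableTypeR R => (expR (- y ^+ 2))%:E).
  by apply/measurable_EFinP; have := measurable_gaussian 1; under eq_fun do rewrite mul1r.
have := @ge0_integral_aff1 R 1 (- a) ltr01 (fun y => (expR (- y ^+ 2))%:E) mg (fun y => ltW
  (expR_gt0 _)).
rewrite invr1 mul1e integralT_gauss => h; rewrite -[RHS]h.
by apply: eq_integral => y _; rewrite /aff1 mul1r.
Qed.

(** The scaling of the half-line Gaussian integral starting at b. *)
Lemma half_gauss (a b : R) : 0 < a ->
  (\int[mu]_y (if b <= y then expR (- (a * (y - b)) ^+ 2) else 0)%:E = (sqpi / (2 * a))%:E)%E.
Proof.
move=> a0.
pose G (y : measurableTypeR R) : R := if 0 <= y then expR (- y ^+ 2) else 0.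
have mG : measurable_fun setT (fun y => (G y)%:E).
  apply/measurable_EFinP; apply: measurable_fun_if => //.
    by apply: measurable_fun_ler => //; exact: measurable_id.
  apply: measurable_funTS.
  by have := measurable_gaussian 1; under eq_fun do rewrite mul1r.
have G0 y : (0 <= (G y)%:E)%E by rewrite lee_fin /G; case: ifP => // _; exact: expR_ge0.
have := @ge0_integral_aff1 R a (- (a * b)) a0 (fun y => (G y)%:E) mG G0.
have -> : (\int[mu]_y (G y)%:E = (sqpi / 2)%:E)%E.
  rewrite -[RHS]integral0y_gauss [RHS]integral_mkcond; apply: eq_integral => y _.
  rewrite /G patchE; case: ifPn => h; case: ifPn => //; rewrite ?in_itv/= ?andbT.
    by move/negP; rewrite inE /= in_itv /= andbT h.
  by rewrite inE /= in_itv /= andbT (negbTE h).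
rewrite -EFinM.
have -> : a^-1 * (sqpi / 2) = sqpi / (2 * a) by field; rewrite gt_eqF.
move=> <-; apply: eq_integral => y _; rewrite /G /aff1 -mulrBr.
by rewrite pmulr_rge0// subr_ge0.
Qed.

Lemma measurable_gaussn n : measurable_fun setT (fun xi : euclid R n => (expR (- dotr xi xi))%:E).
Proof.
apply/measurable_EFinP; apply: measurableT_comp => //; apply: measurable_funN.
exact: measurable_normsq.
Qed.

Lemma dotr_cons n (a b : R) (x y : euclid R n) :
  dotr (cons_pair (a, x) : euclid R n.+1) (cons_pair (b, y)) = a * b + dotr x y.
Proof.
rewrite /dotr big_ord_recl; congr (_ + _).
by apply: eq_bigr => i _; rewrite !tnthS.
Qed.

Lemma gaussn n : (\int[mun n]_xi (expR (- dotr xi xi))%:E = (sqpi ^+ n)%:E)%E.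
Proof.
elim: n => [|n IHn].
  rewrite expr0 [LHS]integral_dirac//; last exact: measurable_gaussn.
  rewrite diracT mul1e.
  by rewrite /dotr big_ord0 oppr0 expR0.
have S := @ge0_integral_lebesgueS R n (fun xi => (expR (- dotr xi xi))%:E) (@measurable_gaussn n.+1)
  (fun xi => expR_ge0 _).
rewrite S.
transitivity (\int[mu]_x ((sqpi ^+ n)%:E * (expR (- x ^+ 2))%:E))%E.
  apply: eq_integral => x _; rewrite -IHn muleC -ge0_integralZl//.
  - by apply: eq_integral => y _; rewrite dotr_cons opprD expRD EFinM expr2.
  - exact: measurable_gaussn.
rewrite ge0_integralZl//.
- by rewrite integralT_gauss -EFinM -exprSr.
- by apply/measurable_EFinP; have := measurable_gaussian 1; under eq_fun do rewrite mul1r.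
- by rewrite lee_fin exprn_ge0// ltW// sqpi_gt0.
Qed.

(** Completing the square: tau xi + x / (2 tau) is the new variable. *)
Lemma gaussn_linear n (tau : R) (x : euclid R n) : 0 < tau ->
  (\int[mun n]_xi (expR (- (tau ^+ 2 * dotr xi xi + dotr x xi)))%:E =
   ((sqpi / tau) ^+ n * expR (dotr x x / (4 * tau ^+ 2)))%:E)%E.
Proof.
move=> tau0.
have := @ge0_integral_aff R n tau (vscale (2 * tau)^-1 x) tau0 (fun xi => (expR (- dotr xi xi))%:E)
  (@measurable_gaussn n) (fun xi => ltW (expR_gt0 _)).
rewrite gaussn -EFinM -exprMn [_^-1 * _]mulrC => h.
rewrite mulrC EFinM -h -ge0_integralZl//.
- apply: eq_integral => xi _; rewrite -EFinM -expRD dotr_aff_vscale; congr ((expR _)%:E).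
  by field; rewrite gt_eqF.
- apply: (measurableT_comp (@measurable_gaussn n)); exact: measurable_aff.
Qed.

End gauss.

(** * The Laplace transform of the weight *)

Section laplace.
Context {R : realType} {n : nat}.
Local Notation E := (euclid R n).
Local Notation mu := (@lebesgue_measure R).
Local Notation mun := (@lebesgue_measuren R n).

(** The integrand of the subordination formula, up to constants: its integral
    in tau, a Bessel function of t * A times powers of t and A, dominates t^(n/2)
    A^(-n/2-1) expR (- t A).  It is extended by 0 so that tau can range over the line. *)
Definition subord (t A tau : R) : R :=
  if 0 < tau then tau ^+ n * expR (- (tau ^+ 2 * A ^+ 2 + t ^+ 2 / 4 * tau `^ (- 2))) else 0.

Lemma subord_ge0 t A tau : 0 <= subord t A tau.
Proof. by rewrite /subord; case: ifPn => // h; rewrite mulr_ge0 ?expR_ge0// exprn_ge0// ltW. Qed.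

Lemma subordE t A tau : 0 < tau ->
  subord t A tau = tau ^+ n * expR (- (tau ^+ 2 * A ^+ 2 + t ^+ 2 / (4 * tau ^+ 2))).
Proof.
move=> tau0; rewrite /subord tau0; congr (_ * expR (- (_ + _))).
by rewrite powRN powR_mulrn ?ltW//; field; rewrite gt_eqF.
Qed.

Lemma measurable_subord d (T : measurableType d) (t : R) (f g : T -> R) :
  measurable_fun setT f -> measurable_fun setT g ->
  measurable_fun setT (fun z => subord t (f z) (g z)).
Proof.
move=> mf mg; apply: measurable_fun_ifT => //.
  by apply: measurable_fun_ltr.
apply: measurable_funM; first by apply: measurable_funX.
apply: measurableT_comp => //; apply: measurable_funN; apply: measurable_funD.
  by apply: measurable_funM; apply: measurable_funX.
by apply: measurable_funM => //; exact: (measurableT_comp (@measurable_powR R (- 2)) mg).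
Qed.

(** The exponent tau^2 A^2 + t^2 / (4 tau^2) is minimal at tau = b with b^2 = t / (2A),
    where it equals t A.  To the right of b it exceeds t A by at most the square of
    2 A (tau - b), and tau^n is at least b^n: a half Gaussian remains. *)
Lemma subord_lb (t A : R) : 0 < t -> 1 <= A ->
  (((t / (2 * A)) `^ (n%:R / 2) * expR (- (t * A)) * (sqpi / (4 * A)))%:E <=
   \int[mu]_tau (subord t A tau)%:E)%E.
Proof.
move=> t0 A1; have A0 : 0 < A by exact: lt_le_trans A1.
pose w := t / (2 * A).
have w0 : 0 < w by rewrite divr_gt0// mulr_gt0.
pose b := Num.sqrt w.
have b0 : 0 < b by rewrite sqrtr_gt0.
have bb : b ^+ 2 = w by rewrite sqr_sqrtr// ltW.
pose c := b ^+ n * expR (- (t * A)).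
have c0 : 0 <= c by rewrite mulr_ge0 ?expR_ge0// exprn_ge0// ltW.
have -> : (t / (2 * A)) `^ (n%:R / 2) = b ^+ n.
  by rewrite -/w /b -powR12_sqrt ?(ltW w0)// -powR_mulrn ?powR_ge0// -powRrM mulrC.
have aa : 0 < 2 * A by rewrite mulr_gt0.
have -> : sqpi / (4 * A) = sqpi / (2 * (2 * A)) by congr (_ / _); ring.
rewrite -[_ * expR _]/c EFinM -(half_gauss b aa).
have mg : measurable_fun setT (fun y : measurableTypeR R => (if b <= y then expR (- (2 * A *
  (y - b)) ^+ 2) else 0)%:E).
  apply/measurable_EFinP; apply: measurable_fun_ifT => //.
    by apply: measurable_fun_ler => //; exact: measurable_id.
  apply: measurableT_comp => //; apply: measurable_funN; apply: measurable_funX;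
    apply: measurable_funM => //.
  by apply: measurable_funB => //; exact: measurable_id.
have ms : measurable_fun setT (fun tau : measurableTypeR R => (subord t A tau)%:E).
  by apply/measurable_EFinP; apply: measurable_subord => //; exact: measurable_id.
have g0 (y : R) : 0 <= (if b <= y then expR (- (2 * A * (y - b)) ^+ 2) else 0).
  by case: ifP => // _; exact: expR_ge0.
rewrite -ge0_integralZl//; last by move=> y _; rewrite lee_fin.
apply: ge0_le_integral => //.
- by move=> y _; rewrite -EFinM lee_fin mulr_ge0.
- exact: measurable_funeM.
move=> y _; rewrite -EFinM lee_fin; case: ifPn => by_; last by rewrite mulr0 subord_ge0.
have y0 : 0 < y by exact: lt_le_trans by_.
rewrite subordE// /c -[b ^+ n * _ * _]mulrA -expRD ler_pM ?expR_ge0 ?exprn_ge0 ?(ltW b0)//.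
  by rewrite lerXn2r ?nnegrE ?(ltW b0) ?(ltW y0).
rewrite ler_expR -opprD lerN2.
have E1 : y ^+ 2 * A ^+ 2 + t ^+ 2 / (4 * y ^+ 2) = (A * (y - b) * ((y + b) / y)) ^+ 2 + t * A.
  have tE : t = 2 * A * b ^+ 2 by rewrite bb /w; field; rewrite gt_eqF.
  by rewrite tE; field; rewrite gt_eqF.
rewrite E1 addrC lerD2l.
(* to the right of b, the factor (y + b) / y is at most 2 *)
have h1 : (y + b) / y <= 2 by rewrite ler_pdivrMr//; lra.
have h0 : 0 <= (y + b) / y by rewrite divr_ge0 ?addr_ge0// ltW.
have h2 : 0 <= A * (y - b) by rewrite mulr_ge0 ?subr_ge0// ltW.
have -> : 2 * A * (y - b) = A * (y - b) * 2 by ring.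
have p1 : 0 <= A * (y - b) * ((y + b) / y) by exact: mulr_ge0.
have p2 : 0 <= A * (y - b) * 2 by exact: mulr_ge0.
by rewrite ler_sqr ?nnegrE// ler_wpM2l.
Qed.

Local Notation beta := (n%:R / 2 + 1 : R).

Definition laplace_cst : R := 2 `^ (n%:R / 2) * (4 / sqpi) * (sqpi ^+ n * sqpi).

Lemma laplace_cst_ge0 : 0 <= laplace_cst.
Proof.
have h := ltW (@sqpi_gt0 R).
by rewrite /laplace_cst !mulr_ge0 ?powR_ge0 ?invr_ge0 ?exprn_ge0.
Qed.

(** The lower bound for the subordination integral, solved for the weight; the
    powers of A match because b^n / A is proportional to t^(n/2) A^(-n/2-1). *)
Lemma weight_subord (t A : R) : 0 < t -> 1 <= A ->
  ((A `^ (- beta) * expR (- (t * A)))%:E <=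
   (t `^ (- (n%:R / 2)) * (2 `^ (n%:R / 2) * (4 / sqpi)))%:E * \int[mu]_tau (subord t A tau)%:E)%E.
Proof.
move=> t0 A1; have A0 : 0 < A by exact: lt_le_trans A1.
have sp := @sqpi_gt0 R.
have c0 : (0 <= (t `^ (- (n%:R / 2)) * (2 `^ (n%:R / 2) * (4 / sqpi)))%:E)%E.
  by rewrite lee_fin !mulr_ge0 ?powR_ge0// invr_ge0 ltW.
apply: (le_trans _ (lee_wpmul2l c0 (subord_lb t0 A1))).
rewrite -EFinM lee_fin.
have A2 : 0 <= 2 * A by rewrite mulr_ge0// ltW.
have -> : (t / (2 * A)) `^ (n%:R / 2) = t `^ (n%:R / 2) * ((2 `^ (n%:R / 2))^-1 *
  A `^ (- (n%:R / 2))).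
  rewrite powRM ?(ltW t0) ?invr_ge0//; congr (_ * _).
  rewrite -powR_inv1// -powRrM mulN1r powRM ?(ltW A0)//.
  by rewrite powRN.
have -> : A `^ (- beta) = A `^ (- (n%:R / 2)) * A^-1.
  by rewrite opprD powRD ?(gt_eqF A0) ?implybT// powR_inv1// ltW.
rewrite [t `^ (- _)]powRN.
rewrite le_eqVlt; apply/orP; left; apply/eqP; field.
by rewrite !gt_eqF// powR_gt0.
Qed.

(** Insert the subordination bound, integrate the Gaussian in xi first, and then use
    that the resulting exponent tau^2 + s^2 / (4 tau^2) is at least s + (tau - b)^2
    with b^2 = s / 2, where s is the Lorentzian length of (x, t). *)
Lemma laplace_bound (x : E) (t : R) : 0 < t -> dotr x x <= t ^+ 2 ->
  (\int[mun]_xi (jbracket xi `^ (- beta) * expR (- (t * jbracket xi + dotr x xi)))%:E <=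
   (laplace_cst * t `^ (- (n%:R / 2)) * expR (- Num.sqrt (t ^+ 2 - dotr x x)))%:E)%E.
Proof.
move=> t0 xt.
have sp := @sqpi_gt0 R.
pose c := t `^ (- (n%:R / 2)) * (2 `^ (n%:R / 2) * (4 / sqpi)).
have c0 : 0 <= c by rewrite /c !mulr_ge0 ?powR_ge0// invr_ge0 ltW.
set s := Num.sqrt _.
have s0 : 0 <= s by exact: sqrtr_ge0.
have ss : s ^+ 2 = t ^+ 2 - dotr x x by rewrite sqr_sqrtr// subr_ge0.
have mj : measurable_fun setT (@jbracket R n) := @measurable_jbracket R n.
have ml : measurable_fun setT (dotr x) := @measurable_dotr R n x.
have mE : measurable_fun setT (fun xi : E => expR (- dotr x xi)).
  by apply: measurableT_comp => //; exact: measurable_funN.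
pose F (p : E * measurableTypeR R) : \bar R := (expR (- dotr x p.1) *
  subord t (jbracket p.1) p.2)%:E.
have F0 p : (0 <= F p)%E by rewrite lee_fin mulr_ge0 ?expR_ge0 ?subord_ge0.
have mF : measurable_fun setT F.
  apply/measurable_EFinP; apply: measurable_funM; first exact: (measurableT_comp mE).
  by apply: measurable_subord => //; exact: (measurableT_comp mj).
have mw : measurable_fun setT (fun xi : E => (jbracket xi `^ (- beta) * expR (- (t *
  jbracket xi + dotr x xi)))%:E).
  apply/measurable_EFinP; apply: measurable_funM.
    exact: (measurableT_comp (@measurable_powR R _) mj).
  apply: measurableT_comp => //; apply: measurable_funN; apply: measurable_funD => //.
  exact: measurable_funM.
apply: (@le_trans _ _ (\int[mun]_xi (c%:E * \int[mu]_tau F (xi, tau)))%E).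
  apply: ge0_le_integral => //.
  - by move=> xi _; rewrite lee_fin mulr_ge0 ?powR_ge0 ?expR_ge0.
  - apply: measurable_funeM.
    exact: (@measurable_fun_fubini_tonelli_F _ _ _ _ _ mu F).
  move=> xi _.
  have -> : (\int[mu]_tau F (xi, tau) = (expR (- dotr x xi))%:E *
    \int[mu]_tau (subord t (jbracket xi) tau)%:E)%E.
    rewrite -ge0_integralZl//.
    - by apply/measurable_EFinP; apply: measurable_subord => //; exact: measurable_id.
    - by move=> tau _; rewrite lee_fin subord_ge0.
  have -> : expR (- (t * jbracket xi + dotr x xi)) = expR (- (t * jbracket xi)) *
    expR (- dotr x xi).
    by rewrite -expRD opprD.
  rewrite mulrA EFinM muleC muleCA lee_wpmul2l ?lee_fin ?expR_ge0//.
  exact: weight_subord (jbracket_ge1 _).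
rewrite ge0_integralZl//; last 2 first.
- exact: (@measurable_fun_fubini_tonelli_F _ _ _ _ _ mu F).
- by move=> xi _; exact: integral_ge0.
rewrite (@fubini_tonelli _ _ _ _ _ mun mu F)//.
pose b := Num.sqrt (s / 2).
have bb : b ^+ 2 = s / 2 by rewrite sqr_sqrtr// divr_ge0.
have b0 : 0 <= b by exact: sqrtr_ge0.
have inner (tau : R) : (\int[mun]_xi F (xi, tau) <= (sqpi ^+ n * expR (- s))%:E *
  (expR (- (tau - b) ^+ 2))%:E)%E.
  have [tau0|tau0] := ltP 0 tau; last first.
    rewrite integral0_eq ?mule_ge0 ?lee_fin ?mulr_ge0 ?expR_ge0 ?exprn_ge0 ?(ltW sp)//.
    by move=> xi _; rewrite /F /subord ltNge tau0 mulr0.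
  have -> : (\int[mun]_xi F (xi, tau) = (tau ^+ n * expR (- (tau ^+ 2 +
    t ^+ 2 / (4 * tau ^+ 2))))%:E *
     \int[mun]_xi (expR (- (tau ^+ 2 * dotr xi xi + dotr x xi)))%:E)%E.
    rewrite -ge0_integralZl//.
    - apply: eq_integral => xi _; rewrite /F /= subordE// jbracket_sqr -EFinM; congr EFin.
      rewrite mulrCA -[in RHS]mulrA; congr (_ * _).
      by rewrite -!expRD; congr expR; ring.
    - apply/measurable_EFinP; apply: measurableT_comp => //; apply: measurable_funN;
        apply: measurable_funD => //.
      by apply: measurable_funM => //; exact: measurable_normsq.
    - by rewrite lee_fin mulr_ge0 ?expR_ge0// exprn_ge0// ltW.
  rewrite gaussn_linear// -!EFinM lee_fin expr_div_n.
  have -> : tau ^+ n * expR (- (tau ^+ 2 + t ^+ 2 / (4 * tau ^+ 2))) * (sqpi ^+ n / tau ^+ n *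
    expR (dotr x x / (4 * tau ^+ 2)))
    = sqpi ^+ n * expR (- (tau ^+ 2 + s ^+ 2 / (4 * tau ^+ 2))).
    have -> : - (tau ^+ 2 + s ^+ 2 / (4 * tau ^+ 2)) = - (tau ^+ 2 + t ^+ 2 / (4 * tau ^+ 2)) +
      dotr x x / (4 * tau ^+ 2).
      by rewrite ss; field; rewrite gt_eqF.
    by rewrite expRD; field; rewrite expf_neq0// gt_eqF.
  rewrite -[sqpi ^+ n * expR (- s) * _]mulrA -expRD ler_wpM2l ?exprn_ge0 ?(ltW sp)// ler_expR
    -opprD lerN2.
  have sE : s = 2 * b ^+ 2 by rewrite bb; field.
  have -> : tau ^+ 2 + s ^+ 2 / (4 * tau ^+ 2) = s + ((tau - b) * (1 + b / tau)) ^+ 2.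
    by rewrite sE; field; rewrite gt_eqF.
  have bt : 0 <= b / tau by rewrite divr_ge0// ltW.
  by rewrite lerD2l exprMn ler_peMr ?sqr_ge0// exprn_ege1// lerDl.
apply: (@le_trans _ _ (c%:E * \int[mu]_tau ((sqpi ^+ n * expR (- s))%:E *
  (expR (- (tau - b) ^+ 2))%:E))%E).
  apply: lee_wpmul2l => //; apply: ge0_le_integral => //.
  - by move=> tau _; exact: integral_ge0.
  - exact: (@measurable_fun_fubini_tonelli_G _ _ _ _ _ mun F).
  - apply: measurable_funeM; apply/measurable_EFinP; apply: measurableT_comp => //;
      apply: measurable_funN; apply: measurable_funX.
    by apply: measurable_funB => //; exact: measurable_id.
rewrite ge0_integralZl//.
- rewrite gauss_shift -!EFinM lee_fin /laplace_cst /c le_eqVlt; apply/orP; left; apply/eqP; ring.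
- apply/measurable_EFinP; apply: measurableT_comp => //; apply: measurable_funN;
    apply: measurable_funX.
  by apply: measurable_funB => //; exact: measurable_id.
- by rewrite lee_fin mulr_ge0 ?expR_ge0// exprn_ge0// ltW.
Qed.

End laplace.

(** * Integrals of negative powers of the phase *)

Section decay.
Context {R : realType} {n : nat}.
Local Notation E := (euclid R n).
Local Notation mu := (@lebesgue_measure R).
Local Notation mun := (@lebesgue_measuren R n).
Local Notation beta := (n%:R / 2 + 1 : R).

Definition expmean (y m : R) : R := if (0 < m) && (m <= 1) then m ^+ n * expR (- (m * y)) else 0.

Lemma expmean_ge0 y m : 0 <= expmean y m.
Proof.
by rewrite /expmean; case: ifPn => // /andP[h _]; rewrite mulr_ge0 ?expR_ge0// exprn_ge0// ltW.
Qed.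

Lemma measurable_expmean d (T : measurableType d) (f g : T -> R) :
  measurable_fun setT f -> measurable_fun setT g ->
  measurable_fun setT (fun z => expmean (f z) (g z)).
Proof.
move=> mf mg; apply: measurable_fun_ifT => //.
  by apply: measurable_and; [exact: measurable_fun_ltr|exact: measurable_fun_ler].
apply: measurable_funM; first by apply: measurable_funX.
by apply: measurableT_comp => //; apply: measurable_funN; exact: measurable_funM.
Qed.

(** On the interval [a/2, a] with a = 1 / (1 + y) the exponential is at least
    exp(-1); the length of the interval and m^n give the power of a. *)
Lemma expmean_lb (y : R) : 0 <= y ->
  (((1 + y)^-1 ^+ n.+1)%:E <= (2 ^+ n.+1 * expR 1)%:E * \int[mu]_m (expmean y m)%:E)%E.
Proof.
move=> y0; have y1 : 0 < 1 + y by rewrite ltr_pwDl.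
pose a := (1 + y)^-1.
have a0 : 0 < a by rewrite invr_gt0.
have a1 : a <= 1 by rewrite invf_le1// lerDl.
pose c := (a / 2) ^+ n * expR (- 1).
have c0 : 0 <= c by rewrite mulr_ge0 ?expR_ge0// exprn_ge0// divr_ge0// ltW.
pose J : set (measurableTypeR R) := `[a / 2, a]%classic.
have mJ : measurable J by exact: measurable_itv.
have muJ : lebesgue_measure J = (a / 2)%:E.
  rewrite lebesgue_measure_itv /= lte_fin ifT; last by rewrite ltr_pdivrMr//; lra.
  by rewrite -EFinB; congr EFin; field.
have h : ((c * (a / 2))%:E <= \int[mu]_m (expmean y m)%:E)%E.
  apply: (@le_trans _ _ (\int[mu]_m (c%:E * (\1_J m)%:E))%E).
    rewrite ge0_integralZl//; last by apply/measurable_EFinP; exact: measurable_indic.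
    have -> : (\int[mu]_m (\1_J m)%:E = (a / 2)%:E)%E by rewrite integral_indic// setIT; exact: muJ.
    by [].
  apply: ge0_le_integral => //.
  - by move=> m _; rewrite mule_ge0// lee_fin.
  - by apply: measurable_funeM; apply/measurable_EFinP; exact: measurable_indic.
  - by apply/measurable_EFinP; apply: measurable_expmean => //; exact: measurable_id.
  - move=> m _; rewrite -EFinM lee_fin indicE.
    have [|_] := boolP (m \in _); last by rewrite mulr0 expmean_ge0.
    rewrite inE /J /= in_itv /= => /andP[m1 m2]; rewrite mulr1.
    have m0 : 0 < m by apply: lt_le_trans m1; rewrite divr_gt0.
    rewrite /expmean m0 (le_trans m2)//= /c ler_pM ?expR_ge0 ?exprn_ge0 ?divr_ge0 ?(ltW a0)//.
      by rewrite lerXn2r ?nnegrE ?divr_ge0 ?(ltW a0) ?(ltW m0).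
    rewrite ler_expR lerN2.
    have : m * (1 + y) <= 1 by rewrite -ler_pdivlMr// mul1r.
    by have := ltW m0; lra.
have k0 : (0 <= (2 ^+ n.+1 * expR 1)%:E :> \bar R)%E by rewrite lee_fin mulr_ge0 ?expR_ge0//
  exprn_ge0.
apply: (le_trans _ (lee_wpmul2l k0 h)).
rewrite -EFinM lee_fin le_eqVlt -/a; apply/orP; left; apply/eqP.
rewrite /c expr_div_n !exprS expRN.
by field; rewrite expf_neq0//= gt_eqF// expR_gt0.
Qed.

(** The phase scaled by m is the phase of the point m (x, t), whose Lorentzian length
    is m times that of (x, t).  So laplace_bound bounds the exponential integral by
    a multiple of (m t)^(-n/2) exp(- m s), and
    subtracting s0 <= s in the exponent is affordable; the factor m^n makes the bound integrable at m = 0. *)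
Lemma decay_integral : exists C : R, 0 <= C /\ forall (x : E) (t s0 : R), 0 < t ->
  dotr x x <= t ^+ 2 -> 0 <= s0 -> s0 <= Num.sqrt (t ^+ 2 - dotr x x) ->
  (forall xi, 0 <= t * jbracket xi + dotr x xi - s0) ->
  (\int[mun]_xi (jbracket xi `^ (- beta) * ((1 + (t * jbracket xi +
    dotr x xi - s0))^-1) ^+ n.+1)%:E <=
   (C * t `^ (- (n%:R / 2)))%:E)%E.
Proof.
pose c : R := 2 ^+ n.+1 * expR 1.
have c0 : 0 <= c by rewrite mulr_ge0 ?expR_ge0// exprn_ge0.
have lc0 := @laplace_cst_ge0 R n.
exists (c * @laplace_cst R n); rewrite mulr_ge0//; split => // x t s0 t0 xt s00 s0le hk.
pose k xi := t * jbracket xi + dotr x xi - s0.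
have mj : measurable_fun setT (@jbracket R n) := @measurable_jbracket R n.
have ml : measurable_fun setT (dotr x) := @measurable_dotr R n x.
have mk : measurable_fun setT k.
  by apply: measurable_funB => //; apply: measurable_funD => //; exact: measurable_funM.
have mw : measurable_fun setT (fun xi : E => jbracket xi `^ (- beta)).
  exact: (measurableT_comp (@measurable_powR R _) mj).
have w0 (xi : E) : 0 <= jbracket xi `^ (- beta) by exact: powR_ge0.
pose F (p : E * measurableTypeR R) : \bar R := (jbracket p.1 `^ (- beta) * expmean (k p.1) p.2)%:E.
have F0 p : (0 <= F p)%E by rewrite lee_fin mulr_ge0 ?expmean_ge0.
have mF : measurable_fun setT F.
  apply/measurable_EFinP; apply: measurable_funM; first exact: (measurableT_comp mw).
  by apply: measurable_expmean => //; exact: (measurableT_comp mk).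
have k1 xi : 0 < 1 + k xi by rewrite ltr_pwDl// hk.
apply: (@le_trans _ _ (\int[mun]_xi (c%:E * \int[mu]_m F (xi, m)))%E).
  apply: ge0_le_integral => //.
  - by move=> xi _; rewrite lee_fin mulr_ge0// exprn_ge0// invr_ge0 ltW// k1.
  - apply/measurable_EFinP; apply: measurable_funM => //; apply: measurable_funX.
    by apply: measurable_inv_pos => //; exact: measurable_funD.
  - apply: measurable_funeM; exact: (@measurable_fun_fubini_tonelli_F _ _ _ _ _ mu F).
  move=> xi _.
  have -> : (\int[mu]_m F (xi, m) = (jbracket xi `^ (- beta))%:E *
    \int[mu]_m (expmean (k xi) m)%:E)%E.
    rewrite -ge0_integralZl//.
    - by apply/measurable_EFinP; apply: measurable_expmean => //; exact: measurable_id.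
    - by move=> m _; rewrite lee_fin expmean_ge0.
    - by rewrite lee_fin.
  rewrite EFinM muleCA lee_wpmul2l ?lee_fin//.
  exact: expmean_lb (hk xi).
rewrite ge0_integralZl//; last 2 first.
- exact: (@measurable_fun_fubini_tonelli_F _ _ _ _ _ mu F).
- by move=> xi _; exact: integral_ge0.
rewrite (@fubini_tonelli _ _ _ _ _ mun mu F)//.
pose I : set (measurableTypeR R) := `[0, 1]%classic.
have mI : measurable I by exact: measurable_itv.
have muI : lebesgue_measure I = 1%:E.
  by rewrite lebesgue_measure_itv /= lte_fin ltr01 sube0.
pose K := @laplace_cst R n * t `^ (- (n%:R / 2)).
have K0 : 0 <= K by rewrite mulr_ge0 ?powR_ge0.
have -> : ((c * @laplace_cst R n * t `^ (- (n%:R / 2)))%:E = c%:E *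
  K%:E)%E by rewrite -EFinM /K [in RHS]mulrA.
apply: lee_wpmul2l; first by rewrite lee_fin.
have inner (m : R) : (\int[mun]_xi F (xi, m) <= K%:E * (\1_I m)%:E)%E.
  have [/andP[m0 m1]|nm] := boolP ((0 < m) && (m <= 1)); last first.
    rewrite integral0_eq; first by rewrite mule_ge0 ?lee_fin.
    by move=> xi _; rewrite /F /expmean (negbTE nm) mulr0.
  have mt : 0 < m * t by rewrite mulr_gt0.
  have -> : (\int[mun]_xi F (xi, m) = (m ^+ n * expR (m * s0))%:E *
     \int[mun]_xi (jbracket xi `^ (- beta) * expR (- (m * t * jbracket xi +
       dotr (vscale m x) xi)))%:E)%E.
    rewrite -ge0_integralZl//.
    - apply: eq_integral => xi _; rewrite /F /expmean m0 m1 /= -EFinM; congr EFin.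
      have -> : expR (- (m * k xi)) = expR (m * s0) * expR (- (m * t * jbracket xi +
        dotr (vscale m x) xi)).
        rewrite -expRD; congr expR; rewrite /k [dotr (vscale _ _)
          _]dotrC dotr_vscale [dotr xi x]dotrC; ring.
      by ring.
    - apply/measurable_EFinP; apply: measurable_funM => //.
      apply: measurableT_comp => //; apply: measurable_funN; apply: measurable_funD;
        last exact: measurable_dotr.
      exact: measurable_funM.
    - by move=> xi _; rewrite lee_fin mulr_ge0 ?expR_ge0.
    - by rewrite lee_fin mulr_ge0 ?expR_ge0// exprn_ge0// ltW.
  have xm : dotr (vscale m x) (vscale m x) = m ^+ 2 * dotr x x.
    by rewrite dotr_vscale [dotr (vscale _ _) _]dotrC dotr_vscale; ring.
  have e0 : (0 <= (m ^+ n * expR (m * s0))%:E)%E by rewrite lee_fin mulr_ge0 ?expR_ge0//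
    exprn_ge0// ltW.
  have xm2 : dotr (vscale m x) (vscale m x) <= (m * t) ^+ 2.
    by rewrite xm exprMn ler_wpM2l// sqr_ge0.
  apply: (le_trans (lee_wpmul2l e0 (laplace_bound mt xm2))).
  rewrite indicE mem_set; last by rewrite /I /= in_itv /= m1 ltW.
  rewrite -!EFinM mulr1 lee_fin xm exprMn -mulrBr sqrtrM ?sqr_ge0// sqrtr_sqr (ger0_norm (ltW m0)).
  rewrite powRM ?(ltW m0) ?(ltW t0)//.
  have -> : m ^+ n * expR (m * s0) * (@laplace_cst R n * (m `^ (- (n%:R / 2)) *
    t `^ (- (n%:R / 2))) * expR (- (m * Num.sqrt (t ^+ 2 - dotr x x)))) =
    K * ((m ^+ n * m `^ (- (n%:R / 2))) * (expR (m * s0) * expR (- (m *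
      Num.sqrt (t ^+ 2 - dotr x x))))).
    by rewrite /K; ring.
  rewrite ler_piMr// mulr_ile1// ?mulr_ge0 ?expR_ge0 ?powR_ge0 ?exprn_ge0 ?(ltW m0)//.
    rewrite -powR_mulrn ?(ltW m0)// -powRD; last by rewrite (gt_eqF m0) implybT.
    apply: (@le_trans _ _ (1 `^ (n%:R + - (n%:R / 2)))); last by rewrite powR1.
    rewrite ge0_ler_powR ?nnegrE ?(ltW m0)//.
    have : 0 <= n%:R :> R by [].
    lra.
  rewrite -expRD -expR0 ler_expR -mulrBr pmulr_rle0// subr_le0//.
apply: (@le_trans _ _ (\int[mu]_m (K%:E * (\1_I m)%:E))%E).
  apply: ge0_le_integral => //.
  - by move=> m _; exact: integral_ge0.
  - exact: (@measurable_fun_fubini_tonelli_G _ _ _ _ _ mun F).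
  - by apply: measurable_funeM; apply/measurable_EFinP; exact: measurable_indic.
rewrite ge0_integralZl//; last by apply/measurable_EFinP; exact: measurable_indic.
have -> : (\int[mu]_m (\1_I m)%:E = 1%:E)%E by rewrite integral_indic// setIT; exact: muI.
by rewrite mule1.
Qed.

End decay.

(** * Vector fields and their adjoints *)

Section vector_field.
Context {R : realType} {n : nat}.
Local Notation E := (euclid R n).
Local Notation mun := (@lebesgue_measuren R n).

(** The vector field a D + b E, where D differentiates in a fixed direction and E is
    the Euler field, with the derivative of each coefficient along its own flow: these
    two derivatives are all that the divergence involves. *)
Record vfield := VField {
  vf_dir : E ;
  vf_a : E -> R ; vf_a' : E -> R ;
  vf_b : E -> R ; vf_b' : E -> R ;
  vf_da : derivative_along (trans vf_dir) vf_a vf_a' ;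
  vf_db : derivative_along dil vf_b vf_b' }.

Implicit Types (v : vfield) (f g : E -> R).

Definition vdiv v xi := vf_a' v xi + vf_b' v xi + n%:R * vf_b v xi.

(** g is the derivative of f along v.  The existence of both directional derivatives
    is required, and not only of their combination, so that products and integration
    by parts can be treated one flow at a time. *)
Definition vderive v f g := exists fx fE,
  [/\ derivative_along (trans (vf_dir v)) f fx, derivative_along dil f fE &
   forall xi, g xi = vf_a v xi * fx xi + vf_b v xi * fE xi].

Lemma vderive_eq v f g g' : vderive v f g -> g =1 g' -> vderive v f g'.
Proof. by move=> h /funext <-. Qed.

Lemma vderive_meas v f g : vderive v f g -> measurable_fun setT f.
Proof. by move=> [fx [fE [/da_meas]]]. Qed.

Lemma vderive_cst v (a : R) : vderive v (fun=> a) (fun=> 0).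
Proof.
exists (fun=> 0), (fun=> 0); split; [exact: da_cst|exact: da_cst|].
by move=> xi; rewrite !mulr0 addr0.
Qed.

Lemma vderive_add v f f' g g' : vderive v f f' -> vderive v g g' ->
  vderive v (fun xi => f xi + g xi) (fun xi => f' xi + g' xi).
Proof.
move=> [fx [fE [h1 h2 h3]]] [gx [gE [k1 k2 k3]]].
exists (fun xi => fx xi + gx xi), (fun xi => fE xi + gE xi); split.
- exact: da_add.
- exact: da_add.
- by move=> xi; rewrite h3 k3; ring.
Qed.

Lemma vderive_mul v f f' g g' : vderive v f f' -> vderive v g g' ->
  vderive v (fun xi => f xi * g xi) (fun xi => f' xi * g xi + f xi * g' xi).
Proof.
move=> [fx [fE [h1 h2 h3]]] [gx [gE [k1 k2 k3]]].
exists (fun xi => fx xi * g xi + f xi * gx xi), (fun xi => fE xi * g xi + f xi * gE xi); split.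
- exact: (da_mul (trans_flow _)).
- exact: (da_mul dil_flow).
- by move=> xi; rewrite h3 k3; ring.
Qed.

Lemma vderive_comp v (h h' : R -> R) f f' : vderive v f f' ->
  measurable_fun setT (h \o f) -> measurable_fun setT (h' \o f) ->
  locally_bounded (h \o f) -> locally_bounded (h' \o f) ->
  (forall xi, is_derive (f xi) (1 : R) h (h' (f xi))) ->
  vderive v (h \o f) (fun xi => h' (f xi) * f' xi).
Proof.
move=> [fx [fE [h1 h2 h3]]] mh mh' bh bh' dh.
exists (fun xi => h' (f xi) * fx xi), (fun xi => h' (f xi) * fE xi); split.
- exact: (da_comp (trans_flow _)).
- exact: (da_comp dil_flow).
- by move=> xi; rewrite h3; ring.
Qed.

Lemma vderive_scale v (a : R) f f' : vderive v f f' -> vderive v (fun xi => a *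
  f xi) (fun xi => a * f' xi).
Proof.
by move=> h; apply: vderive_eq (vderive_mul (vderive_cst v a) h) _ => xi; rewrite mul0r add0r.
Qed.

Lemma vderive_inv v f f' : vderive v f f' -> (forall xi, 0 < f xi) ->
  locally_bounded (fun xi => (f xi)^-1) ->
  vderive v (fun xi => (f xi)^-1) (fun xi => - (f xi)^-1 ^+ 2 * f' xi).
Proof.
move=> [fx [fE [h1 h2 h3]]] f0 bf.
exists (fun xi => - (f xi)^-1 ^+ 2 * fx xi), (fun xi => - (f xi)^-1 ^+ 2 * fE xi); split.
- exact: (da_inv (trans_flow _)).
- exact: (da_inv dil_flow).
- by move=> xi; rewrite h3; ring.
Qed.

Lemma vderive_exp v f f' m : vderive v f f' ->
  vderive v (fun xi => f xi ^+ m) (fun xi => m%:R * f xi ^+ m.-1 * f' xi).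
Proof.
move=> h; elim: m => [|[|m] IHm].
- by apply: vderive_eq (vderive_cst _ 1) _ => xi; rewrite !mul0r.
- by apply: vderive_eq h _ => xi; rewrite expr0 !mul1r.
- have := vderive_mul h IHm.
  rewrite (_ : (fun xi => f xi * f xi ^+ m.+1) = (fun xi => f xi ^+ m.+2)); last first.
    by apply/funext => xi; rewrite -exprS.
  move/vderive_eq; apply => xi /=.
  by rewrite exprS -[m.+2%:R]natr1 -[m.+1%:R]natr1; ring.
Qed.

Lemma vderive_sin v f f' : vderive v f f' -> vderive v (sin \o f) (fun xi => cos (f xi) * f' xi).
Proof.
move=> h; have mf := vderive_meas h; apply: vderive_comp => //.
- by apply: measurableT_comp => //; apply: continuous_measurable_fun; exact: continuous_sin.
- by apply: measurableT_comp => //; apply: continuous_measurable_fun; exact: continuous_cos.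
- by move=> L; exists 1 => xi _; rewrite ler_norml sin_geN1 sin_le1.
- by move=> L; exists 1 => xi _; rewrite ler_norml cos_geN1 cos_le1.
Qed.

(** Apply flow_ibp to a f along translations and to b f along dilations, whose
    divergence n accounts for the last term of vdiv. *)
Lemma vderive_ibp v f g (L : R) : vderive v f g -> (forall xi, L < jbracket xi -> f xi = 0) ->
  mun.-integrable setT (EFin \o (fun xi => g xi + vdiv v xi * f xi)) /\
  \int[mun]_xi (g xi + vdiv v xi * f xi) = 0.
Proof.
move=> [fx [fE [h1 h2 h3]]] f0.
have [i1 i2 i3] := flow_ibp (trans_flow _) (da_mul (trans_flow _) (vf_da v) h1)
  (L := L) (fun xi h => etrans (congr1 _ (f0 _ h)) (mulr0 _)).
have [j1 j2 j3] := flow_ibp dil_flow (da_mul dil_flow (vf_db v) h2)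
  (L := L) (fun xi h => etrans (congr1 _ (f0 _ h)) (mulr0 _)).
pose G1 xi := vf_a' v xi * f xi + vf_a v xi * fx xi + 0 * (vf_a v xi * f xi).
pose G2 xi := vf_b' v xi * f xi + vf_b v xi * fE xi + n%:R * (vf_b v xi * f xi).
have I1 : mun.-integrable setT (EFin \o G1).
  apply: eq_integrable i2 => // xi _ /=; by rewrite /G1 mul0r addr0.
have I2 : mun.-integrable setT (EFin \o G2).
  apply: (@eq_integrable _ _ _ _ _ _ ((EFin \o (fun xi => (vf_b' v xi * f xi +
    vf_b v xi * fE xi)%R)) \+ (fun xi => n%:R%:E * (EFin \o (fun xi => (vf_b v xi *
      f xi)%R)) xi))%E) => //.
  by apply: integrableD => //; exact: integrableZl.
have -> : (fun xi => g xi + vdiv v xi * f xi) = (fun xi => G1 xi + G2 xi).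
  by apply/funext => xi; rewrite /G1 /G2 h3 /vdiv; ring.
split.
  by apply: (@eq_integrable _ _ _ _ _ _ ((EFin \o G1) \+ (EFin \o G2))%E) => //; exact: integrableD.
by rewrite RintegralD// i3 j3 addr0.
Qed.

End vector_field.

(** * Derivatives of the bracket and of linear forms *)

Section base_derivatives.
Context {R : realType} {n : nat}.
Local Notation E := (euclid R n).
Implicit Types (x xi : E).

Lemma dotr_le x xi : `|dotr x xi| <= enorm x * enorm xi.
Proof.
rewrite -ler_sqr ?nnegrE ?mulr_ge0 ?sqrtr_ge0//.
by rewrite real_normK ?num_real// exprMn !enorm_sqr dotr_CS.
Qed.

Lemma enorm_le_jbracket xi : enorm xi <= jbracket xi.
Proof.
by rewrite -ler_sqr ?nnegrE ?sqrtr_ge0// jbracket_sqr enorm_sqr lerDr.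
Qed.

Lemma locally_bounded_dotr x : locally_bounded (dotr x : E -> R).
Proof.
move=> L; exists (enorm x * L) => xi h.
rewrite (le_trans (dotr_le _ _))// ler_wpM2l ?sqrtr_ge0//.
exact: le_trans (enorm_le_jbracket xi) h.
Qed.

Lemma locally_bounded_jbracket : locally_bounded (@jbracket R n).
Proof. by move=> L; exists L => xi h; rewrite ger0_norm// ltW// jbracket_gt0. Qed.

Lemma jbracketV_le1 xi : 0 <= (jbracket xi)^-1 <= 1.
Proof. by rewrite invr_ge0 ltW ?jbracket_gt0//= invf_le1 ?jbracket_gt0// jbracket_ge1. Qed.

Lemma locally_bounded_jbracketV : locally_bounded (fun xi : E => (jbracket xi)^-1).
Proof. by move=> L; exists 1 => xi h; have /andP[h0 h1] := jbracketV_le1 xi; rewrite ger0_norm. Qed.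

Lemma measurable_jbracketV : measurable_fun setT (fun xi : E => (jbracket xi)^-1).
Proof. by apply: measurable_inv_pos; [exact: measurable_jbracket|exact: jbracket_gt0]. Qed.

Lemma da_dotr_trans x : derivative_along (trans x) (dotr x) (fun=> dotr x x).
Proof.
split; [exact: measurable_dotr|exact: measurable_cst|exact: locally_bounded_dotr|exact:
  locally_bounded_cst|].
move=> xi; rewrite (_ : (fun t => _) = (fun t => dotr x xi + t * dotr x x)); last first.
  by apply/funext => t; rewrite dotr_trans.
by apply: is_derive_eq; rewrite /GRing.scale /= ; ring.
Qed.

Lemma da_dotr_dil x : derivative_along dil (dotr x : E -> R) (dotr x).
Proof.
split; [exact: measurable_dotr|exact: measurable_dotr|exact: locally_bounded_dotr|exact:
  locally_bounded_dotr|].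
move=> xi; rewrite (_ : (fun t => _) = (fun t => expR t * dotr x xi)); last first.
  by apply/funext => t; rewrite dotr_dil.
by apply: is_derive_eq; rewrite /GRing.scale /= expR0; ring.
Qed.

Lemma jbracketE xi : jbracket xi = Num.sqrt (1 + dotr xi xi).
Proof. by rewrite /jbracket enorm_sqr. Qed.

Lemma is_derive_sqrt_comp (f : R -> R) (t df : R) : 0 < f t -> is_derive t (1 : R) f df ->
  is_derive t (1 : R) (fun s => Num.sqrt (f s)) ((2 * Num.sqrt (f t))^-1 * df).
Proof. by move=> f0 hf; apply: is_derive1_comp; exact: is_derive1_sqrt. Qed.

Lemma da_jbracket_trans x : derivative_along (trans x) (@jbracket R n) (fun xi => dotr x xi *
  (jbracket xi)^-1).
Proof.
split; [exact: measurable_jbracket| |exact: locally_bounded_jbracket| |].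
- by apply: measurable_funM; [exact: measurable_dotr|exact: measurable_jbracketV].
- by apply: locally_boundedM; [exact: locally_bounded_dotr|exact: locally_bounded_jbracketV].
move=> xi; rewrite (_ : (fun t => _) = (fun t => Num.sqrt (1 + (dotr xi xi +
  2 * t * dotr x xi + t * t * dotr x x)))); last first.
  by apply/funext => t; rewrite jbracketE normsq_trans expr2.
have E0 : 1 + (dotr xi xi + 2 * 0 * dotr x xi + 0 * 0 * dotr x x) = 1 + dotr xi xi by ring.
apply: is_derive_eq.
  apply: (@is_derive_sqrt_comp (fun t => 1 + (dotr xi xi + 2 * t * dotr x xi + t * t * dotr x x))).
  by rewrite E0 ltr_pwDl// dotrr_ge0.
rewrite /= E0 -jbracketE /GRing.scale /=.
by field; rewrite gt_eqF// jbracket_gt0.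
Qed.

Lemma da_jbracket_dil : derivative_along dil (@jbracket R n) (fun xi => jbracket xi +
  -1 * (jbracket xi)^-1).
Proof.
split; [exact: measurable_jbracket| |exact: locally_bounded_jbracket| |].
- by apply: measurable_funD; [exact: measurable_jbracket|apply: measurable_funM => //;
    exact: measurable_jbracketV].
- apply: locally_boundedD; [exact: locally_bounded_jbracket|].
  by apply: locally_boundedM; [exact: locally_bounded_cst|exact: locally_bounded_jbracketV].
move=> xi; rewrite (_ : (fun t => _) = (fun t => Num.sqrt (1 + expR t * expR t * dotr xi xi)));
  last first.
  by apply/funext => t; rewrite jbracketE normsq_dil expr2.
have E0 : 1 + expR 0 * expR 0 * dotr xi xi = 1 + dotr xi xi by rewrite expR0; ring.
apply: is_derive_eq.
  apply: (@is_derive_sqrt_comp (fun t => 1 + expR t * expR t * dotr xi xi)).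
  by rewrite E0 ltr_pwDl// dotrr_ge0.
rewrite /= E0 -jbracketE /GRing.scale /= expR0.
have -> : dotr xi xi = jbracket xi ^+ 2 - 1 by rewrite jbracket_sqr; ring.
by field; rewrite gt_eqF// jbracket_gt0.
Qed.

End base_derivatives.

(** * Uniform symbols and non-stationary phase *)

Section symbols.
Context {R : realType} {n : nat} {P : Type}.
Local Notation E := (euclid R n).
Local Notation mun := (@lebesgue_measuren R n).
Variables (v : P -> @vfield R n) (om : P -> E -> R).
Hypothesis om1 : forall p xi, 1 <= om p xi.
Implicit Types (f g M : P -> E -> R) (N : nat).

(** Symbols of size M that can be differentiated N times along v, each derivative
    costing at most a factor om.  The constants are uniform in the parameter p: this
    is where the independence of the final constant from x, t and the cutoff comes
    from. *)
Fixpoint symbol N f M : Prop :=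
  (exists C, 0 <= C /\ forall p xi, `|f p xi| <= C * M p xi) /\
  match N with
  | 0 => forall p, measurable_fun setT (f p)
  | N'.+1 => exists g, (forall p, vderive (v p) (f p) (g p)) /\ symbol N' g (fun p xi => M p xi
    * om p xi)
  end.

Lemma symbol_bd N f M : symbol N f M -> exists C, 0 <= C /\ forall p xi, `|f p xi| <= C * M p xi.
Proof. by case: N => [|N] []. Qed.

Lemma symbol_weak N f M M' : (exists C, 0 <= C /\ forall p xi, M p xi <= C * M' p xi) ->
  symbol N f M -> symbol N f M'.
Proof.
elim: N f M M' => [|N IHN] f M M' [C [C0 hC]] [[D [D0 hD]] h].
  split; last exact: h.
  exists (D * C); rewrite mulr_ge0//; split => // p xi.
  by rewrite (le_trans (hD _ _))// -mulrA ler_wpM2l.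
have [g [h1 h2]] := h.
split.
  exists (D * C); rewrite mulr_ge0//; split => // p xi.
  by rewrite (le_trans (hD _ _))// -mulrA ler_wpM2l.
exists g; split => //; apply: IHN h2; exists C; split => // p xi.
by rewrite mulrA ler_wpM2r// (le_trans _ (om1 p xi)).
Qed.

Lemma symbol_weak1 N f M M' : (forall p xi, M p xi <= M' p xi) -> symbol N f M -> symbol N f M'.
Proof. by move=> h; apply: symbol_weak; exists 1; split => // p xi; rewrite mul1r. Qed.

Lemma symbol_eq N f g M : (forall p xi, f p xi = g p xi) -> symbol N f M -> symbol N g M.
Proof.
move=> h; suff -> : f = g by [].
by apply/funext => p; apply/funext => xi.
Qed.

Lemma symbolS N f M : symbol N.+1 f M -> symbol N f M.
Proof.
elim: N f M => [|N IHN] f M [h1 [g [h2 h3]]].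
  by split => // p; exact: vderive_meas (h2 p).
by split => //; exists g; split => //; exact: IHN.
Qed.

Lemma symbol_cst0 N M : (forall p xi, 0 <= M p xi) -> symbol N (fun _ _ => 0) M.
Proof.
elim: N M => [|N IHN] M M0; (split; first by exists 1; split => // p xi; rewrite normr0 mul1r).
  by move=> p; exact: measurable_cst.
exists (fun _ _ => 0); split; first by move=> p; exact: vderive_cst.
by apply: IHN => p xi; rewrite mulr_ge0// (le_trans _ (om1 p xi)).
Qed.

Lemma symbol_add N f g M : symbol N f M -> symbol N g M -> symbol N (fun p xi => f p xi + g p xi) M.
Proof.
elim: N f g M => [|N IHN] f g M [[C [C0 hC]] h] [[D [D0 hD]] k];
  (split; first by exists (C + D); rewrite addr_ge0//; split => // p xi;
    rewrite mulrDl (le_trans (ler_normD _ _))// lerD).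
  by move=> p; apply: measurable_funD.
have [f' [hf1 hf2]] := h; have [g' [hg1 hg2]] := k.
exists (fun p xi => f' p xi + g' p xi); split; last exact: IHN.
by move=> p; exact: vderive_add.
Qed.

Lemma symbol_mul N f g M M' : symbol N f M -> symbol N g M' ->
  symbol N (fun p xi => f p xi * g p xi) (fun p xi => M p xi * M' p xi).
Proof.
elim: N f g M M' => [|N IHN] f g M M' hh kk.
  have [[C [C0 hC]] h] := hh; have [[D [D0 hD]] k] := kk.
  split; last by move=> p; exact: measurable_funM.
  exists (C * D); rewrite mulr_ge0//; split => // p xi.
  by rewrite normrM mulrACA ler_pM.
have [[C [C0 hC]] h] := hh; have [[D [D0 hD]] k] := kk.
split.
  exists (C * D); rewrite mulr_ge0//; split => // p xi.
  by rewrite normrM mulrACA ler_pM.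
have [f' [hf1 hf2]] := h; have [g' [hg1 hg2]] := k.
exists (fun p xi => f' p xi * g p xi + f p xi * g' p xi); split; first by move=> p;
  exact: vderive_mul.
apply: symbol_add.
  apply: symbol_weak1 (IHN _ _ _ _ hf2 (symbolS kk)) => p xi.
  by rewrite mulrAC.
apply: symbol_weak1 (IHN _ _ _ _ (symbolS hh) hg2) => p xi.
by rewrite mulrA.
Qed.

Lemma symbol_par N (k : P -> R) : symbol N (fun p _ => k p) (fun p _ => `|k p|).
Proof.
have bd : exists C, 0 <= C /\ forall p (xi : E), `|k p| <= C * `|k p|.
  by exists 1; split => // p xi; rewrite mul1r.
case: N => [|N]; (split; first exact: bd).
  by move=> p; exact: measurable_cst.
exists (fun _ _ => 0); split; first by move=> p; exact: vderive_cst.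
by apply: symbol_cst0 => p xi; rewrite mulr_ge0// (le_trans _ (om1 p xi)).
Qed.

Lemma symbol_cst N (a : R) : symbol N (fun _ _ => a) (fun _ _ => 1).
Proof.
apply: symbol_weak (symbol_par N (fun=> a)); exists `|a|; split => // _ _.
by rewrite mulr1.
Qed.

Lemma symbol_step N f g M : (exists C, 0 <= C /\ forall p xi, `|f p xi| <= C * M p xi) ->
  (forall p, vderive (v p) (f p) (g p)) -> symbol N g (fun p xi => M p xi *
    om p xi) -> symbol N.+1 f M.
Proof. by move=> h1 h2 h3; split => //; exists g. Qed.

Section oscillation.
Variables (k e Hp : P -> E -> R) (K : P -> R).
Hypothesis K1 : forall p, 1 <= K p.
Hypothesis omE : forall p xi, om p xi ^+ 2 = 1 + k p xi.
Hypothesis hH : forall p, vderive (v p) (Hp p) (fun xi => k p xi + e p xi).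
Hypothesis he : forall N, symbol N e (fun p _ => K p).
Hypothesis hdiv : forall N, symbol N (fun p => vdiv (v p)) (fun _ _ => 1).
Hypothesis hk : forall N, symbol N (fun p xi => (1 + k p xi)^-1) (fun p xi => om p xi ^- 2).

Lemma osc_integrable f M L B p c : symbol 0 f M -> (forall xi, L < jbracket xi -> M p xi = 0) ->
  (forall xi, jbracket xi <= L -> `|M p xi| <= B) ->
  measurable_fun setT (Hp p) -> mun.-integrable setT (EFin \o (fun xi => f p xi *
    cos (Hp p xi + c))).
Proof.
move=> [[C [C0 hC]] mf] M0 MB mH.
apply: (@bounded_jball_integrable _ _ _ L (C * B)).
- apply: measurable_funM => //.
  have mc : measurable_fun setT (@cos R) by apply: continuous_measurable_fun; exact: continuous_cos.
  by apply: (measurableT_comp mc); exact: measurable_funD.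
- move=> xi /negP; rewrite /jball /= -ltNge => h.
  have := hC p xi; rewrite M0// mulr0 normr_le0 => /eqP ->; by rewrite mul0r.
- move=> xi h; rewrite normrM -[leRHS]mulr1 ler_pM//.
    rewrite (le_trans (hC _ _))// ler_wpM2l// (le_trans (ler_norm _))// MB//.
  by rewrite ler_norml cos_geN1 cos_le1.
Qed.

(** Here k + e is the derivative of the phase Hp, with k large and e an error
    of size K.  Put q = f / (1 + k).  Then f cos Hp = (1 - e) q cos Hp + q v(sin Hp),
    and an integration by parts moves v from sin Hp to q.  Both resulting
    amplitudes are symbols of order one less and of size at most K M / om.  Since
    sin is a shifted cos, the two terms have the original form, and the induction
    closes provided that the constant phase c is arbitrary. *)
Lemma oscillatory_bound N f M :
  symbol N f M -> (forall p xi, 0 <= M p xi) ->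
  (forall p, exists L, forall xi, L < jbracket xi -> M p xi = 0) ->
  (forall p, measurable_fun setT (M p)) -> (forall p, locally_bounded (M p)) ->
  (forall p, measurable_fun setT (om p)) ->
  exists C, 0 <= C /\ forall p c,
    (`|\int[mun]_xi (f p xi * cos (Hp p xi + c))|%:E <=
     (C * K p ^+ N)%:E * \int[mun]_xi (M p xi * (om p xi)^-1 ^+ N)%:E)%E.
Proof.
move=> sf M_ge0 M0 mM bM mom.
have om0 p xi : 0 < om p xi by exact: lt_le_trans (om1 p xi).
have K0 p : 0 < K p by exact: lt_le_trans (K1 p).
have mom' p : measurable_fun setT (fun xi => (om p xi)^-1) by exact: measurable_inv_pos.
elim: N f M sf M_ge0 M0 mM bM => [|N IHN] f M sf M_ge0 M0 mM bM.
  have [[C [C0 hC]] mf] := sf; exists C; split => // p c.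
  have [L hL] := M0 p; have [B hB] := bM p L.
  have ig := osc_integrable c sf hL hB (vderive_meas (hH p)).
  rewrite EFin_normr_Rintegral//.
  apply: (le_trans (le_abse_integral _ _ (measurable_int _ ig))) => //.
  have mM' : measurable_fun setT (fun xi => (M p xi * (om p xi)^-1 ^+ 0)%:E).
    by apply/measurable_EFinP; apply: measurable_funM => //; exact: measurable_funX.
  rewrite expr0 mulr1 -ge0_integralZl//; last by move=> xi _; rewrite expr0 mulr1 lee_fin.
  apply: ge0_le_integral => //.
  - by apply: measurableT_comp => //; exact: (measurable_int _ ig).
  - exact: measurable_funeM.
  - move=> xi _; rewrite expr0 mulr1 -EFinM /= lee_fin normrM -[leRHS]mulr1 ler_pM//.
    by rewrite ler_norml cos_geN1 cos_le1.
pose M1 p xi := K p * (M p xi * (om p xi)^-1).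
(* f1 and f2 are the amplitudes left after one integration by parts *)
pose iq p xi := (1 + k p xi)^-1.
pose q p xi := f p xi * iq p xi.
have sq : symbol N.+1 q (fun p xi => M p xi * om p xi ^- 2) by exact: symbol_mul sf (hk _).
have [_ [wq [hwq swq]]] := sq.
pose f1 p xi := (1 + -1 * e p xi) * q p xi.
pose f2 p xi := wq p xi + vdiv (v p) xi * q p xi.
have omm p xi : om p xi ^- 2 <= (om p xi)^-1.
  by rewrite -exprVn expr2 ler_piMr ?invr_ge0 ?(ltW (om0 _ _))// invf_le1.
have Mo p xi : 0 <= M p xi * (om p xi)^-1 by rewrite mulr_ge0// invr_ge0 ltW.
have s1 : symbol N f1 M1.
  apply: symbol_weak1 (symbol_mul (symbol_add (symbol_weak1 _ (symbol_cst N 1)) (symbol_weak1 _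
    (symbol_mul (symbol_cst N (-1)) (he N)))) (symbolS sq)) => p xi; last 2 first.
  - exact: K1.
  - by rewrite mul1r.
  by rewrite /M1 ler_wpM2l ?(ltW (K0 _))// ler_wpM2l.
have s2 : symbol N f2 M1.
  apply: symbol_add.
    apply: symbol_weak1 swq => p xi.
    rewrite -mulrA -exprVn expr2 -mulrA mulVf ?gt_eqF// mulr1 /M1.
    by rewrite ler_peMl.
  apply: symbol_weak1 (symbol_mul (hdiv N) (symbolS sq)) => p xi.
  rewrite mul1r /M1 (@le_trans _ _ (M p xi * (om p xi)^-1))//.
    by rewrite ler_wpM2l.
  by rewrite ler_peMl.
have M1_ge0 p xi : 0 <= M1 p xi by rewrite /M1 mulr_ge0// ltW.
have M10 p : exists L, forall xi, L < jbracket xi -> M1 p xi = 0.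
  by have [L hL] := M0 p; exists L => xi h; rewrite /M1 hL// mul0r mulr0.
have mM1 p : measurable_fun setT (M1 p).
  by apply: measurable_funM => //; exact: measurable_funM.
have bM1 p : locally_bounded (M1 p).
  apply: locally_boundedM; first exact: locally_bounded_cst.
  apply: locally_boundedM => // L; exists 1 => xi _.
  by rewrite ger0_norm ?invr_ge0 ?(ltW (om0 _ _))// invf_le1.
have [C1 [C10 h1]] := IHN _ _ s1 M1_ge0 M10 mM1 bM1.
have [C2 [C20 h2]] := IHN _ _ s2 M1_ge0 M10 mM1 bM1.
exists (C1 + C2); rewrite addr_ge0//; split => // p c.
have [L hL] := M0 p; have [B hB] := bM p L.
have [L1 hL1] := M10 p; have [B1 hB1] := bM1 p L1.
have S0 g g' : symbol N g g' -> symbol 0 g g' by case: (N) => [|N'] // [? [? [hh _]]];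
  split => // p'; exact: vderive_meas (hh p').
have i1 := osc_integrable c (S0 _ _ s1) hL1 hB1 (vderive_meas (hH p)).
have i2 := osc_integrable (c - pi / 2) (S0 _ _ s2) hL1 hB1 (vderive_meas (hH p)).
have q0 xi : L < jbracket xi -> q p xi = 0.
  move=> h; have [C [C0 hC]] := symbol_bd sf.
  by have := hC p xi; rewrite hL// mulr0 normr_le0 /q => /eqP ->; rewrite mul0r.
have wH : vderive (v p) (fun xi => Hp p xi + c) (fun xi => k p xi + e p xi + 0).
  exact: vderive_add (hH p) (vderive_cst _ _).
have wqs := vderive_mul (hwq p) (vderive_sin wH).
have [I3 I30] : mun.-integrable setT (EFin \o (fun xi =>
    (wq p xi * (sin \o (fun xi => Hp p xi + c)) xi + q p xi * (cos (Hp p xi + c) * (k p xi +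
      e p xi + 0)))
     + vdiv (v p) xi * (q p xi * (sin \o (fun xi => Hp p xi + c)) xi))) /\
   \int[mun]_xi ((wq p xi * (sin \o (fun xi => Hp p xi + c)) xi + q p xi * (cos (Hp p xi +
     c) * (k p xi + e p xi + 0)))
     + vdiv (v p) xi * (q p xi * (sin \o (fun xi => Hp p xi + c)) xi)) = 0.
  by apply: (vderive_ibp (L := L) wqs) => xi h; rewrite q0// mul0r.
have k1 xi : 1 + k p xi != 0 by rewrite -omE gt_eqF// exprn_gt0.
have fE : \int[mun]_xi (f p xi * cos (Hp p xi + c)) =
   \int[mun]_xi (f1 p xi * cos (Hp p xi + c)) - \int[mun]_xi (f2 p xi * cos (Hp p xi +
     (c - pi / 2))).
  pose g3 xi := (wq p xi * (sin \o (fun xi => Hp p xi + c)) xi + q p xi * (cos (Hp p xi +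
    c) * (k p xi + e p xi + 0)))
     + vdiv (v p) xi * (q p xi * (sin \o (fun xi => Hp p xi + c)) xi).
  pose g12 xi := f1 p xi * cos (Hp p xi + c) - f2 p xi * cos (Hp p xi + (c - pi / 2)).
  have i12 : mun.-integrable setT (EFin \o g12).
    by apply: eq_integrable (integrableB _ i1 i2) => // xi _ /=.
  rewrite -RintegralB// -[RHS]addr0 -I30 -RintegralD//.
  apply: eq_Rintegral => xi _; rewrite /f1 /f2 [Hp p xi + (c - _)]addrA cosBpihalf /=.
  have -> : f p xi = q p xi * (1 + k p xi) by rewrite /q /iq -mulrA mulVf// mulr1.
  ring.
have mM' m : measurable_fun setT (fun xi => (M p xi * (om p xi)^-1 ^+ m)%:E).
  by apply/measurable_EFinP; apply: measurable_funM => //; exact: measurable_funX.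
have ME : (\int[mun]_xi (M1 p xi * (om p xi)^-1 ^+ N)%:E = (K p)%:E * \int[mun]_xi (M p xi *
  (om p xi)^-1 ^+ N.+1)%:E)%E.
  rewrite -ge0_integralZl//.
  - by apply: eq_integral => xi _; rewrite -EFinM; congr EFin; rewrite /M1 exprS; ring.
  - by move=> xi _; rewrite lee_fin mulr_ge0// exprn_ge0// invr_ge0 ltW.
  - by rewrite lee_fin ltW.
have KN m : 0 <= K p ^+ m by rewrite exprn_ge0// ltW.
rewrite exprSr mulrA EFinM -muleA -ME mulrDl EFinD ge0_muleDl ?lee_fin ?mulr_ge0//.
apply: (@le_trans _ _ (`|\int[mun]_xi (f1 p xi * cos (Hp p xi + c))|%:E +
    `|\int[mun]_xi (f2 p xi * cos (Hp p xi + (c - pi / 2)))|%:E)%E).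
  by rewrite -EFinD lee_fin fE ler_normB.
by apply: leeD; [exact: h1|exact: h2].
Qed.

End oscillation.
End symbols.

(** * Truncated powers as amplitudes *)

Section positive_part_power.
Context {R : realType}.

(** The square of the positive part is the first truncated power that is
    differentiable at 0. *)
Lemma is_derive_pospart_sqr (s : R) :
  is_derive s (1 : R) (fun s => Num.max s 0 ^+ 2) (2 * Num.max s 0).
Proof.
have [s0|s0|->] := ltgtP s 0.
- rewrite mulr0; apply: (near_eq_is_derive _ (is_derive_cst (0 : R) s (1 : R))).
  near=> t; rewrite max_r ?expr0n//; near: t.
  by exists (- s) => /=; [rewrite oppr_gt0|move=> t /=; rewrite ltr_norml => /andP[h1 h2]; lra].
- apply: (@near_eq_is_derive _ _ _ (fun t : R => t ^+ 2)).
    near=> t; rewrite max_l//; near: t.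
    by exists s => //= t /=; rewrite ltr_norml => /andP[h1 h2]; lra.
  by apply: is_derive_eq; rewrite /GRing.scale /=; ring.
- rewrite mulr0; suff h : h^-1 *: ((fun s => Num.max s 0 ^+ 2 : R) (h *: 1 +
    0) - (fun s => Num.max s 0 ^+ 2) 0) @[h --> (0 : R)^'] --> (0 : R).
    by apply: DeriveDef; [apply/cvg_ex; exists 0|exact/cvg_lim].
  apply/cvgrPdist_le => e e0; near=> h.
  have h0 : h != 0 by near: h; exact: nbhs_dnbhs_neq.
  rewrite sub0r normrN /= /GRing.scale /= mulr1 addr0 maxxx expr0n subr0.
  have he : `|h| <= e.
    near: h; exists e => //= h /=; rewrite sub0r normrN => h1 _; exact: ltW.
  have [hp|hn] := leP h 0; first by rewrite expr0n mulr0 normr0 ltW.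
  by rewrite expr2 mulrA mulVf// mul1r.
Unshelve. all: end_near. Qed.

Lemma is_derive_pospart_exp (m : nat) (s : R) :
  is_derive s (1 : R) (fun s => Num.max s 0 ^+ m.+2) (m.+2%:R * Num.max s 0 ^+ m.+1).
Proof.
elim: m => [|m IHm]; first by rewrite expr1; exact: is_derive_pospart_sqr.
rewrite (_ : (fun _ => _) = (fun s => s * Num.max s 0 ^+ m.+2)); last first.
  apply/funext => t; rewrite exprS; have [h|h] := leP t 0; last by [].
  by rewrite exprS !mul0r mulr0.
apply: is_derive_eq; rewrite /GRing.scale /=.
have [h|h] := leP s 0; first by rewrite !exprS !(mul0r, mulr0, add0r).
rewrite -[m.+3%:R]natr1 !exprS; ring.
Qed.

End positive_part_power.

Section amplitude.
Context {R : realType} {n : nat} {P : Type}.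
Local Notation E := (euclid R n).
Local Notation mun := (@lebesgue_measuren R n).
Variables (v : P -> @vfield R n) (h k pk y : P -> E -> R).
Hypothesis k0 : forall p xi, 0 <= k p xi.
Let om p xi := Num.sqrt (1 + k p xi).

Hypothesis hA : forall p, vderive (v p) (@jbracket R n) (fun xi => y p xi * jbracket xi).
Hypothesis hh : forall p, vderive (v p) (h p) (k p).
Hypothesis hk : forall p, vderive (v p) (k p) (fun xi => pk p xi * k p xi).
Hypothesis sy : forall N, symbol v om N y (fun _ _ => 1).
Hypothesis spk : forall N, symbol v om N pk (fun _ _ => 1).
Hypothesis sdiv : forall N, symbol v om N (fun p => vdiv (v p)) (fun _ _ => 1).

Let om1 p xi : 1 <= om p xi.
Proof. by rewrite /om -[leLHS]sqrtr1 ler_wsqrtr// lerDl. Qed.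

Let omE p xi : om p xi ^+ 2 = 1 + k p xi.
Proof. by rewrite sqr_sqrtr// addr_ge0. Qed.

Let mom p : measurable_fun setT (om p).
Proof.
have ms : measurable_fun setT (@Num.sqrt R) by apply: continuous_measurable_fun => x;
  exact: sqrt_continuous.
apply: (measurableT_comp ms); apply: measurable_funD => //.
exact: vderive_meas (hk p).
Qed.

Let k1 p xi : 0 < 1 + k p xi. Proof. by rewrite ltr_pwDl. Qed.

Let iq01 p xi : 0 <= (1 + k p xi)^-1 <= 1.
Proof. by rewrite invr_ge0 (ltW (k1 _ _)) invf_le1 ?k1//= lerDl. Qed.

(** As k' = pk k, the derivative of (1 + k)^-1 is again (1 + k)^-1 times bounded
    factors, so the class reproduces itself. *)
Lemma symbol_gain N : symbol v om N (fun p xi => (1 + k p xi)^-1) (fun p xi => om p xi ^- 2).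
Proof.
have bd : exists C : R, 0 <= C /\ forall p xi, `|(1 + k p xi)^-1| <= C * om p xi ^- 2.
  by exists 1; split => // p xi; have /andP[h0 _] := iq01 p xi; rewrite mul1r omE ger0_norm.
have wg p : vderive (v p) (fun xi => (1 + k p xi)^-1)
    (fun xi => (-1 * pk p xi) * (1 + -1 * (1 + k p xi)^-1) * (1 + k p xi)^-1).
  have w1 := vderive_add (vderive_cst (v p) 1) (hk p).
  apply: vderive_eq (vderive_inv w1 _ _) _ => //.
    by move=> L; exists 1 => xi _; have /andP[h0 h1] := iq01 p xi; rewrite ger0_norm.
  by move=> xi; field; rewrite gt_eqF.
elim: N => [|N IHN]; first by split => // p; exact: vderive_meas (wg p).
apply: (symbol_step bd wg).
have s1 : symbol v om N (fun p xi => 1 + -1 * (1 + k p xi)^-1) (fun _ _ => 1).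
  apply: symbol_add; first exact: symbol_cst.
  apply: symbol_weak1 (symbol_mul om1 (symbol_cst v om1 N (-1)) IHN) => // p xi.
  by rewrite mul1r invf_le1 ?exprn_gt0 ?(lt_le_trans _ (om1 _ _))// exprn_ege1.
apply: symbol_weak1 (symbol_mul om1 (symbol_mul om1 (symbol_mul om1 (symbol_cst v om1 N (-1))
  (spk N)) s1) IHN) => // p xi.
by rewrite !mul1r ler_peMr// invr_ge0 exprn_ge0// (le_trans _ (om1 _ _)).
Qed.

Variables (beta : R) (beta0 : 0 <= beta).

Let powle (b : R) (xi : E) : 0 <= b -> `|jbracket xi `^ (- b)| <= 1.
Proof.
move=> b0; rewrite ger0_norm ?powR_ge0// -(powRr0 (jbracket xi)) ler_powR ?jbracket_ge1//.
by rewrite oppr_le0.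
Qed.

Lemma vderive_weight p : vderive (v p) (fun xi => jbracket xi `^ (- beta))
   (fun xi => (- beta) * y p xi * jbracket xi `^ (- beta)).
Proof.
have mA := @measurable_jbracket R n.
have w := @vderive_comp _ _ (v p) (fun a => a `^ (- beta)) (fun a => - beta *
  a `^ (- beta - 1)) _ _ (hA p).
apply: vderive_eq (w _ _ _ _ _) _.
- exact: (measurableT_comp (@measurable_powR R (- beta)) mA).
- apply: measurable_funM => //.
  exact: (measurableT_comp (@measurable_powR R (- beta - 1)) mA).
- by move=> L; exists 1 => xi _; exact: powle.
- apply: locally_boundedM; first exact: locally_bounded_cst.
  by move=> L; exists 1 => xi _; rewrite -opprD powle// addr_ge0.
- by move=> xi; apply: is_derive1_powR; exact: jbracket_gt0.
- move=> xi; have A0 := jbracket_gt0 xi.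
  have -> : jbracket xi `^ (- beta - 1) = jbracket xi `^ (- beta) / jbracket xi.
    by rewrite powRB ?powRr1 ?(ltW A0)// (gt_eqF A0) implybT.
  by field; rewrite gt_eqF.
Qed.

(** The logarithmic derivative of the weight is -beta y, with y bounded. *)
Lemma symbol_weight N : symbol v om N (fun _ xi => jbracket xi `^ (- beta)) (fun _ xi =>
  jbracket xi `^ (- beta)).
Proof.
have bd : exists C : R, 0 <= C /\ forall (p : P) xi, `|jbracket xi `^ (- beta)| <= C *
  (jbracket (xi : E) `^ (- beta)).
  by exists 1; split => // p xi; rewrite mul1r ger0_norm// powR_ge0.
elim: N => [|N IHN].
  split => // p; exact: vderive_meas (vderive_weight p).
apply: (symbol_step bd vderive_weight).
apply: symbol_weak1 (symbol_mul om1 (symbol_mul om1 (symbol_cst v om1 N (- beta)) (sy N)) IHN)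
  => // p xi.
by rewrite !mul1r ler_peMr// powR_ge0.
Qed.

Variables (dl : P -> R).
Hypothesis dl0 : forall p, 0 < dl p.
Let U p (xi : E) := 1 - dl p * (jbracket xi ^+ 2 - 1).
Let y' p xi := dl p * jbracket xi ^+ 2 * y p xi.
Let indU p xi : R := if 0 < U p xi then 1 else 0.
(** The bound on y' is used on the support of the cutoff; elsewhere, where indU
    vanishes, bigU leaves room for the trivial one. *)
Let bigU p xi : R := if 0 < U p xi then 1 else 1 + dl p * jbracket xi ^+ 2.
Hypothesis sy' : forall N, symbol v om N y' (fun p xi => om p xi * bigU p xi).

Lemma vderive_cutoff p : vderive (v p) (U p) (fun xi => -2 * y' p xi).
Proof.
have w := vderive_exp 2 (hA p).
rewrite (_ : U p = (fun xi => 1 + -1 * (dl p * (jbracket xi ^+ 2 + -1)))); last first.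
  by apply/funext => xi; rewrite /U; ring.
apply: vderive_eq (vderive_add (vderive_cst _ 1) (vderive_scale (-1) (vderive_scale (dl p)
  (vderive_add w (vderive_cst _ (-1)))))) _.
by move=> xi; rewrite /y'; ring.
Qed.

Let Ule1 p xi : U p xi <= 1.
Proof.
by rewrite /U lerBlDr lerDl mulr_ge0 ?(ltW (dl0 _))// subr_ge0 exprn_ege1// jbracket_ge1.
Qed.

Let posle p xi m : `|Num.max (U p xi) 0 ^+ m.+1| <= indU p xi.
Proof.
rewrite /indU; case: (ltP 0 (U p xi)) => [u0|u0].
  by rewrite ger0_norm ?exprn_ge0 ?(ltW u0)// exprn_ile1 ?(ltW u0).
by rewrite expr0n normr0.
Qed.

Let mpos p m : measurable_fun setT (fun xi => Num.max (U p xi) 0 ^+ m).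
Proof.
apply: measurable_funX; apply: measurable_maxr => //.
exact: vderive_meas (vderive_cutoff p).
Qed.

Lemma vderive_cutoff_exp p m : vderive (v p) (fun xi => Num.max (U p xi) 0 ^+ m.+2)
  (fun xi => (-2 * m.+2%:R) * Num.max (U p xi) 0 ^+ m.+1 * y' p xi).
Proof.
apply: vderive_eq (@vderive_comp _ _ (v p) (fun s => Num.max s 0 ^+ m.+2) (fun s => m.+2%:R *
  Num.max s 0 ^+ m.+1)
  _ _ (vderive_cutoff p) _ _ _ _ _) _.
- exact: mpos.
- by apply: measurable_funM => //; exact: mpos.
- by move=> L; exists 1 => xi _; rewrite (le_trans (posle p xi m.+1))// /indU; case: ifP.
- apply: locally_boundedM; first exact: locally_bounded_cst.
  by move=> L; exists 1 => xi _; rewrite (le_trans (posle p xi m))// /indU; case: ifP.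
- by move=> xi; exact: is_derive_pospart_exp.
- by move=> xi /=; ring.
Qed.

(** Each derivative lowers the exponent of the truncated power by one and brings out
    a factor y', which costs one om on the support.  The exponent therefore has to
    exceed the number of derivatives. *)
Lemma symbol_cutoff N m : (N <= m)%N ->
  symbol v om N (fun p xi => Num.max (U p xi) 0 ^+ m.+1) indU.
Proof.
have bd m' : exists C : R, 0 <= C /\ forall p xi, `|Num.max (U p xi) 0 ^+ m'.+1| <= C * indU p xi.
  by exists 1; split => // p xi; rewrite mul1r.
elim: N m => [|N IHN] m Nm; first by split => // p; exact: mpos.
case: m Nm => // m Nm.
apply: (symbol_step (bd _) (fun p => vderive_cutoff_exp p m)).
apply: symbol_weak1 (symbol_mul om1 (symbol_mul om1 (symbol_cst v om1 N (-2 *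
  m.+2%:R)) (IHN m Nm)) (sy' N)) => // p xi.
by rewrite /indU /bigU; case: ifP; rewrite !(mul1r, mulr1, mul0r).
Qed.

Let M p (xi : E) := jbracket xi `^ (- beta) * indU p xi.

Let M_ge0 p xi : 0 <= M p xi.
Proof. by rewrite /M mulr_ge0 ?powR_ge0// /indU; case: ifP. Qed.

Let indU0 p xi : 1 + (dl p)^-1 < jbracket xi -> indU p xi = 0.
Proof.
move=> hL; rewrite /indU ifF//; apply/negbTE; rewrite -leNgt /U subr_le0.
have d0 := dl0 p; have A1 := jbracket_ge1 xi.
have : (dl p)^-1 <= jbracket xi ^+ 2 - 1.
  have : 0 < (dl p)^-1 by rewrite invr_gt0.
  nra.
by rewrite -(ler_pM2l d0) mulfV ?gt_eqF.
Qed.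

Let mind p : measurable_fun setT (indU p).
Proof.
apply: measurable_fun_if => //.
by apply: measurable_fun_ltr => //; exact: vderive_meas (vderive_cutoff p).
Qed.

(** The instance of oscillatory_bound that is common to the two regions: h is the
    phase, k its derivative, and the logarithmic term contributes the error -2 kap y.
    The fields enter only through the relations assumed in this section. *)
Lemma amplitude_bound N (kap : P -> R) :
  exists C, 0 <= C /\ forall p c,
    (`|\int[mun]_xi (jbracket xi `^ (- beta) * Num.max (1 - dl p * (jbracket xi ^+ 2 - 1)) 0 ^+ N.+1
          * cos (h p xi - kap p * (2 * ln (jbracket xi)) + c))|%:E <=
     (C * (1 + `|kap p|) ^+ N)%:E * \int[mun]_xi (jbracket xi `^ (- beta) * (Num.sqrt (1 +
       k p xi))^-1 ^+ N)%:E)%E.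
Proof.
have mA := @measurable_jbracket R n.
have wln p : vderive (v p) (fun xi => ln (jbracket xi)) (y p).
  apply: vderive_eq (@vderive_comp _ _ (v p) (@ln R) (fun a => a^-1) _ _ (hA p) _ _ _ _ _) _.
  - exact: (measurableT_comp (@measurable_ln R) mA).
  - exact: measurable_jbracketV.
  - move=> L; exists (ln L) => xi hL; rewrite /= ger0_norm ?ln_ge0 ?jbracket_ge1//.
    by rewrite ler_ln// ?posrE ?jbracket_gt0// (lt_le_trans _ hL)// jbracket_gt0.
  - exact: locally_bounded_jbracketV.
  - by move=> xi; apply: is_derive1_ln; exact: jbracket_gt0.
  - by move=> xi /=; rewrite mulrCA mulVf ?mulr1// gt_eqF// jbracket_gt0.
pose e p xi := - (2 * kap p) * y p xi.
pose Hp p xi := h p xi - kap p * (2 * ln (jbracket xi)).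
have hH p : vderive (v p) (Hp p) (fun xi => k p xi + e p xi).
  rewrite (_ : Hp p = (fun xi => h p xi + - (2 * kap p) * ln (jbracket xi))); last first.
    by apply/funext => xi; rewrite /Hp; ring.
  exact: vderive_add (hh p) (vderive_scale _ (wln p)).
pose K p := 1 + `|kap p|.
have K1 p : 1 <= K p by rewrite /K lerDl.
have he m : symbol v om m e (fun p _ => K p).
  apply: (symbol_weak om1 _ (symbol_mul om1 (symbol_par v om1 m (fun p => - (2 * kap p))) (sy m))).
  exists 2; split => // p xi; rewrite mulr1 normrN normrM ger0_norm// /K mulrDr.
  by rewrite lerDr.
have sf : symbol v om N (fun p xi => jbracket xi `^ (- beta) * Num.max (U p xi) 0 ^+ N.+1) M.
  exact: symbol_mul (symbol_weight N) (symbol_cutoff (leqnn N)).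
have M0 p : exists L, forall xi, L < jbracket xi -> M p xi = 0.
  by exists (1 + (dl p)^-1) => xi hL; rewrite /M indU0 ?mulr0.
have mw : measurable_fun setT (fun xi : E => jbracket xi `^ (- beta)).
  exact: (measurableT_comp (@measurable_powR R (- beta)) mA).
have mM p : measurable_fun setT (M p) by exact: measurable_funM.
have bM p : locally_bounded (M p).
  move=> L; exists 1 => xi _; rewrite /M normrM -[leRHS]mulr1 ler_pM ?powle//.
  by rewrite /indU; case: ifP; rewrite ?normr1 ?normr0.
have [C [C0 hC]] := oscillatory_bound om1 K1 omE hH he sdiv symbol_gain sf M_ge0 M0 mM bM mom.
exists C; split => // p c; apply: le_trans (hC p c) _.
have moV : measurable_fun setT (fun xi => (om p xi)^-1).
  by apply: measurable_inv_pos => // xi; exact: lt_le_trans (om1 _ _).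
have oV xi : 0 <= (om p xi)^-1 by rewrite invr_ge0 (le_trans _ (om1 _ _)).
apply: lee_wpmul2l; first by rewrite lee_fin mulr_ge0// exprn_ge0// (le_trans _ (K1 p)).
apply: ge0_le_integral => //.
- by move=> xi _; rewrite lee_fin mulr_ge0// exprn_ge0.
- by apply/measurable_EFinP; apply: measurable_funM => //; exact: measurable_funX.
- by apply/measurable_EFinP; apply: measurable_funM => //; exact: measurable_funX.
- move=> xi _; rewrite lee_fin ler_wpM2r ?exprn_ge0// /M ler_piMr ?powR_ge0//.
  by rewrite /indU; case: ifP.
Qed.

End amplitude.

(** * The spacelike region *)

Section pair.
Context {R : realType} {n : nat} {P : Type}.
Local Notation E := (euclid R n).
Variables (v : P -> @vfield R n) (om : P -> E -> R).
Hypothesis om1 : forall p xi, 1 <= om p xi.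

(** Two functions whose derivatives are combinations of each other.  The second is
    allowed to be larger by a factor om, which is exactly what one derivative of the
    first may cost; so the pair is closed under differentiation although neither
    function is. *)
Lemma symbol_pair (f g a1 a2 b1 b2 M : P -> E -> R) :
  (forall p xi, 0 <= M p xi) ->
  (exists C, 0 <= C /\ forall p xi, `|f p xi| <= C * (om p xi * M p xi)) ->
  (exists C, 0 <= C /\ forall p xi, `|g p xi| <= C * (om p xi ^+ 2 * M p xi)) ->
  (forall p, vderive (v p) (f p) (fun xi => a1 p xi * f p xi + a2 p xi * g p xi)) ->
  (forall p, vderive (v p) (g p) (fun xi => b1 p xi * f p xi + b2 p xi * g p xi)) ->
  (forall N, symbol v om N a1 (fun _ _ => 1)) -> (forall N, symbol v om N a2 (fun _ _ => 1)) ->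
  (forall N, symbol v om N b1 (fun _ _ => 1)) -> (forall N, symbol v om N b2 (fun _ _ => 1)) ->
  forall N, symbol v om N f (fun p xi => om p xi * M p xi) /\
            symbol v om N g (fun p xi => om p xi ^+ 2 * M p xi).
Proof.
move=> M0 bf bg wf wg sa1 sa2 sb1 sb2; elim => [|N [IHf IHg]].
  by split; split => // p; [exact: vderive_meas (wf p)|exact: vderive_meas (wg p)].
have om0 p xi : 0 <= om p xi by exact: le_trans (om1 _ _).
have h1 p xi : om p xi * M p xi <= om p xi ^+ 2 * M p xi.
  by rewrite ler_wpM2r// expr2 ler_peMl.
have h2 p xi : om p xi ^+ 2 * M p xi <= om p xi ^+ 2 * M p xi * om p xi.
  by rewrite ler_peMr// mulr_ge0// exprn_ge0.
split.
  apply: (symbol_step bf wf); apply: symbol_add.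
    by apply: symbol_weak1 (symbol_mul om1 (sa1 N) IHf) => // p xi;
      rewrite mul1r ler_peMr// mulr_ge0.
  by apply: symbol_weak1 (symbol_mul om1 (sa2 N) IHg) => // p xi;
    rewrite mul1r [leRHS]mulrAC -expr2.
apply: (symbol_step bg wg); apply: symbol_add.
  apply: symbol_weak1 (symbol_mul om1 (sb1 N) IHf) => // p xi; rewrite mul1r.
  exact: le_trans (h1 p xi) (h2 p xi).
by apply: symbol_weak1 (symbol_mul om1 (sb2 N) IHg) => // p xi; rewrite mul1r.
Qed.

End pair.

Section parameters.
Context {R : realType} {n : nat}.
Local Notation E := (euclid R n).

(** The condition on par_dl excludes the range par_dl > max(1, par_t), in which the
    cutoff varies too fast to be differentiated and its support is small enough
    for a trivial estimate. *)
Record params := Params {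
  par_x : E ; par_t : R ; par_dl : R ; par_kap : R ;
  par_t0 : 0 < par_t ; par_dl0 : 0 < par_dl ; par_dl1 : par_dl <= 1 \/ par_dl <= par_t }.

Lemma jbracket_dotr_sq (x xi : E) : dotr x xi ^+ 2 <= dotr x x * (jbracket xi ^+ 2 - 1).
Proof. by rewrite jbracket_sqr addrC addKr dotr_CS. Qed.

End parameters.

Section spacelike.
Context {R : realType} {n : nat}.
Local Notation E := (euclid R n).
Local Notation mun := (@lebesgue_measuren R n).

Definition spacelike := {p : @params R n | par_t p ^+ 2 <= dotr (par_x p) (par_x p)}.
Implicit Types p : spacelike.

Let x p := par_x (sval p).
Let t p := par_t (sval p).
Let dl p := par_dl (sval p).
Let X p := enorm (x p).

Let t0 p : 0 < t p. Proof. exact: par_t0. Qed.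
Let Xsq p : X p ^+ 2 = dotr (x p) (x p). Proof. exact: enorm_sqr. Qed.
Let tX p : t p <= X p.
Proof.
rewrite -ler_sqr ?nnegrE ?sqrtr_ge0 ?(ltW (t0 p))// Xsq; exact: (svalP p).
Qed.
Let X0 p : 0 < X p. Proof. exact: lt_le_trans (t0 p) (tX p). Qed.

Let A (xi : E) := jbracket xi.
Let l p xi := dotr (x p) xi.

Let lsq p xi : l p xi ^+ 2 <= X p ^+ 2 * (A xi ^+ 2 - 1).
Proof. by rewrite Xsq; exact: jbracket_dotr_sq. Qed.

Let A1 xi : 1 <= A xi. Proof. exact: jbracket_ge1. Qed.
Let A0 xi : 0 < A xi. Proof. exact: jbracket_gt0. Qed.

Let labs p xi : `|l p xi| < X p * A xi.
Proof.
rewrite -ltr_sqr ?nnegrE ?mulr_ge0 ?(ltW (X0 p)) ?(ltW (A0 xi))//.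
rewrite real_normK ?num_real// (le_lt_trans (lsq p xi))// exprMn ltr_pM2l ?exprn_gt0//.
by rewrite ltrBlDr ltrDl.
Qed.

Let da_a p : derivative_along (trans (x p)) (fun xi => (X p)^-1 * A xi)
  (fun xi => (X p)^-1 * (l p xi * (A xi)^-1)).
Proof.
apply: da_eq (da_mul (trans_flow _) (da_cst _ (X p)^-1) (da_jbracket_trans (x p))) _ => xi.
by rewrite mul0r add0r.
Qed.

(** The generator A D_x of the Lorentz boost in the direction of x, divided by X. *)
Let v p : @vfield R n := VField (da_a p) (da_cst dil 0).

(** The logarithmic derivatives of A and of g along v are y and z. *)
Let y p xi := l p xi * (X p * A xi)^-1.
Let h p xi := t p * A xi + l p xi.
Let g p xi := X p * A xi + t p * (X p)^-1 * l p xi.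
Let z p xi := h p xi * (g p xi)^-1.

Let wA p : vderive (v p) A (fun xi => y p xi * A xi).
Proof.
exists (fun xi => l p xi * (A xi)^-1), (fun xi => A xi + -1 * (A xi)^-1); split.
- exact: da_jbracket_trans.
- exact: da_jbracket_dil.
- by move=> xi /=; rewrite /y; field; rewrite !gt_eqF.
Qed.

Let wl p : vderive (v p) (l p) (fun xi => X p * A xi).
Proof.
exists (fun=> dotr (x p) (x p)), (l p); split.
- exact: da_dotr_trans.
- exact: da_dotr_dil.
- by move=> xi /=; rewrite -Xsq; field; rewrite !gt_eqF.
Qed.

Let wh p : vderive (v p) (h p) (g p).
Proof.
apply: vderive_eq (vderive_add (vderive_scale (t p) (wA p)) (wl p)) _ => xi.
by rewrite /g /y; field; rewrite !gt_eqF.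
Qed.

Let wg' p : vderive (v p) (g p) (h p).
Proof.
apply: vderive_eq (vderive_add (vderive_scale (X p) (wA p)) (vderive_scale (t p *
  (X p)^-1) (wl p))) _ => xi.
by rewrite /h /y; field; rewrite !gt_eqF.
Qed.

Let r2_ge0 xi : 0 <= A xi ^+ 2 - 1.
Proof. by rewrite subr_ge0 exprn_ege1. Qed.

(** As t x / X has length t, g is at least t (A - |xi|) = t / (A + |xi|). *)
Let g_lb p xi : t p <= 2 * A xi * g p xi.
Proof.
have a1 := A1 xi; have a0 := A0 xi; have tt := t0 p; have XX := X0 p; have tx := tX p.
have lX : `|l p xi| <= X p * Num.sqrt (A xi ^+ 2 - 1).
  rewrite -ler_sqr ?nnegrE ?mulr_ge0 ?sqrtr_ge0 ?(ltW XX)//.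
  by rewrite real_normK ?num_real// exprMn (sqr_sqrtr (r2_ge0 xi)); exact: lsq.
set r := Num.sqrt _ in lX.
have r0 : 0 <= r by exact: sqrtr_ge0.
have rr : r ^+ 2 = A xi ^+ 2 - 1 by exact: (sqr_sqrtr (r2_ge0 xi)).
have : g p xi >= t p * (A xi - r).
  have h1 : t p * (X p)^-1 * l p xi >= - (t p * r).
    have : `|t p * (X p)^-1 * l p xi| <= t p * r.
      rewrite normrM ger0_norm ?mulr_ge0 ?invr_ge0 ?(ltW tt) ?(ltW XX)// -mulrA ler_pM2l//.
      by rewrite mulrC ler_pdivrMr// mulrC.
    by rewrite ler_norml => /andP[].
  rewrite /g; have : t p * A xi <= X p * A xi by rewrite ler_wpM2r ?(ltW a0).
  lra.
have rA : r <= A xi by rewrite -ler_sqr ?nnegrE ?(ltW a0)// rr lerBlDr lerDl.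
move=> hg.
have : (A xi + r) * (A xi - r) = 1 by rewrite mulrC -subr_sqr rr; ring.
have : 0 <= A xi - r by rewrite subr_ge0.
move=> h1 h2.
have h3 : 1 <= 2 * A xi * (A xi - r) by rewrite -[leLHS]h2 ler_wpM2r//; lra.
have : t p * 1 <= t p * (2 * A xi * (A xi - r)) by rewrite ler_pM2l.
have : 2 * A xi * (t p * (A xi - r)) <= 2 * A xi * g p xi by rewrite ler_pM2l// mulr_gt0.
lra.
Qed.

Let g0 p xi : 0 < g p xi.
Proof.
have := g_lb p xi; have := t0 p; have := A0 xi => a0 tt hg.
have : 0 < 2 * A xi * g p xi by exact: lt_le_trans tt hg.
by rewrite pmulr_rgt0// mulr_gt0.
Qed.

Let om p xi := Num.sqrt (1 + g p xi).
Let om1 p xi : 1 <= om p xi.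
Proof. by rewrite /om -[leLHS]sqrtr1 ler_wsqrtr// lerDl ltW. Qed.
Let omE p xi : om p xi ^+ 2 = 1 + g p xi.
Proof. by rewrite sqr_sqrtr// addr_ge0 ?(ltW (g0 _ _)). Qed.

Let y_le1 p xi : `|y p xi| <= 1.
Proof.
have XA : 0 < X p * A xi by rewrite mulr_gt0.
by rewrite /y normrM normfV (ger0_norm (ltW XA)) ler_pdivrMr// mul1r ltW.
Qed.

(** g^2 - h^2 = (X^2 - t^2) (A^2 - (l / X)^2) is nonnegative: h and g are a pair of
    hyperbolic functions along the boost. *)
Let z_le1 p xi : `|z p xi| <= 1.
Proof.
have gg := g0 p xi.
rewrite /z normrM normfV (ger0_norm (ltW gg)) ler_pdivrMr// mul1r.
rewrite -ler_sqr ?nnegrE ?(ltW gg)// real_normK ?num_real// -subr_ge0.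
have XX := X0 p; have h1 := lsq p xi; have h2 := t0 p; have h3 := tX p.
have -> : g p xi ^+ 2 - h p xi ^+ 2 = (X p ^+ 2 - t p ^+ 2) * (A xi ^+ 2 - (l p xi / X p) ^+ 2).
  by rewrite /g /h; field; rewrite gt_eqF.
rewrite mulr_ge0// subr_ge0.
  by rewrite ler_sqr ?nnegrE// ltW.
rewrite expr_div_n ler_pdivrMr ?exprn_gt0//.
by rewrite (le_trans h1)// mulrBr mulr1 mulrC gerBl exprn_ge0// ltW.
Qed.

Let wgV p : vderive (v p) (fun xi => (g p xi)^-1) (fun xi => - (g p xi)^-1 ^+ 2 * h p xi).
Proof.
apply: vderive_inv => // L.
exists (2 * L / t p) => xi hL; have gg := g0 p xi; have tt := t0 p.
rewrite ger0_norm ?invr_ge0 ?(ltW gg)// ler_pdivlMr// mulrC ler_pdivrMr//.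
by rewrite (le_trans (g_lb p xi))// ler_pM2r// ler_pM2l.
Qed.

Let wz p : vderive (v p) (z p) (fun xi => 1 + -1 * (z p xi * z p xi)).
Proof.
apply: vderive_eq (vderive_mul (wh p) (wgV p)) _ => xi.
by rewrite /z; field; rewrite gt_eqF.
Qed.

Let wy p : vderive (v p) (y p) (fun xi => 1 + -1 * (y p xi * y p xi)).
Proof.
have w1 := vderive_inv (vderive_scale (X p) (wA p)) (fun xi => mulr_gt0 (X0 p) (A0 xi)).
apply: vderive_eq (vderive_mul (wl p) (w1 _)) _.
  move=> L; exists ((X p)^-1) => xi _;
    rewrite ger0_norm ?invr_ge0 ?mulr_ge0 ?(ltW (X0 p)) ?(ltW (A0 xi))//.
  by rewrite lef_pV2 ?posrE ?mulr_gt0// ler_peMr// ltW.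
by move=> xi; rewrite /y; field; rewrite !gt_eqF.
Qed.

(** A bounded solution of the Riccati equation f' = 1 - f^2 is a symbol of size 1, as
    its derivatives are polynomials in f. *)
Let symbol_riccati (f : spacelike -> E -> R) :
  (forall p xi, `|f p xi| <= 1) ->
  (forall p, vderive (v p) (f p) (fun xi => 1 + -1 * (f p xi * f p xi))) ->
  forall N, symbol v om N f (fun _ _ => 1).
Proof.
move=> f1 wf.
have bd : exists C : R, 0 <= C /\ forall p xi, `|f p xi| <= C * 1.
  by exists 1; split => // p xi; rewrite mulr1.
elim => [|N IHN]; first by split => // p; exact: vderive_meas (wf p).
apply: (symbol_step bd wf).
apply: (@symbol_weak1 _ _ _ v om om1 _ _ (fun _ _ => 1)); first by move=> p xi; rewrite mul1r.
apply: symbol_add; first exact: symbol_cst.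
by apply: symbol_weak1 (symbol_mul om1 (symbol_cst v om1 N (-1)) (symbol_mul om1 IHN IHN)) =>
  // p xi; rewrite !mul1r.
Qed.

Let sy := symbol_riccati y_le1 wy.
Let sz := symbol_riccati z_le1 wz.

Let sdiv N : symbol v om N (fun p => vdiv (v p)) (fun _ _ => 1).
Proof.
apply: symbol_eq (sy N) => p xi; rewrite /vdiv /= /y.
by field; rewrite !gt_eqF.
Qed.

Let wk p : vderive (v p) (g p) (fun xi => z p xi * g p xi).
Proof.
by apply: vderive_eq (wg' p) _ => xi; rewrite /z -mulrA mulVf ?mulr1// gt_eqF.
Qed.

Let U p (xi : E) := 1 - dl p * (A xi ^+ 2 - 1).
(** Off the support of the cutoff this leaves room for the trivial bound on D. *)
Let bigU p xi : R := if 0 < U p xi then 1 else 1 + dl p * A xi ^+ 2.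
Let dl0 p : 0 < dl p. Proof. exact: par_dl0. Qed.
Let D p xi := dl p * A xi ^+ 2.
Let y' p xi := dl p * A xi ^+ 2 * y p xi.

Let D_ge0 p xi : 0 <= D p xi.
Proof. by rewrite mulr_ge0 ?exprn_ge0 ?(ltW (dl0 _)) ?(ltW (A0 _)). Qed.

Let bigU_ge0 p xi : 0 <= bigU p xi.
Proof. by rewrite /bigU; case: ifP => // _; rewrite addr_ge0//; exact: D_ge0. Qed.

(** On the support of the cutoff, dl |xi|^2 < 1.  If dl <= 1 this bounds D.  If dl > 1,
    then |xi| < 1, and dl <= t makes D at most a multiple of t, hence of g. *)
Let D_small p xi : 0 < U p xi -> D p xi <= 2 \/ (D p xi <= 8 * g p xi /\ D p xi *
  (A xi ^+ 2 - 1) <= 2).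
Proof.
rewrite /U subr_gt0 => hU; have d0 := dl0 p; have := par_dl1 (sval p);
  rewrite -/(dl p) -/(t p) => -[d1|dt].
  by left; rewrite /D; lra.
have [d1|d1] := leP (dl p) 1; first by left; rewrite /D; lra.
right; have hr := r2_ge0 xi.
have rle : A xi ^+ 2 - 1 <= 1.
  have : (A xi ^+ 2 - 1) * 1 <= (A xi ^+ 2 - 1) * dl p by rewrite ler_wpM2l// ltW.
  lra.
have a2 : A xi ^+ 2 <= 2 by lra.
split; last first.
  have : (dl p * (A xi ^+ 2 - 1)) * A xi ^+ 2 <= 1 * A xi ^+ 2.
    by rewrite ler_wpM2r ?exprn_ge0 ?(ltW (A0 _))// ltW.
  rewrite /D; lra.
have a3 : A xi <= 2.
  by rewrite -ler_sqr ?nnegrE ?(ltW (A0 _))//; lra.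
have := g_lb p xi; have gg := g0 p xi => hg.
have h1 : 2 * A xi * g p xi <= 4 * g p xi by rewrite ler_pM2r//; lra.
have h2 : D p xi <= dl p * 2 by rewrite /D ler_pM2l.
lra.
Qed.

Let bd_D : exists C, 0 <= C /\ forall p xi, `|D p xi| <= C * (om p xi ^+ 2 * bigU p xi).
Proof.
exists 8; split => // p xi; rewrite ger0_norm// omE.
have gg := g0 p xi; have hD := D_ge0 p xi.
rewrite /bigU; case: ifPn => [/D_small[h1|[h1 _]]|_].
- by rewrite mulr1; lra.
- by rewrite mulr1; lra.
- rewrite -/(D p xi); have : 0 <= g p xi * D p xi by rewrite mulr_ge0// ltW.
  lra.
Qed.

(** Where D is large, xi is small, and y vanishes to first order at xi = 0: thus
    D y is of order sqrt D, hence of order om. *)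
Let bd_y' : exists C, 0 <= C /\ forall p xi, `|y' p xi| <= C * (om p xi * bigU p xi).
Proof.
exists 4; split => // p xi; rewrite /y' -/(D p xi) normrM ger0_norm//.
have gg := g0 p xi; have hD := D_ge0 p xi; have o1 := om1 p xi; have y1 := y_le1 p xi.
have oE := omE p xi.
rewrite /bigU; case: ifPn => [/D_small[h1|[h1 h2]]|_].
- rewrite mulr1; have : D p xi * `|y p xi| <= 2 * 1 by rewrite ler_pM.
  lra.
- have o0 : 0 <= 4 * om p xi by rewrite mulr_ge0// (le_trans _ o1).
  have Dy0 : 0 <= D p xi * `|y p xi| by rewrite mulr_ge0.
  rewrite mulr1 -ler_sqr ?nnegrE// exprMn real_normK ?num_real//.
  have hy : y p xi ^+ 2 * A xi ^+ 2 <= A xi ^+ 2 - 1.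
    rewrite /y expr_div_n exprMn.
    have -> : l p xi ^+ 2 / (X p ^+ 2 * A xi ^+ 2) * A xi ^+ 2 = l p xi ^+ 2 / X p ^+ 2.
      by field; rewrite !gt_eqF.
    by rewrite ler_pdivrMr ?exprn_gt0// mulrC lsq.
  have hy2 : y p xi ^+ 2 <= A xi ^+ 2 - 1.
    apply: le_trans hy; rewrite ler_peMr ?sqr_ge0// exprn_ege1//.
  have : D p xi ^+ 2 * y p xi ^+ 2 <= D p xi ^+ 2 * (A xi ^+ 2 - 1) by rewrite ler_wpM2l// sqr_ge0.
  have : D p xi * (D p xi * (A xi ^+ 2 - 1)) <= D p xi * 2 by rewrite ler_wpM2l.
  have -> : (4 * om p xi) ^+ 2 = 16 * (1 + g p xi) by rewrite exprMn oE; ring.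
  rewrite expr2; lra.
- rewrite -/(D p xi).
  have : D p xi * `|y p xi| <= D p xi * 1 by rewrite ler_wpM2l.
  have : 1 * D p xi <= om p xi * D p xi by rewrite ler_wpM2r.
  have : 0 <= om p xi by exact: le_trans o1.
  lra.
Qed.

Let wD p : vderive (v p) (D p) (fun xi => 2 * y' p xi + 0 * D p xi).
Proof.
apply: vderive_eq (vderive_scale (dl p) (vderive_exp 2 (wA p))) _ => xi; rewrite /y' /=; ring.
Qed.

Let wy' p : vderive (v p) (y' p) (fun xi => y p xi * y' p xi + 1 * D p xi).
Proof.
apply: vderive_eq (vderive_mul (wD p) (wy p)) _ => xi; rewrite /D /y' /=; ring.
Qed.

Let osc_bound (beta : R) (beta0 : 0 <= beta) N :
  exists C, 0 <= C /\ forall p c,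
    (`|\int[mun]_xi (jbracket xi `^ (- beta) * Num.max (1 - dl p * (jbracket xi ^+ 2 - 1)) 0 ^+ N.+1
          * cos (h p xi - par_kap (sval p) * (2 * ln (jbracket xi)) + c))|%:E <=
     (C * (1 + `|par_kap (sval p)|) ^+ N)%:E *
       \int[mun]_xi (jbracket xi `^ (- beta) * (Num.sqrt (1 + g p xi))^-1 ^+ N)%:E)%E.
Proof.
have sp := symbol_pair om1 bigU_ge0 bd_y' bd_D wy' wD sy (fun N => symbol_cst v om1 N 1)
  (fun N => symbol_cst v om1 N 2) (fun N => symbol_cst v om1 N 0).
exact: (amplitude_bound (fun p xi => ltW (g0 p xi)) wA wh wk sy sz sdiv beta0 dl0 (fun N => (sp
  N).1)).
Qed.

Local Notation beta := (n%:R / 2 + 1 : R).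

(** After the integrations by parts the weight is integrated against a power of
    1 + g.  As g is the phase with time X and space point t x / X, decay_integral
    applies to it and gives X^(-n/2), which is at most t^(-n/2). *)
Lemma spacelike_bound : exists C, 0 <= C /\ forall p c,
  `|\int[mun]_xi (jbracket xi `^ (- beta) *
      Num.max (1 - par_dl (sval p) * (jbracket xi ^+ 2 - 1)) 0 ^+ (2 * n.+1).+1 *
      cos (par_t (sval p) * jbracket xi + dotr (par_x (sval p)) xi
           - par_kap (sval p) * (2 * ln (jbracket xi)) + c))| <=
  C * (1 + `|par_kap (sval p)|) ^+ (2 * n.+1) * par_t (sval p) `^ (- (n%:R / 2)).
Proof.
have n2 : 0 <= n%:R / 2 :> R by rewrite divr_ge0.
have b0 : 0 <= beta by rewrite addr_ge0.
have [C [C0 hC]] := osc_bound b0 (2 * n.+1).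
have [C' [C'0 hC']] := @decay_integral R n.
exists (C * C'); rewrite mulr_ge0//; split => // p c.
rewrite -lee_fin; apply: (le_trans (hC p c)).
have XX := X0 p; have tt := t0 p.
have E1 xi : dotr (vscale (t p / X p) (x p)) xi = t p * (X p)^-1 * l p xi.
  by rewrite dotrC dotr_vscale dotrC.
have := hC' (vscale (t p / X p) (x p)) (X p) 0 XX.
have -> : dotr (vscale (t p / X p) (x p)) (vscale (t p / X p) (x p)) = t p ^+ 2.
  by rewrite dotr_vscale dotrC dotr_vscale -Xsq; field; rewrite gt_eqF.
move=> /(_ _ (lexx 0) (sqrtr_ge0 _) _) dec.
have K0 : (0 <= (C * (1 + `|par_kap (sval p)|) ^+ (2 * n.+1))%:E)%E.
  by rewrite lee_fin mulr_ge0// exprn_ge0// addr_ge0.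
rewrite (_ : C * C' * _ * _ = C * (1 + `|par_kap (sval p)|) ^+ (2 * n.+1) * (C' *
  t p `^ (- (n%:R / 2)))); last by rewrite /t; ring.
rewrite [leRHS]EFinM; apply: lee_wpmul2l => //.
have tX2 : t p ^+ 2 <= X p ^+ 2 by rewrite ler_sqr ?nnegrE ?(ltW tt) ?(ltW XX).
apply: (@le_trans _ _ (C' * X p `^ (- (n%:R / 2)))%:E).
  have hk xi : 0 <= X p * jbracket xi + dotr (vscale (t p / X p) (x p)) xi - 0.
    by rewrite E1 subr0; exact: ltW (g0 p xi).
  apply: le_trans (dec tX2 hk).
  rewrite le_eqVlt; apply/orP; left; apply/eqP; apply: eq_integral => xi _; congr ((_ * _)%:E).
  rewrite E1 subr0 -/(A xi) -/(g p xi) exprM; congr (_ ^+ _).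
  by rewrite exprVn -/(om p xi) omE.
rewrite lee_fin ler_wpM2l// !powRN lef_pV2 ?posrE ?powR_gt0//.
by rewrite ge0_ler_powR ?nnegrE ?(ltW tt) ?(ltW XX).
Qed.

End spacelike.

(** * The timelike region *)

Section timelike.
Context {R : realType} {n : nat}.
Local Notation E := (euclid R n).
Local Notation mun := (@lebesgue_measuren R n).

Definition timelike := {p : @params R n | dotr (par_x p) (par_x p) < par_t p ^+ 2}.
Implicit Types p : timelike.

Let x p := par_x (sval p).
Let t p := par_t (sval p).
Let dl p := par_dl (sval p).
Let s p := Num.sqrt (t p ^+ 2 - dotr (x p) (x p)).

Let t0 p : 0 < t p. Proof. exact: par_t0. Qed.
Let s0 p : 0 < s p.
Proof. by rewrite sqrtr_gt0 subr_gt0; exact: (svalP p). Qed.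
Let Xsq p : dotr (x p) (x p) = t p ^+ 2 - s p ^+ 2.
Proof. by rewrite sqr_sqrtr; [ring|rewrite subr_ge0 ltW//; exact: (svalP p)]. Qed.

Let A (xi : E) := jbracket xi.
Let l p xi := dotr (x p) xi.

Let lsq p xi : l p xi ^+ 2 <= (t p ^+ 2 - s p ^+ 2) * (A xi ^+ 2 - 1).
Proof. by rewrite -Xsq; exact: jbracket_dotr_sq. Qed.

Let A1 xi : 1 <= A xi. Proof. exact: jbracket_ge1. Qed.
Let A0 xi : 0 < A xi. Proof. exact: jbracket_gt0. Qed.
Let r2_ge0 xi : 0 <= A xi ^+ 2 - 1.
Proof. by rewrite subr_ge0 exprn_ege1. Qed.

Let h p xi := t p * A xi + l p xi.
Let k p xi := h p xi - s p.
Let i p xi := (h p xi + s p)^-1.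
(** The logarithmic derivative of A along v is y, and z obeys a Riccati equation. *)
Let z p xi := h p xi * i p xi.
Let y p xi := z p xi - t p * (A xi)^-1 * i p xi.

(** As |x| < t, h is at least t (A - |xi|) = t / (A + |xi|). *)
Let h_lb p xi : t p <= 2 * A xi * h p xi.
Proof.
have a1 := A1 xi; have a0 := A0 xi; have tt := t0 p; have r2 := r2_ge0 xi.
have lX : `|l p xi| <= t p * Num.sqrt (A xi ^+ 2 - 1).
  rewrite -ler_sqr ?nnegrE ?mulr_ge0 ?sqrtr_ge0 ?(ltW tt)//.
  rewrite real_normK ?num_real// exprMn (sqr_sqrtr r2) (le_trans (lsq p xi))//.
  by rewrite ler_wpM2r// gerBl sqr_ge0.
set r := Num.sqrt _ in lX.
have r0 : 0 <= r by exact: sqrtr_ge0.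
have rr : r ^+ 2 = A xi ^+ 2 - 1 by exact: (sqr_sqrtr r2).
have hg : h p xi >= t p * (A xi - r).
  by move: lX; rewrite ler_norml /h => /andP[h1 h2]; lra.
have rA : r <= A xi by rewrite -ler_sqr ?nnegrE ?(ltW a0)// rr lerBlDr lerDl.
have h2 : (A xi + r) * (A xi - r) = 1 by rewrite mulrC -subr_sqr rr; ring.
have h1 : 0 <= A xi - r by rewrite subr_ge0.
have h3 : 1 <= 2 * A xi * (A xi - r) by rewrite -[leLHS]h2 ler_wpM2r//; lra.
have : t p * 1 <= t p * (2 * A xi * (A xi - r)) by rewrite ler_pM2l.
have : 2 * A xi * (t p * (A xi - r)) <= 2 * A xi * h p xi by rewrite ler_pM2l// mulr_gt0.
lra.
Qed.

Let h0 p xi : 0 < h p xi.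
Proof.
have := h_lb p xi; have := t0 p; have := A0 xi => a0 tt hg.
have : 0 < 2 * A xi * h p xi by exact: lt_le_trans tt hg.
by rewrite pmulr_rgt0// mulr_gt0.
Qed.

Let hs0 p xi : 0 < h p xi + s p. Proof. by rewrite addr_gt0. Qed.

(** h A - t is the derivative of h along the Euler field times A, and h^2 - s^2 is the
    squared length of the hyperbolic gradient of h; the difference of the two sides is
    the defect in the Cauchy-Schwarz inequality for x and xi. *)
Let grad p xi : (h p xi * A xi - t p) ^+ 2 <= (h p xi ^+ 2 - s p ^+ 2) * (A xi ^+ 2 - 1).
Proof.
rewrite -subr_ge0 (_ : _ - _ = (t p ^+ 2 - s p ^+ 2) * (A xi ^+ 2 - 1) - l p xi ^+ 2).
  by rewrite subr_ge0 lsq.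
by rewrite /h; ring.
Qed.

(** The reversed Cauchy-Schwarz inequality for timelike vectors: the phase is smallest
    at the point of the hyperboloid in the direction of (- x, t). *)
Let hs p xi : s p <= h p xi.
Proof.
rewrite -ler_sqr ?nnegrE ?(ltW (h0 _ _)) ?(ltW (s0 _))// -subr_ge0.
have := r2_ge0 xi; rewrite le_eqVlt => /orP[/eqP r0|r0].
  have l0 : l p xi = 0.
    have := lsq p xi; rewrite -r0 mulr0 => l2; apply/eqP; rewrite -sqrf_eq0 eq_le l2.
    by rewrite sqr_ge0.
  have -> : h p xi ^+ 2 = t p ^+ 2 * A xi ^+ 2 by rewrite /h l0; ring.
  have -> : A xi ^+ 2 = 1 by lra.
  by rewrite mulr1 -Xsq dotrr_ge0.
by rewrite -(pmulr_lge0 _ r0) (le_trans _ (grad p xi))// sqr_ge0.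
Qed.

Let k0 p xi : 0 <= k p xi. Proof. by rewrite /k subr_ge0. Qed.

Let i_ge0 p xi : 0 <= i p xi. Proof. by rewrite /i invr_ge0 ltW. Qed.

Let bd_i p : locally_bounded (i p).
Proof.
move=> L; exists (s p)^-1 => xi _; rewrite ger0_norm//.
by rewrite /i lef_pV2 ?posrE// lerDr ltW.
Qed.

Let da_hx p : derivative_along (trans (x p)) (fun xi => h p xi + s p)
  (fun xi => t p * (l p xi * (A xi)^-1) + dotr (x p) (x p)).
Proof.
apply: da_eq (da_add (da_add (da_mul (trans_flow _)
  (da_cst _ (t p)) (da_jbracket_trans (x p))) (da_dotr_trans (x p))) (da_cst _ (s p))) _ => xi.
by rewrite mul0r add0r addr0.
Qed.

Let da_hE0 p : derivative_along dil (h p) (fun xi => t p * (A xi + -1 * (A xi)^-1) + l p xi).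
Proof.
apply: da_eq (da_add (da_mul dil_flow (da_cst _ (t p)) da_jbracket_dil) (da_dotr_dil (x p))) _
  => xi.
by rewrite mul0r add0r.
Qed.

Let da_hE p : derivative_along dil (fun xi => h p xi + s p) (fun xi => t p * (A xi +
  -1 * (A xi)^-1) + l p xi).
Proof.
by apply: da_eq (da_add (da_hE0 p) (da_cst _ (s p))) _ => xi; rewrite addr0.
Qed.

Let da_a p := da_inv (trans_flow _) (da_hx p) (hs0 p) (@bd_i p).
Let da_b p := da_mul dil_flow (da_hE0 p) (da_inv dil_flow (da_hE p) (hs0 p) (@bd_i p)).

(** The hyperbolic gradient D_x + h E of h, divided by h + s. *)
Let v p : @vfield R n := VField (da_a p) (da_b p).

Let ne p xi : (h p xi + s p != 0) * (A xi != 0).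
Proof. by rewrite !gt_eqF. Qed.

Let wA p : vderive (v p) A (fun xi => y p xi * A xi).
Proof.
exists (fun xi => l p xi * (A xi)^-1), (fun xi => A xi + -1 * (A xi)^-1); split.
- exact: da_jbracket_trans.
- exact: da_jbracket_dil.
- move=> xi /=; rewrite /y /z /i.
  have -> : l p xi = h p xi - t p * A xi by rewrite /h; ring.
  by field; rewrite !ne.
Qed.

Let wl p : vderive (v p) (l p) (fun xi => k p xi - t p * (y p xi * A xi)).
Proof.
exists (fun=> dotr (x p) (x p)), (l p); split.
- exact: da_dotr_trans.
- exact: da_dotr_dil.
- move=> xi /=; rewrite Xsq /y /z /i /k.
  have -> : l p xi = h p xi - t p * A xi by rewrite /h; ring.
  by field; rewrite !ne.
Qed.

Let wh p : vderive (v p) (h p) (k p).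
Proof.
by apply: vderive_eq (vderive_add (vderive_scale (t p) (wA p)) (wl p)) _ => xi; ring.
Qed.

Let wk p : vderive (v p) (k p) (fun xi => 1 * k p xi).
Proof. by apply: vderive_eq (vderive_add (wh p) (vderive_cst _ (- s p))) _ => xi; ring. Qed.

Let wi p : vderive (v p) (i p) (fun xi => - i p xi ^+ 2 * k p xi).
Proof.
apply: vderive_eq (vderive_inv (vderive_add (wh p) (vderive_cst _ (s p))) (hs0 p) (@bd_i p)) _
  => xi.
by rewrite addr0.
Qed.

Let wz p : vderive (v p) (z p) (fun xi => (1 - z p xi) * (2 * z p xi - 1)).
Proof.
apply: vderive_eq (vderive_mul (wh p) (wi p)) _ => xi.
by rewrite /z /i /k; field; rewrite !ne.
Qed.

Let wy p : vderive (v p) (y p) (fun xi => (1 - z p xi) * (2 * z p xi - 1) +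
  (z p xi - y p xi) * (y p xi + 2 * z p xi - 1)).
Proof.
have wAV := vderive_inv (wA p) A0 locally_bounded_jbracketV.
have w := vderive_add (wz p) (vderive_scale (-1) (vderive_mul (vderive_scale (t p) wAV) (wi p))).
rewrite (_ : y p = (fun xi => z p xi + -1 * (t p * (A xi)^-1 * i p xi))); last first.
  by apply/funext => xi; rewrite /y; ring.
apply: vderive_eq w _ => xi.
by rewrite /y /z /i /k; field; rewrite !ne.
Qed.

Let om p xi := Num.sqrt (1 + k p xi).
Let om1 p xi : 1 <= om p xi.
Proof. by rewrite /om -[leLHS]sqrtr1 ler_wsqrtr// lerDl. Qed.
Let omE p xi : om p xi ^+ 2 = 1 + k p xi.
Proof. by rewrite sqr_sqrtr// addr_ge0. Qed.

Let z01 p xi : 0 <= z p xi <= 1.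
Proof.
rewrite /z mulr_ge0 ?(ltW (h0 _ _))//=.
by rewrite /i ler_pdivrMr// mul1r lerDl ltW.
Qed.

Let yE p xi : y p xi * (A xi * (h p xi + s p)) = h p xi * A xi - t p.
Proof. by rewrite /y /z /i; field; rewrite !ne. Qed.

(** The Euler derivative is bounded by the length of the gradient; dividing by h + s
    turns h^2 - s^2 into k.  So y vanishes where k does, to order one half. *)
Let y_sq p xi : y p xi ^+ 2 * A xi ^+ 2 * (h p xi + s p) <= k p xi * (A xi ^+ 2 - 1).
Proof.
rewrite -(ler_pM2r (hs0 p xi)).
have -> : y p xi ^+ 2 * A xi ^+ 2 * (h p xi + s p) * (h p xi + s p) = (h p xi * A xi - t p) ^+ 2.
  by rewrite -yE; ring.
apply: le_trans (grad p xi) _; rewrite le_eqVlt; apply/orP; left; apply/eqP.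
by rewrite /k; ring.
Qed.

Let y_le1 p xi : `|y p xi| <= 1.
Proof.
have hh := hs0 p xi; have a0 := A0 xi.
have H : 0 < A xi ^+ 2 * (h p xi + s p) by rewrite mulr_gt0// exprn_gt0.
rewrite -[leRHS]ger0_norm// -ler_sqr ?nnegrE// !real_normK ?num_real// expr1n.
rewrite -(ler_pM2r H) mul1r mulrA (le_trans (y_sq p xi))//.
rewrite [leRHS]mulrC ler_pM// ?r2_ge0//.
  by rewrite /k; have := s0 p; lra.
by rewrite gerBl.
Qed.

Let syz N : symbol v om N y (fun _ _ => 1) /\ symbol v om N z (fun _ _ => 1).
Proof.
have bdy : exists C : R, 0 <= C /\ forall p xi, `|y p xi| <= C * 1.
  by exists 1; split => // p xi; rewrite mulr1.
have bdz : exists C : R, 0 <= C /\ forall p xi, `|z p xi| <= C * 1.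
  exists 1; split => // p xi; rewrite mulr1; have /andP[z0 z1] := z01 p xi.
  by rewrite ger0_norm.
elim: N => [|N [sy sz]].
  by split; split => // p; [exact: vderive_meas (wy p)|exact: vderive_meas (wz p)].
have c a := symbol_cst v om1 N a.
have mulS f g : symbol v om N f (fun _ _ => 1) -> symbol v om N g (fun _ _ => 1) ->
    symbol v om N (fun p xi => f p xi * g p xi) (fun _ _ => 1).
  by move=> hf hg; apply: symbol_weak1 (symbol_mul om1 hf hg) => // p xi; rewrite mul1r.
have w1 g : symbol v om N g (fun _ _ => 1) -> symbol v om N g (fun p xi => 1 * om p xi).
  by apply: symbol_weak1 => // p xi; rewrite mul1r.
have s1 : symbol v om N (fun p xi => (1 - z p xi) * (2 * z p xi - 1)) (fun _ _ => 1).
  apply: symbol_eq (mulS _ _ (symbol_add (c 1) (mulS _ _ (c (-1)) sz)) (symbol_add (mulS _ _ (c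
    2) sz) (c (-1)))).
  by move=> p xi /=; ring.
have s2 : symbol v om N (fun p xi => (z p xi - y p xi) * (y p xi + 2 * z p xi - 1)) (fun _ _ => 1).
  apply: symbol_eq (mulS _ _ (symbol_add sz (mulS _ _ (c (-1)) sy)) (symbol_add (symbol_add sy
    (mulS _ _ (c 2) sz)) (c (-1)))).
  by move=> p xi /=; ring.
split.
  by apply: (symbol_step bdy wy); apply: w1; exact: symbol_add.
by apply: (symbol_step bdz wz); exact: w1.
Qed.

Let mulS N f g : symbol v om N f (fun _ _ => 1) -> symbol v om N g (fun _ _ => 1) ->
  symbol v om N (fun p xi => f p xi * g p xi) (fun _ _ => 1).
Proof.
by move=> hf hg; apply: symbol_weak1 (symbol_mul om1 hf hg) => // p xi; rewrite mul1r.
Qed.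

Let sdiv N : symbol v om N (fun p => vdiv (v p)) (fun _ _ => 1).
Proof.
have [sy sz] := syz N; have c a := symbol_cst v om1 N a.
apply: symbol_eq (symbol_add (symbol_add (mulS (c (n%:R - 2)) sz) sy) (c 1)) => p xi.
rewrite /vdiv /= Xsq /y /z /i.
have -> : l p xi = h p xi - t p * A xi by rewrite /h; ring.
by field; rewrite !ne.
Qed.

Let U p (xi : E) := 1 - dl p * (A xi ^+ 2 - 1).
(** Off the support of the cutoff this leaves room for the trivial bound on D. *)
Let bigU p xi : R := if 0 < U p xi then 1 else 1 + dl p * A xi ^+ 2.
Let dl0 p : 0 < dl p. Proof. exact: par_dl0. Qed.
Let D p xi := dl p * A xi ^+ 2.
Let y' p xi := dl p * A xi ^+ 2 * y p xi.
Let z' p xi := dl p * A xi ^+ 2 * (2 * z p xi - 1).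

Let D_ge0 p xi : 0 <= D p xi.
Proof. by rewrite mulr_ge0 ?exprn_ge0 ?(ltW (dl0 _)) ?(ltW (A0 _)). Qed.

Let bigU_ge0 p xi : 0 <= bigU p xi.
Proof. by rewrite /bigU; case: ifP => // _; rewrite addr_ge0//; exact: D_ge0. Qed.

(** On the support of the cutoff, dl |xi|^2 < 1.  If dl <= 1 this bounds D.  If dl > 1,
    then |xi| < 1, and dl <= t makes D at most a multiple of t, hence of h. *)
Let D_small p xi : 0 < U p xi ->
  D p xi <= 2 \/ (D p xi <= 8 * (h p xi + s p) /\ D p xi * (A xi ^+ 2 - 1) <= 2).
Proof.
rewrite /U subr_gt0 => hU; have d0 := dl0 p; have := par_dl1 (sval p);
  rewrite -/(dl p) -/(t p) => -[d1|dt].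
  by left; rewrite /D; lra.
have [d1|d1] := leP (dl p) 1; first by left; rewrite /D; lra.
right; have hr := r2_ge0 xi.
have rle : A xi ^+ 2 - 1 <= 1.
  have : (A xi ^+ 2 - 1) * 1 <= (A xi ^+ 2 - 1) * dl p by rewrite ler_wpM2l// ltW.
  lra.
have a2 : A xi ^+ 2 <= 2 by lra.
split; last first.
  have : (dl p * (A xi ^+ 2 - 1)) * A xi ^+ 2 <= 1 * A xi ^+ 2.
    by rewrite ler_wpM2r ?exprn_ge0 ?(ltW (A0 _))// ltW.
  rewrite /D; lra.
have a3 : A xi <= 2.
  by rewrite -ler_sqr ?nnegrE ?(ltW (A0 _))//; lra.
have := h_lb p xi; have gg := h0 p xi; have ss := s0 p => hg.
have h1 : 2 * A xi * h p xi <= 4 * h p xi by rewrite ler_pM2r//; lra.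
have h2 : D p xi <= dl p * 2 by rewrite /D ler_pM2l.
lra.
Qed.

Let zeta p xi : (2 * z p xi - 1) * (h p xi + s p) = k p xi.
Proof. by rewrite /z /i /k; field; rewrite !ne. Qed.

Let zeta01 p xi : 0 <= 2 * z p xi - 1 <= 1.
Proof.
rewrite -(pmulr_lge0 _ (hs0 p xi)) zeta k0 /=.
by have /andP[_ ?] := z01 p xi; lra.
Qed.

(** 2 z - 1 = k / (h + s), while D is at most a multiple of h + s unless it is bounded. *)
Let bd_z' : exists C, 0 <= C /\ forall p xi, `|z' p xi| <= C * (om p xi ^+ 2 * bigU p xi).
Proof.
exists 8; split => // p xi; have /andP[Z0 Z1] := zeta01 p xi; have hD := D_ge0 p xi.
have kk := k0 p xi.
have DZ0 : 0 <= D p xi * (2 * z p xi - 1) by exact: mulr_ge0.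
rewrite /z' -/(D p xi) (ger0_norm DZ0) omE.
have DZ : D p xi * (2 * z p xi - 1) <= D p xi by rewrite ler_piMr.
rewrite /bigU; case: ifPn => [/D_small[h1|[h1 _]]|_].
- by rewrite mulr1; lra.
- have : D p xi * (2 * z p xi - 1) <= 8 * (h p xi + s p) * (2 * z p xi - 1) by rewrite ler_wpM2r.
  have -> : 8 * (h p xi + s p) * (2 * z p xi - 1) = 8 * k p xi by rewrite -zeta; ring.
  by rewrite mulr1; lra.
- rewrite -/(D p xi); have : 0 <= k p xi * D p xi by rewrite mulr_ge0.
  lra.
Qed.

(** Where D is large it is at most a multiple of h + s and |xi|^2 is at most 2 / D, so
    that y_sq bounds D^2 y^2 by a multiple of k. *)
Let bd_y' : exists C, 0 <= C /\ forall p xi, `|y' p xi| <= C * (om p xi * bigU p xi).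
Proof.
exists 4; split => // p xi; rewrite /y' -/(D p xi) normrM ger0_norm//.
have kk := k0 p xi; have hD := D_ge0 p xi; have o1 := om1 p xi; have y1 := y_le1 p xi.
have oE := omE p xi.
rewrite /bigU; case: ifPn => [/D_small[h1|[h1 h2]]|_].
- rewrite mulr1; have : D p xi * `|y p xi| <= 2 * 1 by rewrite ler_pM.
  lra.
- have o0 : 0 <= 4 * om p xi by rewrite mulr_ge0// (le_trans _ o1).
  have Dy0 : 0 <= D p xi * `|y p xi| by rewrite mulr_ge0.
  rewrite mulr1 -ler_sqr ?nnegrE// exprMn real_normK ?num_real//.
  have hp := hs0 p xi; have r2 := r2_ge0 xi.
  have hy2 : y p xi ^+ 2 * (h p xi + s p) <= k p xi * (A xi ^+ 2 - 1).
    apply: le_trans (y_sq p xi); rewrite ler_wpM2r ?(ltW hp)//.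
    by rewrite ler_peMr ?sqr_ge0// exprn_ege1.
  have -> : (4 * om p xi) ^+ 2 = 16 * (1 + k p xi) by rewrite exprMn oE; ring.
  have e1 : D p xi ^+ 2 * y p xi ^+ 2 <= D p xi * (8 * (h p xi + s p)) * y p xi ^+ 2.
    by rewrite expr2 ler_wpM2r ?sqr_ge0// ler_wpM2l.
  have e2 : D p xi * (y p xi ^+ 2 * (h p xi + s p)) <= D p xi * (k p xi *
    (A xi ^+ 2 - 1)) by rewrite ler_wpM2l.
  have e3 : k p xi * (D p xi * (A xi ^+ 2 - 1)) <= k p xi * 2 by rewrite ler_wpM2l.
  lra.
- rewrite -/(D p xi).
  have : D p xi * `|y p xi| <= D p xi * 1 by rewrite ler_wpM2l.
  have : 1 * D p xi <= om p xi * D p xi by rewrite ler_wpM2r.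
  have : 0 <= om p xi by exact: le_trans o1.
  lra.
Qed.

Let wD p : vderive (v p) (D p) (fun xi => 2 * y p xi * D p xi).
Proof.
by apply: vderive_eq (vderive_scale (dl p) (vderive_exp 2 (wA p))) _ => xi; rewrite /D /=; ring.
Qed.

Let wy' p : vderive (v p) (y' p) (fun xi => (y p xi + z p xi) * y' p xi + (1 +
  -1 * y p xi) * z' p xi).
Proof.
by apply: vderive_eq (vderive_mul (wD p) (wy p)) _ => xi; rewrite /D /y' /z' /=; ring.
Qed.

Let wz' p : vderive (v p) (z' p) (fun xi => 0 * y' p xi + (2 * (y p xi + (1 +
  -1 * z p xi))) * z' p xi).
Proof.
rewrite (_ : z' p = (fun xi => D p xi * (2 * z p xi + -1))); last first.
  by apply/funext => xi; rewrite /z' /D; ring.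
apply: vderive_eq (vderive_mul (wD p) (vderive_add (vderive_scale 2 (wz p)) (vderive_cst _
  (-1)))) _ => xi.
by rewrite /D /z' /=; ring.
Qed.

Let osc_bound (beta : R) (beta0 : 0 <= beta) N :
  exists C, 0 <= C /\ forall p c,
    (`|\int[mun]_xi (jbracket xi `^ (- beta) * Num.max (1 - dl p * (jbracket xi ^+ 2 - 1)) 0 ^+ N.+1
          * cos (h p xi - par_kap (sval p) * (2 * ln (jbracket xi)) + c))|%:E <=
     (C * (1 + `|par_kap (sval p)|) ^+ N)%:E *
       \int[mun]_xi (jbracket xi `^ (- beta) * (Num.sqrt (1 + k p xi))^-1 ^+ N)%:E)%E.
Proof.
have c m a := symbol_cst v om1 m a.
have sy m := (syz m).1; have sz m := (syz m).2.
have sp := symbol_pair om1 bigU_ge0 bd_y' bd_z' wy' wz'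
  (fun m => symbol_add (sy m) (sz m)) (fun m => symbol_add (c m 1) (mulS (c m (-1)) (sy m)))
  (fun m => c m 0) (fun m => mulS (c m 2) (symbol_add (sy m) (symbol_add (c m 1) (mulS (c m
    (-1)) (sz m))))).
exact: (amplitude_bound k0 wA wh wk sy (fun m => c m 1) sdiv beta0 dl0 (fun m => (sp m).1)).
Qed.

Local Notation beta := (n%:R / 2 + 1 : R).

(** k is the phase minus its minimum s, the situation of decay_integral. *)
Lemma timelike_bound : exists C, 0 <= C /\ forall p c,
  `|\int[mun]_xi (jbracket xi `^ (- beta) *
      Num.max (1 - par_dl (sval p) * (jbracket xi ^+ 2 - 1)) 0 ^+ (2 * n.+1).+1 *
      cos (par_t (sval p) * jbracket xi + dotr (par_x (sval p)) xi
           - par_kap (sval p) * (2 * ln (jbracket xi)) + c))| <=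
  C * (1 + `|par_kap (sval p)|) ^+ (2 * n.+1) * par_t (sval p) `^ (- (n%:R / 2)).
Proof.
have n2 : 0 <= n%:R / 2 :> R by rewrite divr_ge0.
have b0 : 0 <= beta by rewrite addr_ge0.
have [C [C0 hC]] := osc_bound b0 (2 * n.+1).
have [C' [C'0 hC']] := @decay_integral R n.
exists (C * C'); rewrite mulr_ge0//; split => // p c.
rewrite -lee_fin; apply: (le_trans (hC p c)).
have dec := hC' (x p) (t p) (s p) (t0 p) (ltW (svalP p)) (ltW (s0 p)) (lexx _) (k0 p).
have K0 : (0 <= (C * (1 + `|par_kap (sval p)|) ^+ (2 * n.+1))%:E)%E.
  by rewrite lee_fin mulr_ge0// exprn_ge0// addr_ge0.
rewrite (_ : C * C' * _ * _ = C * (1 + `|par_kap (sval p)|) ^+ (2 * n.+1) * (C' *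
  t p `^ (- (n%:R / 2)))); last by rewrite /t; ring.
rewrite [leRHS]EFinM; apply: lee_wpmul2l => //.
apply: le_trans dec.
rewrite le_eqVlt; apply/orP; left; apply/eqP; apply: eq_integral => xi _; congr ((_ * _)%:E).
rewrite -/(A xi) -/(l p xi) -/(h p xi) -/(k p xi) exprM; congr (_ ^+ _).
by rewrite exprVn -/(om p xi) omE.
Qed.

End timelike.

(** * The kernel with a truncated power as cutoff *)

Section cutoff_bound.
Context {R : realType} {n : nat}.
Local Notation E := (euclid R n).
Local Notation mu := (@lebesgue_measure R).
Local Notation mun := (@lebesgue_measuren R n).
Local Notation beta := (n%:R / 2 + 1 : R).
Local Notation N := (2 * n.+1)%N.

Definition amplitude (xi : E) : R := jbracket xi `^ (- beta).

Definition phase (x : E) (t kap c : R) (xi : E) : R :=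
  t * jbracket xi + dotr x xi - kap * (2 * ln (jbracket xi)) + c.

Definition ballcut (dl : R) (xi : E) : R := Num.max (1 - dl * (jbracket xi ^+ 2 - 1)) 0.

Lemma amplitude01 xi : 0 <= amplitude xi <= 1.
Proof.
have b0 : 0 <= beta by rewrite addr_ge0// divr_ge0.
by rewrite powR_ge0 /= -(powRr0 (jbracket xi)) ler_powR ?jbracket_ge1// oppr_le0.
Qed.

Lemma ballcut01 dl xi : 0 < dl -> 0 <= ballcut dl xi <= 1.
Proof.
move=> d0; rewrite /ballcut le_max lexx orbT /= ge_max ler01 andbT.
by rewrite lerBlDr lerDl mulr_ge0 ?(ltW d0)// subr_ge0 exprn_ege1// jbracket_ge1.
Qed.

Lemma measurable_amplitude : measurable_fun setT amplitude.
Proof. exact: (measurableT_comp (@measurable_powR R _) (@measurable_jbracket R n)). Qed.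

Lemma measurable_ballcut dl : measurable_fun setT (ballcut dl).
Proof.
apply: measurable_maxr => //; apply: measurable_funB => //; apply: measurable_funM => //.
by apply: measurable_funB => //; apply: measurable_funX; exact: measurable_jbracket.
Qed.

Lemma measurable_cosphase x t kap c : measurable_fun setT (fun xi => cos (phase x t kap c xi)).
Proof.
have mc : measurable_fun setT (@cos R) by apply: continuous_measurable_fun; exact: continuous_cos.
have mj := @measurable_jbracket R n.
apply: (measurableT_comp mc); apply: measurable_funD => //; apply: measurable_funB.
  by apply: measurable_funD; [exact: measurable_funM|exact: measurable_dotr].
apply: measurable_funM => //; apply: measurable_funM => //.
exact: (measurableT_comp (@measurable_ln R) mj).
Qed.

Lemma norm_cos_le1 (a : R) : `|cos a| <= 1.
Proof. by rewrite ler_norml cos_geN1 cos_le1. Qed.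

(** The cutoff is supported in a cube of side 2 dl^(-1/2), and all factors are at
    most 1. *)
Lemma cutoff_trivial x t kap c dl m : 0 < dl ->
  `|\int[mun]_xi (amplitude xi * ballcut dl xi ^+ m.+1 * cos (phase x t kap c xi))| <=
  2 ^+ n * dl `^ (- (n%:R / 2)).
Proof.
move=> d0.
pose q := (Num.sqrt dl)^-1.
have q0 : 0 < q by rewrite invr_gt0 sqrtr_gt0.
have qq : q ^+ 2 * dl = 1 by rewrite exprVn sqr_sqrtr ?(ltW d0)// mulVf// gt_eqF.
pose J : set (measurableTypeR R) := `[- q, q]%classic.
have mJ : measurable J by exact: measurable_itv.
pose box := [set xi : E | forall i, J (tnth xi i)].
have mbox : measurable box by exact: (@measurable_box R n (fun=> J)).
have muJ : lebesgue_measure J = (2 * q)%:E.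
  rewrite lebesgue_measure_itv /= lte_fin ifT; last by lra.
  by rewrite -EFinB; congr EFin; ring.
have mubox : mun box = ((2 * q) ^+ n)%:E.
  transitivity (\prod_(i < n) (lebesgue_measure J))%E.
    exact: (@lebesgue_measuren_box R n (fun=> J)).
  rewrite [X in (\prod_(i < n) X)%E](_ : _ = (2 * q)%:E); last exact: muJ.
  by rewrite prodEFin prodr_const card_ord.
pose f xi := amplitude xi * ballcut dl xi ^+ m.+1 * cos (phase x t kap c xi).
have mf : measurable_fun setT f.
  apply: measurable_funM; last exact: measurable_cosphase.
  by apply: measurable_funM; [exact: measurable_amplitude|apply: measurable_funX;
    exact: measurable_ballcut].
have fle xi : `|f xi| <= \1_box xi.
  have [/andP[a0 a1] /andP[b0 b1]] := (amplitude01 xi, ballcut01 xi d0).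
  rewrite indicE; have [_|] := boolP (xi \in box).
    rewrite /f !normrM (ger0_norm a0) normrX (ger0_norm b0) -[leRHS]mulr1.
    by rewrite ler_pM ?mulr_ge0 ?exprn_ge0 ?norm_cos_le1// mulr_ile1 ?exprn_ge0// exprn_ile1.
  move=> /negP nb; rewrite (_ : f xi = 0) ?normr0//.
  rewrite /f (_ : ballcut dl xi = 0) ?expr0n/= ?mulr0 ?mul0r//.
  rewrite /ballcut max_r// subr_le0 leNgt; apply/negP => lt1; apply: nb; rewrite inE /box /= => i.
  rewrite /J /= in_itv /= -ler_norml -ler_sqr ?nnegrE ?normr_ge0 ?(ltW q0)// real_normK ?num_real//.
  rewrite -(ler_pM2r d0) qq mulrC (le_trans _ (ltW lt1))// ler_pM2l//.
  rewrite jbracket_sqr addrC addKr /dotr (bigD1 i)//= -expr2 lerDl sumr_ge0// => j _.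
  by rewrite -expr2 sqr_ge0.
have iB : mun.-integrable setT (fun xi => (\1_box xi)%:E).
  apply/integrableP; split; first by apply/measurable_EFinP; exact: measurable_indic.
  under eq_integral do rewrite gee0_abs ?lee_fin//.
  by rewrite integral_indic// setIT [X in (X < _)%E]mubox ltry.
have ifn : mun.-integrable setT (EFin \o f).
  apply: le_integrable iB => //; first exact/measurable_EFinP.
  by move=> xi _; rewrite /= lee_fin (le_trans (fle xi))// ler_norm.
rewrite -lee_fin EFin_normr_Rintegral//.
apply: (le_trans (le_abse_integral _ _ (measurable_int _ ifn))) => //.
apply: (@le_trans _ _ (\int[mun]_xi (\1_box xi)%:E)%E).
  apply: ge0_le_integral => //.
  - by apply: measurableT_comp => //; exact: (measurable_int _ ifn).
  - by apply/measurable_EFinP; exact: measurable_indic.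
  - by move=> xi _ /=; rewrite lee_fin.
rewrite integral_indic// setIT [X in (X <= _)%E]mubox lee_fin exprMn ler_wpM2l ?exprn_ge0//.
rewrite /q powRN exprVn lef_pV2 ?posrE ?exprn_gt0 ?sqrtr_gt0 ?powR_gt0//.
by rewrite -powR12_sqrt ?(ltW d0)// -powR_mulrn ?powR_ge0// -powRrM mulrC.
Qed.

Lemma cutoff_bound_pos : exists C, 0 <= C /\ forall x t kap c dl, 0 < t -> 0 < dl ->
  `|\int[mun]_xi (amplitude xi * ballcut dl xi ^+ N.+1 * cos (phase x t kap c xi))| <=
  C * (1 + `|kap|) ^+ N * t `^ (- (n%:R / 2)).
Proof.
have [C1 [C10 h1]] := @timelike_bound R n.
have [C2 [C20 h2]] := @spacelike_bound R n.
exists (C1 + C2 + 2 ^+ n); split; first by rewrite !addr_ge0// exprn_ge0.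
move=> x t kap c dl t0 d0.
have K1 : 1 <= (1 + `|kap|) ^+ N by rewrite exprn_ege1// lerDl.
have K0 : 0 <= (1 + `|kap|) ^+ N by exact: le_trans K1.
have T0 : 0 <= t `^ (- (n%:R / 2)) by exact: powR_ge0.
have n0 : 0 <= 2 ^+ n :> R by rewrite exprn_ge0.
have [d1|d1] : (dl <= 1 \/ dl <= t) \/ (1 < dl /\ t < dl).
  by have [a|a] := leP dl 1; have [b|b] := leP dl t; [left; left|left; left|left; right|right].
- pose p := Params x kap t0 d0 d1.
  have [xt|xt] := ltP (dotr x x) (t ^+ 2).
    apply: (le_trans (h1 (exist _ p xt) c)) => /=.
    by rewrite ler_wpM2r// ler_wpM2r// -addrA lerDl addr_ge0.
  apply: (le_trans (h2 (exist _ p xt) c)) => /=.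
  by rewrite ler_wpM2r// ler_wpM2r// [C1 + C2]addrC -addrA lerDl addr_ge0.
- apply: (le_trans (cutoff_trivial _ _ _ _ _ d0)).
  have h : dl `^ (- (n%:R / 2)) <= t `^ (- (n%:R / 2)).
    rewrite !powRN lef_pV2 ?posrE ?powR_gt0// ge0_ler_powR ?nnegrE ?divr_ge0 ?(ltW t0) ?(ltW d0)//.
    by apply: ltW; case: d1.
  rewrite (le_trans (ler_wpM2l n0 h))// ler_wpM2r//.
  rewrite -[leLHS]mulr1 ler_pM// lerDr addr_ge0//.
Qed.

(** Complex conjugation changes the signs of x, t, kap and c together. *)
Lemma cutoff_bound : exists C, 0 <= C /\ forall x t kap c dl, t != 0 -> 0 < dl ->
  `|\int[mun]_xi (amplitude xi * ballcut dl xi ^+ N.+1 * cos (phase x t kap c xi))| <=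
  C * (1 + `|kap|) ^+ N * `|t| `^ (- (n%:R / 2)).
Proof.
have [C [C0 h]] := cutoff_bound_pos; exists C; split => // x t kap c dl.
rewrite neq_lt => /orP[t0|t0] d0; last by rewrite (gtr0_norm t0) h.
have mt : 0 < - t by rewrite oppr_gt0.
rewrite (ltr0_norm t0) -(normrN kap).
apply: le_trans (h (vscale (-1) x) (- t) (- kap) (- c) dl mt d0).
rewrite le_eqVlt; apply/orP; left; apply/eqP; congr `|_|.
apply: eq_Rintegral => xi _; congr (_ * _).
rewrite -cosN; congr cos; rewrite /phase [dotr (vscale _ _) _]dotrC dotr_vscale [dotr xi x]dotrC;
  ring.
Qed.

End cutoff_bound.

(** * Smooth functions as superpositions of truncated powers *)

Section superposition.
Context {R : realType}.
Local Notation mu := (@lebesgue_measure R).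
Variables (O : set R).
Hypotheses (openO : open O) (O1 : forall x, 1 <= x -> O x).

(** The class C^m with all derivatives vanishing on O.  With O open the derivatives
    inherit the vanishing, and with O containing [1, +oo[ no boundary terms appear
    at 1. *)
Fixpoint Cm m (f : R -> R) : Prop :=
  [/\ continuous f, (forall x, O x -> f x = 0) &
  match m with
  | 0 => True
  | m'.+1 => exists f', (forall x, is_derive x (1 : R) f (f' x)) /\ Cm m' f'
  end].

Lemma Cm_cont m f : Cm m f -> continuous f. Proof. by case: m => [|m] []. Qed.
Lemma Cm_zero m f : Cm m f -> forall x, O x -> f x = 0. Proof. by case: m => [|m] []. Qed.

Lemma CmS m f : Cm m.+1 f -> Cm m f.
Proof.
elim: m f => [|m IHm] f [cf zf [f' [df hf']]]; split => //.
by exists f'; split => //; exact: IHm.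
Qed.

Lemma Cm_lin m f g (a b : R) : Cm m f -> Cm m g -> Cm m (fun x => a * f x + b * g x).
Proof.
elim: m f g => [|m IHm] f g [cf zf hf] [cg zg hg]; split => //.
- by move=> x; apply: cvgD; (apply: cvgM; first exact: cvg_cst); [exact: cf|exact: cg].
- by move=> x Ox; rewrite zf// zg// !mulr0 addr0.
- by move=> x; apply: cvgD; (apply: cvgM; first exact: cvg_cst); [exact: cf|exact: cg].
- by move=> x Ox; rewrite zf// zg// !mulr0 addr0.
- have [f' [df hf']] := hf; have [g' [dg hg']] := hg.
  exists (fun x => a * f' x + b * g' x); split; last exact: IHm.
  move=> x; have := df x; have := dg x => ? ?.
  by apply: is_derive_eq; rewrite /GRing.scale /=; ring.
Qed.

Lemma Cm_mulx m f : Cm m f -> Cm m (fun x => x * f x).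
Proof.
elim: m f => [|m IHm] f hf.
  have [cf zf _] := hf; split => //.
  - by move=> x; apply: cvgM; [exact: cvg_id|exact: cf].
  - by move=> x Ox; rewrite zf// mulr0.
have [cf zf [f' [df hf']]] := hf; split => //.
- by move=> x; apply: cvgM; [exact: cvg_id|exact: cf].
- by move=> x Ox; rewrite zf// mulr0.
- exists (fun x => 1 * f x + 1 * (x * f' x)); split; last first.
    by apply: Cm_lin; [exact: CmS|exact: IHm].
  move=> x; have := df x => ?; apply: is_derive_eq; rewrite /GRing.scale /=; ring.
Qed.

Definition paraboloid (r rho : R) : R := 1 - (r / rho) ^+ 2.

Lemma is_derive_bump1 (r rho : R) : r = 0 \/ rho != 0 ->
  is_derive rho (1 : R) (paraboloid r) (2 * r ^+ 2 * rho^-1 ^+ 3).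
Proof.
move=> [->|rho0].
  rewrite (_ : paraboloid 0 = cst 1); last by apply/funext => x;
    rewrite /paraboloid mul0r expr0n subr0.
  by apply: is_derive_eq; rewrite expr0n mulr0 mul0r.
have -> : paraboloid r = (fun x => 1 - r ^+ 2 * (x^-1) ^+ 2).
  by apply/funext => x; rewrite /paraboloid exprMn.
have h : is_derive rho (1 : R) (fun x : R => x^-1) (- rho ^- 2 *: 1).
  exact: is_deriveV.
apply: is_derive_eq; rewrite /GRing.scale /=.
by rewrite -!exprVn; ring.
Qed.

Lemma is_derive_exp (u : R -> R) (x du : R) j : is_derive x (1 : R) u du ->
  is_derive x (1 : R) (fun y => u y ^+ j) (j%:R * u x ^+ j.-1 * du).
Proof.
move=> h; have := @is_deriveX _ _ u j x 1 du h.
rewrite (_ : u ^+ j = (fun y => u y ^+ j))//.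
by apply/funext => y; elim: j => [|j IHj]; rewrite ?expr0// !exprS -IHj.
Qed.

Lemma paraboloid_good (r : R) : 0 <= r -> forall rho : R, rho \in `[r, 1] -> r = 0 \/ rho != 0.
Proof.
move=> r0 rho; rewrite in_itv /= => /andP[h _]; move: r0; rewrite le_eqVlt => /orP[/eqP <-|r0];
  first by left.
by right; rewrite gt_eqF// (lt_le_trans r0).
Qed.

Lemma paraboloid_cont (r : R) : 0 <= r -> forall rho : R, rho \in `[r, 1] -> {for rho,
  continuous (paraboloid r)}.
Proof.
move=> r0 rho /(paraboloid_good r0) h; apply/differentiable_continuous/derivable1_diffP.
have := is_derive_bump1 h => ?; exact: ex_derive.
Qed.

Lemma paraboloid_integrable j (u : R -> R) (r : R) : continuous u -> 0 <= r ->
  mu.-integrable `[r, 1] (EFin \o (fun rho => paraboloid r rho ^+ j * u rho)).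
Proof.
move=> cu r0; apply: continuous_compact_integrable; first exact: segment_compact.
apply: continuous_in_subspaceT => rho /set_mem /= hr.
have -> : (fun rho => paraboloid r rho ^+ j * u rho) =
  ((fun x : R => x ^+ j) \o paraboloid r) \* u by [].
apply: continuousM; last exact: cu.
by apply: continuous_comp; [exact: (paraboloid_cont r0)|exact: exprn_continuous].
Qed.

(** With E = 1 - (r / rho)^2, the derivative of rho E^(K+1) f in rho is
    (2K+2) (E^K f - E^(K+1) g), for the g below.  Its integral over [r, 1] is 0 since
    E vanishes at rho = r and f at 1.  One derivative of f is traded for one power
    of E. *)
Lemma superposition_step m K (f : R -> R) : Cm m.+1 f -> exists g, Cm m g /\
  forall r, 0 <= r -> r < 1 ->
    \int[mu]_(rho in `[r, 1]) (paraboloid r rho ^+ K * f rho) =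
    \int[mu]_(rho in `[r, 1]) (paraboloid r rho ^+ K.+1 * g rho).
Proof.
move=> Cf; have [cf zf [f' [df hf']]] := Cf.
pose g x := (2 * K + 1)%:R / (2 * K.+1)%:R * f x + (- (2 * K.+1)%:R^-1) * (x * f' x).
have Cg : Cm m g by apply: Cm_lin; [exact: CmS|exact: Cm_mulx].
exists g; split => // r r0 r1.
have good := paraboloid_good r0; have cE := paraboloid_cont r0.
pose H rho := paraboloid r rho ^+ K * f rho - paraboloid r rho ^+ K.+1 * g rho.
(* (2K+2) H is the derivative of F, also at rho = 0 when r = 0, since then paraboloid is 1 *)
pose F rho := rho * paraboloid r rho ^+ K.+1 * f rho.
have dF rho : rho \in `[r, 1] -> is_derive rho (1 : R) F
   (paraboloid r rho ^+ K.+1 * f rho + rho * (K.+1%:R * paraboloid r rho ^+ K * (2 * r ^+ 2 *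
     rho^-1 ^+ 3)) * f rho
    + rho * paraboloid r rho ^+ K.+1 * f' rho).
  move=> /good h; have := is_derive_exp K.+1 (is_derive_bump1 h) => hE; have := df rho => ?.
  have -> : F = (fun x => x * (paraboloid r x ^+ K.+1 * f x)).
    by apply/funext => x; rewrite /F mulrA.
  apply: (@is_derive_eq _ _ _ _ _ _ _ _ (is_deriveM (is_derive_id rho 1) (is_deriveM hE (df rho)))).
  rewrite /GRing.scale /= -[X in _ + X * 1 = _]/(paraboloid r rho ^+ K.+1 * f rho).
  by ring.
have ci j (u : R -> R) (cu : continuous u) := paraboloid_integrable j cu r0.
have cg : continuous g := Cm_cont Cg.
have cH : {within `[r, 1], continuous (fun rho => (2 * K.+1)%:R * H rho)}.
  have -> : (fun rho => (2 * K.+1)%:R * H rho) =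
      (fun rho => paraboloid r rho ^+ K * ((2 * K.+1)%:R * f rho - paraboloid r rho * ((2 *
        K.+1)%:R * g rho))).
    by apply/funext => rho; rewrite /H exprSr; ring.
  apply: continuous_in_subspaceT => rho /set_mem /= hr.
  have cc (a : R) (u : R -> R) : continuous u -> {for rho, continuous (fun x => a * u x)}.
    by move=> cu; apply: continuousM; [exact: cst_continuous|exact: cu].
  have -> : (fun rho => paraboloid r rho ^+ K * ((2 * K.+1)%:R * f rho - paraboloid r rho *
    ((2 * K.+1)%:R * g rho))) =
     ((fun x : R => x ^+ K) \o paraboloid r) \* ((fun x => (2 * K.+1)%:R *
       f x) \- (paraboloid r \* (fun x => (2 * K.+1)%:R * g x))) by [].
  apply: continuousM.
    by apply: continuous_comp; [exact: cE|exact: exprn_continuous].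
  apply: continuousB; first exact: cc.
  by apply: continuousM; [exact: cE|exact: cc].
have Fr : F r = 0.
  rewrite /F /paraboloid; have [->|rn] := eqVneq r 0; first by rewrite !mul0r.
  by rewrite divff// expr1n subrr expr0n /= mulr0 mul0r.
have F1 : F 1 = 0 by rewrite /F zf ?mulr0//; exact: O1.
have inr : r \in `[r, 1] by rewrite in_itv /= lexx ltW.
have in1 : (1 : R) \in `[r, 1] by rewrite in_itv /= lexx ltW.
have cF rho : rho \in `[r, 1] -> {for rho, continuous F}.
  move=> hr; apply/differentiable_continuous/derivable1_diffP.
  by have ? := dF _ hr; exact: ex_derive.
have FTC := @continuous_FTC2 R (fun rho => (2 * K.+1)%:R * H rho) F r 1 r1 cH.
have D : derivable_oo_LRcontinuous F r 1.
  split.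
  - move=> rho hr; have ? := dF _ (subset_itv_oo_cc hr); exact: ex_derive.
  - by apply: cvg_at_right_filter; exact: cF.
  - by apply: cvg_at_left_filter; exact: cF.
have kn : (2 * K.+1)%:R != 0 :> R by rewrite pnatr_eq0.
have E : {in `]r, 1[, derive1 F =1 (fun rho => (2 * K.+1)%:R * H rho)}.
  move=> rho hr; have d := dF _ (subset_itv_oo_cc hr).
  rewrite derive1E (@derive_val _ _ _ _ _ _ _ d) /H /g.
  have rho0 : rho != 0.
    by move: hr; rewrite in_itv /= => /andP[h _]; rewrite gt_eqF// (le_lt_trans r0).
  have -> : rho * (K.+1%:R * paraboloid r rho ^+ K * (2 * r ^+ 2 * rho^-1 ^+ 3)) =
      (2 * K.+1)%:R * paraboloid r rho ^+ K * (1 - paraboloid r rho).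
    by rewrite /paraboloid natrM; field.
  rewrite exprSr natrM -natr1 natrD natrM.
  have K0 : K%:R + 1 != 0 :> R by rewrite natr1 pnatr_eq0.
  by field.
move: FTC => /(_ D E); rewrite Fr F1 subee// => I0.
have iH : mu.-integrable `[r, 1] (EFin \o H).
  by apply: eq_integrable (integrableB _ (ci K f cf) (ci K.+1 g cg)).
have : \int[mu]_(rho in `[r, 1]) ((2 * K.+1)%:R * H rho) = 0 by rewrite /Rintegral I0.
rewrite RintegralZl// => /eqP; rewrite mulf_eq0 (negbTE kn) /= /H RintegralB//;
  [|exact: ci|exact: ci].
by rewrite subr_eq0 => /eqP.
Qed.

(** The fundamental theorem of calculus, f being 0 at 1. *)
Lemma superposition_base m (f : R -> R) : Cm m.+1 f -> exists g, Cm m g /\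
  forall r, 0 <= r -> r < 1 -> \int[mu]_(rho in `[r, 1]) (paraboloid r rho ^+ 0 * g rho) = f r.
Proof.
move=> [cf zf [f' [df hf']]].
have Cg : Cm m (fun x => -1 * f' x + 0 * f' x) by exact: Cm_lin.
exists (fun x => -1 * f' x + 0 * f' x); split => // r r0 r1.
have cg := Cm_cont Cg.
pose F x := - f x.
have dF x : is_derive x (1 : R) F (-1 * f' x + 0 * f' x).
  by have := df x => ?; apply: is_derive_eq; rewrite mul0r addr0 mulN1r.
have cF : continuous F.
  move=> x; apply/differentiable_continuous/derivable1_diffP.
  by have ? := dF x; exact: ex_derive.
have D : derivable_oo_LRcontinuous F r 1.
  split.
  - move=> rho hr; have ? := dF rho; exact: ex_derive.
  - by apply: cvg_at_right_filter; exact: cF.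
  - by apply: cvg_at_left_filter; exact: cF.
have E : {in `]r, 1[, derive1 F =1 (fun x => -1 * f' x + 0 * f' x)}.
  by move=> rho hr; rewrite derive1E (@derive_val _ _ _ _ _ _ _ (dF rho)).
have FTC := @continuous_FTC2 R _ F r 1 r1 (continuous_subspaceT cg) D E.
rewrite /Rintegral.
rewrite (_ : (\int[mu]_(rho in `[r, 1%R]) _)%E = (\int[mu]_(x in `[r, 1%R]) (-1 * f' x +
  0 * f' x)%:E)%E); last first.
  by apply: eq_integral => rho _; rewrite expr0 mul1r.
by rewrite FTC /F zf ?oppr0 ?sub0e /= ?opprK//; exact: O1.
Qed.

Lemma superposition_closed K m (f : R -> R) : Cm (m + K).+1 f -> exists g, Cm m g /\
  forall r, 0 <= r -> r < 1 -> \int[mu]_(rho in `[r, 1]) (paraboloid r rho ^+ K * g rho) = f r.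
Proof.
elim: K m => [|K IHK] m hf; first by apply: superposition_base; rewrite addn0 in hf.
have [|g [Cg hg]] := IHK m.+1; first by rewrite addSnnS.
have [g2 [Cg2 hg2]] := superposition_step K Cg.
by exists g2; split => // r r0 r1; rewrite -hg2// hg.
Qed.

(** Iterate superposition_step from f(r) = - int_r^1 f'.  The truncation merges the
    lower end r of the interval into the integrand, so that the density does not
    depend on r. *)
Lemma superposition K (f : R -> R) : Cm K.+2 f -> exists g, continuous g /\
  forall r, 0 <= r ->
    \int[mu]_(rho in `]0, 1]) (Num.max (paraboloid r rho) 0 ^+ K.+1 * g rho) = f r.
Proof.
move=> hf; have [|g [[cg zg _] hg]] := @superposition_closed K.+1 0 f; first by rewrite add0n.
exists g; split => // r r0.
have small rho : 0 < rho -> rho <= r -> paraboloid r rho <= 0.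
  move=> h0 h1; rewrite /paraboloid subr_le0 exprn_ege1// ler_pdivlMr// mul1r//.
have [r1|r1] := leP 1 r.
  rewrite (Cm_zero hf (O1 r1)) /Rintegral integral0_eq// => rho /=;
    rewrite in_itv /= => /andP[h0 h1].
  by rewrite max_r ?small ?(le_trans h1)// expr0n mul0r.
rewrite -(hg r r0 r1) -[RHS]Rintegral_itv_obnd_cbnd; last first.
  apply: (integrableS _ _ _ (paraboloid_integrable K.+1 cg r0)) => //.
  exact: subset_itv_oc_cc.
rewrite Rintegral_mkcond [RHS]Rintegral_mkcond; apply: eq_Rintegral => rho _.
rewrite !patchE; case: ifPn => [|h1]; case: ifPn => [|h2] //.
- move=> /set_mem /=; rewrite in_itv /= => /andP[a1 a2] /set_mem /=;
    rewrite in_itv /= => /andP[b1 b2].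
  by rewrite max_l// /paraboloid subr_ge0 exprn_ile1 ?divr_ge0 ?(ltW b1)// ler_pdivrMr// mul1r ltW.
- move=> /set_mem /=; rewrite in_itv /= => /andP[b1 b2]; move: h2;
    rewrite notin_setE /= in_itv /= b2 andbT => /negP.
  by rewrite -leNgt => h; rewrite max_r ?small// expr0n mul0r.
- move=> /set_mem /=; rewrite in_itv /= => /andP[b1 b2]; move: h1;
    rewrite notin_setE /= in_itv /= b2 andbT => /negP.
  by rewrite -leNgt => h; have := le_lt_trans r0 b1; rewrite ltNge h.
Qed.

End superposition.

Lemma smooth_Cm {R : realType} (O : set R) (f : R -> R) : open O ->
  (forall x, O x -> f x = 0) -> smooth f -> forall m, Cm O m f.
Proof.
move=> oO zf sf m.
suff : forall k, Cm O m (derive1n k f) by move=> /(_ 0%N).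
have dk k x : is_derive x (1 : R) (derive1n k f) (derive1n k.+1 f x).
  by rewrite derive1nS derive1E; apply: derivableP; exact: sf.
have ck k : continuous (derive1n k f).
  move=> x; apply/differentiable_continuous/derivable1_diffP; exact: sf.
have zk k : forall x, O x -> derive1n k f x = 0.
  elim: k => [|k IHk] x Ox; first exact: zf.
  have h0 : is_derive x (1 : R) (derive1n k f) 0.
    apply: (near_eq_is_derive _ (is_derive_cst (0 : R) x (1 : R))).
    near=> y; rewrite IHk//; near: y.
    exact: open_nbhs_nbhs.
  by rewrite -[LHS](@derive_val _ _ _ _ _ _ _ (dk k x)) (@derive_val _ _ _ _ _ _ _ h0).
elim: m => [|m IHm] k; (split; [exact: ck|exact: zk|]) => //.
by exists (derive1n k.+1 f); split => // x; exact: dk.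
Unshelve. all: end_near. Qed.

(** * The kernel with a smooth radial cutoff *)

Section radial.
Context {R : realType} {n : nat}.
Local Notation E := (euclid R n).
Local Notation mu := (@lebesgue_measure R).
Local Notation mun := (@lebesgue_measuren R n).
Local Notation N := (2 * n.+1)%N.

Section fixed_parameters.
Variables (g : R -> R) (B eps : R) (f : E -> R).
Hypotheses (cg : continuous g) (B0 : 0 <= B) (hB : forall rho, 0 < rho -> rho <=
  1 -> `|g rho| <= B).
Hypotheses (eps0 : 0 < eps) (mf : measurable_fun setT f) (f1 : forall xi, `|f xi| <= 1).

Let inI (rho : R) := (0 < rho) && (rho <= 1).
Let dlt (rho : R) := eps ^+ 2 * rho `^ (- 2).
Let L := 1 + eps^-1.

(** The integrand in which the radial cutoff is replaced by its superposition, as a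
    function of xi and of the scale rho.  At scale rho, a truncated power in
    eps |xi| / rho is a ballcut with parameter (eps / rho)^2. *)
Definition layer (p : E * measurableTypeR R) : R :=
  if inI p.2 then f p.1 * ballcut (dlt p.2) p.1 ^+ N.+1 * g p.2 else 0.

Let dltE rho : 0 < rho -> dlt rho = (eps / rho) ^+ 2.
Proof. by move=> r0; rewrite /dlt powRN powR_mulrn ?ltW// expr_div_n. Qed.

Let mbump2 : measurable_fun setT (fun p : E * measurableTypeR R => ballcut (dlt p.2) p.1).
Proof.
apply: measurable_maxr => //; apply: measurable_funB => //; apply: measurable_funM.
  apply: measurable_funM => //.
  by apply: (measurableT_comp (@measurable_powR R (- 2))).
apply: measurable_funB => //; apply: measurable_funX.
exact: (measurableT_comp (@measurable_jbracket R n)).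
Qed.

Lemma measurable_layer : measurable_fun setT layer.
Proof.
have m2 : measurable_fun setT (fun p : E * measurableTypeR R => p.2 : R) by exact: measurable_snd.
apply: measurable_fun_ifT => //.
  by apply: measurable_and; [exact: measurable_fun_ltr|exact: measurable_fun_ler].
apply: measurable_funM; last exact: (measurableT_comp (continuous_measurable_fun cg) m2).
apply: measurable_funM; first exact: (measurableT_comp mf).
exact: measurable_funX.
Qed.

Let ballcut_out (xi : E) rho : inI rho -> ~ jball L xi -> ballcut (dlt rho) xi = 0.
Proof.
move=> /andP[r0 r1] /negP; rewrite /jball /= -ltNge => hL.
rewrite /ballcut max_r// subr_le0 dltE//.
have e0 : 0 < eps^-1 by rewrite invr_gt0.
have h1 : eps^-1 ^+ 2 <= jbracket xi ^+ 2 - 1.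
  have h2 : L * L <= jbracket xi * jbracket xi.
    by apply: ler_pM => //; rewrite ?addr_ge0 ?(ltW e0) ?(ltW hL).
  by rewrite /L in h2; rewrite !expr2; lra.
have h3 : 1 <= (eps / rho) ^+ 2 * eps^-1 ^+ 2.
  by rewrite -exprMn mulrAC divff ?gt_eqF// mul1r exprn_ege1// invf_ge1.
by apply: le_trans h3 _; rewrite ler_wpM2l// sqr_ge0.
Qed.

Let layer_out xi rho : ~ jball L xi -> layer (xi, rho) = 0.
Proof.
move=> h; rewrite /layer /=; case: ifPn => // hI.
by rewrite ballcut_out// expr0n /= mulr0 mul0r.
Qed.

Let fcut_bd (xi : E) rho : inI rho -> `|f xi * ballcut (dlt rho) xi ^+ N.+1| <= 1.
Proof.
move=> /andP[r0 r1].
have d0 : 0 < dlt rho by rewrite dltE// exprn_gt0// divr_gt0.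
have /andP[b0 b1] := ballcut01 xi d0.
have c0 : 0 <= ballcut (dlt rho) xi ^+ N.+1 by rewrite exprn_ge0.
have c1 : ballcut (dlt rho) xi ^+ N.+1 <= 1 by rewrite exprn_ile1.
by rewrite normrM (ger0_norm c0) mulr_ile1.
Qed.

Let layer_bd xi rho : `|layer (xi, rho)| <= if inI rho then B else 0.
Proof.
rewrite /layer /=; case: ifPn => [hI|_]; last by rewrite normr0.
rewrite normrM -[leRHS]mul1r ler_pM ?fcut_bd//.
by have /andP[r0 r1] := hI; exact: hB.
Qed.

Let layer_bd1 xi rho : `|layer (xi, rho)| <= B.
Proof. by rewrite (le_trans (layer_bd xi rho))//; case: ifP. Qed.

Let J : set (measurableTypeR R) := `]0, 1]%classic.
Let mJ : measurable J. Proof. exact: measurable_itv. Qed.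
Let muJ : lebesgue_measure J = 1%:E.
Proof. by rewrite lebesgue_measure_itv /= lte_fin ltr01 sube0. Qed.
Let inJ rho : (\1_J rho : R) = if inI rho then 1 else 0.
Proof.
rewrite indicE; have [|/negP h] := boolP (rho \in J).
  by rewrite inE /J /= in_itv /= /inI => ->.
case: ifPn => // h2; exfalso; apply: h; rewrite inE /J /= in_itv /=; exact: h2.
Qed.

Let iJ : mu.-integrable setT (fun rho => (\1_J rho)%:E).
Proof.
apply/integrableP; split; first by apply/measurable_EFinP; exact: measurable_indic.
under eq_integral do rewrite gee0_abs ?lee_fin//.
by rewrite integral_indic// setIT [X in (X < _)%E]muJ ltry.
Qed.

Let layer_bdJ xi rho : `|layer (xi, rho)| <= B * \1_J rho.
Proof. by rewrite (le_trans (layer_bd xi rho))// inJ; case: ifP; rewrite ?mulr1 ?mulr0. Qed.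

Let mlay1 xi : measurable_fun setT (fun rho => layer (xi, rho)).
Proof. by apply: (measurableT_comp measurable_layer); exact: pair1_measurable. Qed.

Let mlay2 rho : measurable_fun setT (fun xi => layer (xi, rho)).
Proof. by apply: (measurableT_comp measurable_layer); exact: pair2_measurable. Qed.

Let ilay1 xi : mu.-integrable setT (EFin \o (fun rho => layer (xi, rho))).
Proof.
apply: (le_integrable measurableT _ _ (integrableZl measurableT B iJ)).
  exact/measurable_EFinP.
move=> rho _ /=; rewrite lee_fin (le_trans (layer_bdJ _ _))//.
exact: ler_norm.
Qed.

Let ilay2 rho : mun.-integrable setT (EFin \o (fun xi => layer (xi, rho))).
Proof.
apply: (@bounded_jball_integrable _ _ _ L B); first exact: mlay2.
- by move=> xi h; exact: layer_out.
- by move=> xi _; exact: layer_bd1.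
Qed.

Let ilay : (mun \x mu)%E.-integrable setT (EFin \o layer).
Proof.
apply/integrable12ltyP; first by apply/measurable_EFinP; exact: measurable_layer.
apply: (@le_lt_trans _ _ (\int[mun]_xi (B%:E * (\1_(jball L) xi)%:E))%E).
  apply: ge0_le_integral => //.
  - by move=> xi _; exact: integral_ge0.
  - have ma : measurable_fun setT (fun p : E * measurableTypeR R => `|layer p|%:E).
      by apply/measurable_EFinP; apply: measurableT_comp => //; exact: measurable_layer.
    exact: (@measurable_fun_fubini_tonelli_F _ _ _ _ _ mu (fun p => `|layer p|%:E) ma).
  - by apply: measurable_funeM; apply/measurable_EFinP; apply: measurable_indic;
      exact: measurable_jball.
  move=> xi _ /=; have [h|h] := pselect (jball L xi); last first.
    by rewrite integral0_eq ?mule_ge0 ?lee_fin// => rho _; rewrite layer_out// normr0.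
  rewrite indicE mem_set// mule1.
  apply: (@le_trans _ _ (\int[mu]_rho (B%:E * (\1_J rho)%:E))%E).
    apply: ge0_le_integral => //.
    - by apply/measurable_EFinP; apply: measurableT_comp => //; exact: mlay1.
    - by apply: measurable_funeM; apply/measurable_EFinP; exact: measurable_indic.
    - by move=> rho _; rewrite -EFinM lee_fin layer_bdJ.
  rewrite ge0_integralZl//; last by apply/measurable_EFinP; exact: measurable_indic.
  by rewrite integral_indic// setIT [X in (_ * X <= _)%E]muJ mule1.
rewrite ge0_integralZl//; last by apply/measurable_EFinP; apply: measurable_indic;
  exact: measurable_jball.
rewrite integral_indic ?setIT//; last exact: measurable_jball.
by rewrite lte_mul_pinfty// ?ge0_fin_numE ?jball_fin// ltry.
Qed.

(** Fubini for layer, which is bounded and supported in a bounded set because all the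
    truncated powers are supported in |xi| <= 1 / eps. *)
Lemma layer_integral (phi : R -> R) (K : R) :
  0 <= K ->
  (forall r, 0 <= r -> \int[mu]_(rho in `]0, 1]) (Num.max (paraboloid r rho) 0 ^+ N.+1 *
    g rho) = phi r) ->
  (forall dl, 0 < dl -> `|\int[mun]_xi (f xi * ballcut dl xi ^+ N.+1)| <= K) ->
  `|\int[mun]_xi (f xi * phi (eps * enorm xi))| <= B * K.
Proof.
move=> K0 hphi hK.
have sl xi : (f xi * phi (eps * enorm xi))%:E = (\int[mu]_rho (layer (xi, rho))%:E)%E.
  have e0 : 0 <= eps * enorm xi by rewrite mulr_ge0 ?sqrtr_ge0 ?(ltW eps0).
  rewrite -(hphi _ e0).
  rewrite -[RHS]fineK; last exact: (integrable_fin_num measurableT (ilay1 xi)).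
  congr EFin; rewrite -[RHS]/(\int[mu]_rho layer (xi, rho)).
  pose w : R -> R := (fun rho => Num.max (paraboloid (eps * enorm xi) rho) 0 ^+ N.+1 *
    g rho) \_ `]0, 1].
  have lE rho : layer (xi, rho) = f xi * w rho.
    rewrite /layer /w patchE /=; case: ifPn => hI; last first.
      by rewrite memNset ?mulr0// /= in_itv; exact/negP.
    rewrite mem_set; last by rewrite /= in_itv.
    have /andP[r0 r1] := hI.
    have rE : jbracket xi ^+ 2 - 1 = enorm xi ^+ 2 by rewrite enorm_sqr jbracket_sqr; ring.
    have -> : ballcut (dlt rho) xi = Num.max (paraboloid (eps * enorm xi) rho) 0.
      by rewrite /ballcut /paraboloid dltE// rE -exprMn [eps / rho * _]mulrAC.
    by rewrite -mulrA.
  rewrite Rintegral_mkcond -/w.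
  (* integrability of w comes from that of layer, by dividing by f xi *)
  have [f0|f0] := eqVneq (f xi) 0.
    rewrite f0 mul0r /Rintegral integral0_eq// => rho _.
    by rewrite lE f0 mul0r.
  have iw : mu.-integrable setT (EFin \o w).
    apply: eq_integrable (integrableZl measurableT (f xi)^-1 (ilay1 xi)) => // rho _ /=.
    by rewrite -EFinM lE mulKf.
  by rewrite -RintegralZl//; apply: eq_Rintegral => rho _; rewrite lE.
have BK0 : (0 <= (B * K)%:E)%E by rewrite lee_fin mulr_ge0.
have -> : \int[mun]_xi (f xi * phi (eps * enorm xi)) =
  fine (\int[mun]_xi \int[mu]_rho (layer (xi, rho))%:E)%E.
  by rewrite /Rintegral; congr fine; apply: eq_integral => xi _; exact: sl.
rewrite (Fubini ilay).
have hle : (`|\int[mu]_rho \int[mun]_xi (layer (xi, rho))%:E| <= (B * K)%:E)%E.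
  apply: (le_trans (le_abse_integral _ _ _)) => //.
    exact: (measurable_fubini_G ilay).
  apply: (@le_trans _ _ (\int[mu]_rho ((B * K)%:E * (\1_J rho)%:E))%E).
    apply: ge0_le_integral => //.
    - by apply: measurableT_comp => //; exact: (measurable_fubini_G ilay).
    - by apply: measurable_funeM; apply/measurable_EFinP; exact: measurable_indic.
    - move=> rho _; rewrite -EFinM -EFin_normr_Rintegral// lee_fin inJ.
      case: ifPn => [hI|hI]; last first.
        by rewrite mulr0 /layer /= (negbTE hI) Rintegral_cst ?mul0r ?normr0.
      rewrite mulr1; have /andP[r0 r1] := hI.
      have d0 : 0 < dlt rho by rewrite dltE// exprn_gt0// divr_gt0.
      rewrite /layer /= hI RintegralZr//; last first.
        apply: (@bounded_jball_integrable _ _ _ L 1).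
        - apply: measurable_funM => //; apply: measurable_funX; exact: measurable_ballcut.
        - by move=> xi h; rewrite ballcut_out// expr0n mulr0.
        - by move=> xi _; exact: fcut_bd.
      by rewrite normrM mulrC ler_pM// ?hB// hK.
  rewrite ge0_integralZl//; last by apply/measurable_EFinP; exact: measurable_indic.
  by rewrite integral_indic// setIT [X in (_ * X <= _)%E]muJ mule1.
move: hle; set z := (\int[mu]_rho \int[mun]_xi _)%E.
by case: z => [r| |] //=; rewrite lee_fin// normr0 mulr_ge0.
Qed.

End fixed_parameters.

Lemma radial_bound (O : set R) (phi : R -> R) : (forall x, 1 <= x -> O x) -> Cm O N.+2 phi ->
  exists C, 0 <= C /\ forall x t kap c eps, t != 0 -> 0 < eps ->
    `|\int[mun]_xi (amplitude xi * cos (phase x t kap c xi) * phi (eps * enorm xi))| <=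
    C * (1 + `|kap|) ^+ N * `|t| `^ (- (n%:R / 2)).
Proof.
move=> O1 hphi; have [g [cg hg]] := superposition O1 hphi.
have [B [B0 hB]] : exists B, 0 <= B /\ forall rho, 0 < rho -> rho <= 1 -> `|g rho| <= B.
  have cn : {within `[0, 1], continuous (fun rho => `|g rho|)}.
    by apply: continuous_subspaceT => x; apply: continuous_comp; [exact: cg|exact: norm_continuous].
  have [m _ hm] := EVT_max (@ler01 R) cn.
  exists `|g m|; split => // rho r0 r1; apply: hm.
  by rewrite in_itv /= (ltW r0).
have [C [C0 hC]] := @cutoff_bound R n.
exists (B * C); split; first exact: mulr_ge0.
move=> x t kap c eps t0 e0.
rewrite -!mulrA [C * _]mulrA.
apply: (layer_integral cg B0 hB e0) => //.
- by apply: measurable_funM; [exact: measurable_amplitude|exact: measurable_cosphase].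
- move=> xi; have /andP[a0 a1] := amplitude01 xi.
  by rewrite normrM (ger0_norm a0) mulr_ile1// norm_cos_le1.
- by rewrite !mulr_ge0// ?powR_ge0// exprn_ge0// addr_ge0.
- move=> dl d0; apply: le_trans (hC x t kap c dl t0 d0).
  rewrite le_eqVlt; apply/orP; left; apply/eqP; congr `|_|.
  by apply: eq_Rintegral => xi _; rewrite mulrAC.
Qed.

End radial.

(** * The complex kernel *)

Section kernel_bound.
Context {R : realType} {d : nat}.
Local Notation E := (euclid R d).
Local Notation mun := (@lebesgue_measuren R d).
Local Notation N := (2 * d.+1)%N.

Lemma normc_le_ReIm (z : R[i]) :
  ComplexField.Normc.normc z <= `|complex.Re z| + `|complex.Im z|.
Proof.
case: z => a b /=; rewrite -[leRHS]ger0_norm ?addr_ge0// -sqrtr_sqr ler_wsqrtr//.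
rewrite -(real_normK (num_real a)) -(real_normK (num_real b)) sqrrD.
by rewrite [leRHS]addrAC lerDl mulrn_wge0// mulr_ge0.
Qed.

(** Real and imaginary parts both become sums of terms with a cosine, the sine being
    absorbed in the constant of the phase. *)
Lemma kernel_integrand (psi : R -> R[i]) kappa eps (x xi : E) t :
  expC (0 +i* (dotr x xi + t * jbracket xi))%C * psi (eps * enorm xi) *
    powRC (1 + enorm xi ^+ 2) ((- ((d%:R + 2) / 4)) -i* kappa)%C =
  ((amplitude xi * cos (phase x t kappa 0 xi) * complex.Re (psi (eps * enorm xi)) +
    amplitude xi * cos (phase x t kappa (pi / 2) xi) * complex.Im (psi (eps * enorm xi))) +i*
   (amplitude xi * cos (phase x t kappa (- (pi / 2)) xi) * complex.Re (psi (eps * enorm xi)) +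
    amplitude xi * cos (phase x t kappa 0 xi) * complex.Im (psi (eps * enorm xi))))%C.
Proof.
have j0 := jbracket_gt0 xi.
have phc c : phase x t kappa c xi = phase x t kappa 0 xi + c by rewrite /phase addr0.
rewrite (phc (pi / 2)) (phc (- (pi / 2))) cosDpihalf cosBpihalf.
set T := phase x t kappa 0 xi.
have TE : T = (dotr x xi + t * jbracket xi) - kappa * (2 * ln (jbracket xi)).
  by rewrite /T /phase addr0 [t * _ + _]addrC.
have lE : ln (1 + enorm xi ^+ 2) = 2 * ln (jbracket xi).
  by rewrite enorm_sqr -jbracket_sqr lnXn// mulr_natl.
have aE : amplitude xi = expR (- ((d%:R + 2) / 4) * (2 * ln (jbracket xi))).
  by rewrite /amplitude /powR gt_eqF//; congr expR; field.
case: (psi (eps * enorm xi)) => p q.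
rewrite /powRC /expC lE /= !mulr0 !subr0 add0r expR0 !mul1r -aE mulNr.
by rewrite {1 2 3 4}TE cosB sinB; congr (_ +i* _)%C; rewrite cosN sinN; ring.
Qed.

Lemma integrable_radial (phi : R -> R) kap eps (x : E) t c :
  continuous phi -> (forall r, 1 <= r -> phi r = 0) -> 0 < eps ->
  mun.-integrable setT
    (EFin \o (fun xi => amplitude xi * cos (phase x t kap c xi) * phi (eps * enorm xi))).
Proof.
move=> cphi phi0 e0.
have [B hB] : exists B, forall r, 0 <= r -> r <= 1 -> `|phi r| <= B.
  have cn : {within `[0, 1], continuous (fun r => `|phi r|)}.
    by apply: continuous_subspaceT => r; apply: continuous_comp;
      [exact: cphi|exact: norm_continuous].
  have [m _ hm] := EVT_max (@ler01 R) cn.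
  by exists `|phi m|; move=> r r0 r1; apply: hm; rewrite in_itv /= r0.
have B0 : 0 <= B by exact: le_trans (hB 0 _ _).
have me : measurable_fun setT (@enorm R d).
  have ms : measurable_fun setT (@Num.sqrt R).
    by apply: continuous_measurable_fun => r; exact: sqrt_continuous.
  exact: (measurableT_comp ms (@measurable_normsq R d)).
(* the integrand vanishes for |xi| >= 1 / eps, and <xi> <= 1 + |xi| *)
apply: (@bounded_jball_integrable _ _ _ (1 + eps^-1) B).
- apply: measurable_funM.
    by apply: measurable_funM; [exact: measurable_amplitude|exact: measurable_cosphase].
  apply: (measurableT_comp (continuous_measurable_fun cphi)).
  exact: measurable_funM.
- move=> xi /negP; rewrite /jball /= -ltNge => hL.
  rewrite phi0 ?mulr0// mulrC -ler_pdivrMr// mul1r.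
  have i0 : 0 < eps^-1 by rewrite invr_gt0.
  rewrite -ler_sqr ?nnegrE ?sqrtr_ge0 ?(ltW i0)// enorm_sqr.
  have h : (1 + eps^-1) * (1 + eps^-1) <= jbracket xi * jbracket xi.
    by apply: ler_pM => //; rewrite ?addr_ge0 ?(ltW i0) ?(ltW hL).
  by rewrite -!expr2 jbracket_sqr in h; rewrite expr2 in h *; lra.
- move=> xi _; have /andP[a0 a1] := amplitude01 xi.
  rewrite !normrM (ger0_norm a0) -[leRHS]mul1r ler_pM ?mulr_ge0//.
    by rewrite mulr_ile1// norm_cos_le1.
  have e1 : 0 <= eps * enorm xi by rewrite mulr_ge0 ?sqrtr_ge0 ?(ltW e0).
  have [h|h] := leP (eps * enorm xi) 1; first exact: hB.
  by rewrite phi0 ?(ltW h)// normr0.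
Qed.

Lemma C0infty_off_support (psi : R -> R[i]) : C0infty (-1) 1 psi ->
  exists O : set R, [/\ open O, (forall r, 1 <= r -> O r) & (forall r, O r -> psi r = 0)].
Proof.
move=> [_ _ _ hs]; exists (~` closure [set r : R | psi r != 0]); split.
- by apply: closed_openC; exact: closed_closure.
- move=> r r1 /= /hs; rewrite /= in_itv /= => /andP[_].
  by rewrite ltNge r1.
- move=> r h; apply/eqP/negP => /negP hr; apply: h.
  exact: subset_closure.
Qed.

Lemma kernelK_bound (psi : R -> R[i]) : C0infty (-1) 1 psi ->
  exists C, forall kappa eps (x : E) t, 0 < eps -> t != 0 ->
    ComplexField.Normc.normc (kernelK psi kappa eps x t) <=
    C * (1 + `|kappa|) ^+ N * `|t| `^ (- (d%:R / 2)).
Proof.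
move=> hpsi; have [U [oU U1 zU]] := C0infty_off_support hpsi.
have [sR sI] : smooth (fun r => complex.Re (psi r)) /\ smooth (fun r => complex.Im (psi r)).
  by case: hpsi.
have cR : forall m, Cm U m (fun r => complex.Re (psi r)).
  by apply: smooth_Cm => // r Ur; rewrite zU.
have cI : forall m, Cm U m (fun r => complex.Im (psi r)).
  by apply: smooth_Cm => // r Ur; rewrite zU.
have [C1 [C10 h1]] := @radial_bound R d U _ U1 (cR _).
have [C2 [C20 h2]] := @radial_bound R d U _ U1 (cI _).
exists (C1 + C2 + (C1 + C2)); move=> kappa eps x t e0 t0.
apply: (le_trans (normc_le_ReIm _)).
have iR c := integrable_radial kappa x t c (Cm_cont (cR 0%N))
  (fun r r1 => Cm_zero (cR 0%N) (U1 r r1)) e0.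
have iI c := integrable_radial kappa x t c (Cm_cont (cI 0%N))
  (fun r r1 => Cm_zero (cI 0%N) (U1 r r1)) e0.
rewrite /kernelK /Cintegral /=.
under eq_Rintegral do rewrite kernel_integrand /=.
under [X in _ + `|X|]eq_Rintegral do rewrite kernel_integrand /=.
rewrite !RintegralD//; try exact: iR; try exact: iI.
rewrite -[leRHS]mulrA !mulrDl !mulrA.
by apply: lerD; (apply: (le_trans (ler_normD _ _)); apply: lerD; [exact: h1|exact: h2]).
Qed.

End kernel_bound.

Unset Implicit Arguments.
Unset Printing Implicit Defensive.
Set Strict Implicit.

Theorem proposition3p4 (R : realType) (d : nat) (hd : (1 <= d)%N)
    (psi : R -> R[i]) (hpsi : C0infty (-1) 1 psi) :
  exists C N : R, 0 < N /\
    forall (kappa eps : R) (x : euclid R d) (t : R), 0 < eps ->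
      ((ComplexField.Normc.normc (kernelK psi kappa eps x t))%:E <=
        if (t == 0)%R then +oo
        else (C * (1 + `|kappa|) `^ N * `|t| `^ (- (d%:R / 2)))%:E)%E.
Proof.
have [C hC] := @kernelK_bound R d psi hpsi.
exists C, (2 * d.+1)%:R; split; first by rewrite ltr0n.
move=> kappa eps x t e0; case: ifPn => [_|t0]; first exact: leey.
by rewrite lee_fin powR_mulrn ?addr_ge0// hC.
Qed.
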